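(* Let $\{X_t: t\ge 0\}$ be a purely non-Gaussian $d$-dimensional Lévy process with $X_0=0$ and Lévy measure $\Pi$. Let $\lambda\ge0$, let $q\in[0,1]$ and $h\in\mathcal{H}_q$, and let $b(t)=\sqrt{t\log\log(1/t)}/h(1/t)$ for all sufficiently small $t>0$. Assume that $$\limsup_{t\downarrow0}V(b(t))\,h^2(1/t)\ge\lambda^2/2.$$ Then with probability one, $$\limsup_{t\downarrow0}h(1/t)\frac{|X_t|}{\sqrt{t\log\log(1/t)}}\ge(1-q)^{1/2}\lambda.$$
   Context: A $d$-dimensional Lévy process with $X_0=0$ has characteristic triplet $(\gamma,\Sigma,\Pi)$ with $\gamma\in\mathbb{R}^d$, $\Sigma$ symmetric non-negative definite and $\Pi$ a Lévy measure on $\mathbb{R}^d$ ($\Pi(\{0\})=0$, $\int(1\wedge|y|^2)\Pi(dy)<\infty$); it is purely non-Gaussian if $\Sigma=0$. $|\cdot|$ is the Euclidean norm, $\langle\cdot,\cdot\rangle$ the inner product. $V(t)=\sup_{|z|\le1}\int_{|y|\le t}\langle y,z\rangle^2\,\Pi(dy)$, $t\ge0$. $\mathcal{H}_1$ is the class of continuous non-decreasing functions $h:[0,\infty)\to[0,\infty)$ slowly varying at infinity. With $f_\tau(x)=\exp((\log x)^\tau)$, $x\ge1$, for $0\le q<1$ the class $\mathcal{H}_q$ consists of those $h\in\mathcal{H}_1$ with $h(xf_\tau(x))/h(x)\to1$ as $x\to\infty$ for every $0\le\tau<1-q$. *)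

(* Defs.v *)
From HB Require Import structures.
From mathcomp Require Import all_boot all_order all_algebra.
From mathcomp Require Import all_classical all_reals all_analysis.
Import Order.TTheory GRing.Theory Num.Theory.
Import numFieldNormedType.Exports.

Set Implicit Arguments.
Unset Strict Implicit.
Unset Printing Implicit Defensive.

Local Open Scope classical_set_scope.
Local Open Scope ring_scope.

Section LevyDefs.
Variable R : realType.

(* R^d is represented by d.-tuple R, carrying the product (= Borel) sigma-algebra
   of mathcomp-analysis (measurable_structure.v, section measurable_tuple). *)

Definition tdot (d : nat) (x y : d.-tuple R) : R := \sum_(i < d) tnth x i * tnth y i.
Definition tnorm (d : nat) (x : d.-tuple R) : R := Num.sqrt (tdot x x).
Definition tsub (d : nat) (x y : d.-tuple R) : d.-tuple R :=
  [tuple tnth x i - tnth y i | i < d].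
Definition tzero (d : nat) : d.-tuple R := [tuple (0 : R) | i < d].

Definition qform (d : nat) (S : 'M[R]_d) (z : d.-tuple R) : R :=
  \sum_(i < d) \sum_(j < d) tnth z i * S i j * tnth z j.

Definition levy_measure (d : nat) (Pi : {measure set (d.-tuple R) -> \bar R}) : Prop :=
  Pi [set tzero d] = 0%E /\
  (\int[Pi]_y (Num.min 1 (tnorm y ^+ 2))%:E < +oo)%E.

(* Levy-Khintchine exponent psi(z) = i<gamma,z> - <z,Sigma z>/2
     + int (e^{i<z,y>} - 1 - i<z,y> 1_{|y|<=1}) Pi(dy),
   split into its real and imaginary parts. *)
Definition LK_re (d : nat) (S : 'M[R]_d) (Pi : {measure set (d.-tuple R) -> \bar R})
  (z : d.-tuple R) : R :=
  - (qform S z) / 2 + Rintegral Pi setT (fun y => cos (tdot z y) - 1).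

Definition LK_im (d : nat) (g : d.-tuple R) (Pi : {measure set (d.-tuple R) -> \bar R})
  (z : d.-tuple R) : R :=
  tdot g z + Rintegral Pi setT
    (fun y => sin (tdot z y) - (if tnorm y <= 1 then tdot z y else 0)).

Definition rv_indep (dT : measure_display) (T : measurableType dT)
  (P : probability T R) (d n : nat) (Y : 'I_n -> T -> d.-tuple R) : Prop :=
  forall B : 'I_n -> set (d.-tuple R), (forall k, measurable (B k)) ->
    P (\bigcap_(k in setT) (Y k @^-1` B k)) = (\prod_(k < n) P (Y k @^-1` B k))%E.

Definition cadlag (d : nat) (f : R -> d.-tuple R) : Prop :=
  forall i : 'I_d,
    (forall t, 0 <= t -> (tnth (f s) i) @[s --> t^'+] --> tnth (f t) i) /\
    (forall t, 0 < t -> exists l : R, (tnth (f s) i) @[s --> t^'-] --> l).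

(* X is a d-dimensional Levy process with X_0 = 0 and characteristic triplet
   (g, S, Pi): X_0 = 0, independent increments, and the increments
   X_t - X_s (0 <= s <= t) have characteristic function exp((t-s) psi(z))
   (hence stationary increments), with a.s. cadlag paths. *)
Definition is_levy_process (dT : measure_display) (T : measurableType dT)
  (P : probability T R) (d : nat) (X : R -> T -> d.-tuple R)
  (g : d.-tuple R) (S : 'M[R]_d) (Pi : {measure set (d.-tuple R) -> \bar R}) : Prop :=
  [/\ (forall t, 0 <= t -> measurable_fun setT (X t)),
      (forall w, X 0 w = tzero d),
      (forall (n : nat) (t : nat -> R), 0 <= t 0%N ->
          (forall k, (k < n)%N -> t k < t k.+1) ->
          rv_indep P (fun (k : 'I_n) w => tsub (X (t k.+1) w) (X (t k) w))),
      (forall (s t : R) (z : d.-tuple R), 0 <= s -> s <= t ->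
          (\int[P]_w (cos (tdot z (tsub (X t w) (X s w))))%:E =
             (expR ((t - s) * LK_re S Pi z) * cos ((t - s) * LK_im g Pi z))%:E)%E /\
          (\int[P]_w (sin (tdot z (tsub (X t w) (X s w))))%:E =
             (expR ((t - s) * LK_re S Pi z) * sin ((t - s) * LK_im g Pi z))%:E)%E)
    & {ae P, forall w, cadlag (fun t => X t w)} ].

Definition limsup0 (f : R -> \bar R) : \bar R := limf_esup f (0 : R)^'+.

Definition Vfun (d : nat) (Pi : {measure set (d.-tuple R) -> \bar R}) (t : R) : \bar R :=
  ereal_sup [set (\int[Pi]_(y in [set y | (tnorm y <= t)%R]) ((tdot y z) ^+ 2)%:E)%E
            | z in [set z : d.-tuple R | tnorm z <= 1]].

Definition slowly_varying (h : R -> R) : Prop :=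
  (exists A : R, forall x, A <= x -> 0 < h x) /\
  forall c : R, 0 < c -> (h (c * x) / h x) @[x --> +oo] --> (1 : R).

Definition H1 (h : R -> R) : Prop :=
  [/\ {within `[0, +oo[, continuous h},
      (forall x, 0 <= x -> 0 <= h x),
      (forall x y, 0 <= x -> x <= y -> h x <= h y)
    & slowly_varying h].

Definition ftau (tau x : R) : R := expR (ln x `^ tau).

(* class H_q, q in [0,1]; for q = 1 the extra condition is vacuous, so H_q = H_1 *)
Definition Hq (q : R) (h : R -> R) : Prop :=
  H1 h /\ forall tau : R, 0 <= tau -> tau < 1 - q ->
    (h (x * ftau tau x) / h x) @[x --> +oo] --> (1 : R).

End LevyDefs.

(* Main.v *)
(* Project the process on a unit vector z, and write psi(t) for the integral of
   1 - cos(t<z,y>) against Pi. The difference of two independent copies of an increment over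
   a time r has characteristic function exp(-2 r psi), which involves neither the drift nor
   the compensator. As r tends to 0, integrating this transform against the kernel of a
   trapezoid shows that the second moment of the difference, truncated at level 2b, is at
   least about 2 r v, where v is the integral of <y,z>^2 over |<y,z>| <= b, while the mass
   beyond 2b is O(r). So an increment over a time u is a sum of n independent increments
   which, outside events of probability O(1/n), are bounded by a multiple of b around their
   mean and have total variance about u v. Their moment generating functions are close to
   Gaussian ones for arguments small with respect to 1/b, and this gives
   P(|increment| >= x) >= exp(-(1+e) x^2 / (2 u v)) / 4 when x^2/(u v) is large and
   b x/(u v) is small.

   Take t small, with a direction z that almost attains V(b(t)), and put L = log(1/t). The
   function h is almost constant between 1/t and exp(-L^tau / 2)/t for tau < 1 - q, by the
   definition of H_q, so that at the order of L^tau geometric scales between t and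
   t exp(L^tau / 2) an increment exceeds the required level with probability at least
   L^(-theta)/4, where theta < tau. By independence, all of them fail with a probability that
   tends to 0 with t; a path staying below the level near 0 fails at every small t. *)
Require Import Defs.
From HB Require Import structures.
From mathcomp Require Import all_boot all_order all_algebra.
From mathcomp Require Import all_classical all_reals all_analysis.
From mathcomp Require Import measurable_realfun ring lra.
Import Order.TTheory GRing.Theory Num.Theory.
Import numFieldNormedType.Exports.
Local Open Scope classical_set_scope.
Local Open Scope ring_scope.

Set Implicit Arguments.
Unset Strict Implicit.
Unset Printing Implicit Defensive.

(** * The trapezoid as a cosine transform *)

(** The process enters only through the characteristic function of its increments; no splitting into
    small and large jumps is used. Truncated moments are therefore recovered in the limit of short
    spans, where the law of a symmetrized increment divided by its span approaches the Lévy measure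
    on even test functions. What is lost when the symmetrization is undone is of second order in the
    span. This is why an increment is cut into n pieces, with n depending on b, u and v, and why the
    final bound must be free of n. The pieces falling outside their good event cannot be excluded by
    a union bound, since their expected number need not be small: they are counted, and the
    displacement they cause is countered by choosing the sign of the deviation of the others.

    Origin of the factor (1-q)^(1/2): if a is the value to be exceeded, the squared level over twice
    the variance is close to (a^2 / lam^2) log log (1/t), so theta is close to a^2 / lam^2. About
    L^tau scales are available with tau < 1 - q, and theta < tau can be arranged exactly when a^2 <
    (1 - q) lam^2. *)

Section trig_bounds.
Context {R : realType}.
Implicit Types x y : R.

Lemma normr_sin_le x : `|sin x| <= `|x|.
Proof.
wlog x0 : x / 0 <= x => [hw|].
  by have [/hw//|/ltW x0] := leP 0 x; rewrite -normrN -sinN -(normrN x) hw// oppr_ge0.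
have [->|xN0] := eqVneq x 0; first by rewrite sin0.
have {xN0}x0 : 0 < x by rewrite lt_neqAle eq_sym xN0.
have [c _] := @MVT R sin cos 0 x x0 (fun y _ => is_derive_sin y)
  (continuous_subspaceT (@continuous_sin R)).
rewrite sin0 !subr0 => ->.
by rewrite normrM ler_piMl// cos_max.
Qed.

Lemma onem_cosE x : 1 - cos x = 2 * sin (x / 2) ^+ 2.
Proof.
by rewrite [in cos x](_ : x = (x / 2) *+ 2) ?cos_mulr2n ?cos2sin2; [ring|field].
Qed.

Lemma onem_cos_ge0 x : 0 <= 1 - cos x.
Proof. by rewrite subr_ge0 cos_le1. Qed.

Lemma onem_cos_le2 x : 1 - cos x <= 2.
Proof. by have := cos_geN1 x; lra. Qed.

Lemma onem_cos_le x : 1 - cos x <= x ^+ 2 / 2.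
Proof.
rewrite onem_cosE -real_normK ?num_real// -[in leRHS]real_normK ?num_real//.
have := normr_sin_le (x / 2); rewrite normrM [`|2^-1|]gtr0_norm// => h.
have := normr_ge0 (sin (x / 2)); nra.
Qed.

(** Write [1 - cos x] as [2 * sin (x / 2) ^+ 2] and [sin (x / 2)] as [cos c * (x / 2)] with [c]
    between 0 and [x / 2]. Then [cos c >= 1 - x ^+ 2 / 8], and squaring this loses at most the
    quartic term. *)
Lemma onem_cos_ge x : `|x| <= 2 -> x ^+ 2 / 2 - x ^+ 4 / 8 <= 1 - cos x.
Proof.
wlog x0 : x / 0 <= x => [hw|].
  have [/hw//|/ltW x0 x2] := leP 0 x.
  by have := hw (- x) _ _; rewrite oppr_ge0 normrN cosN (exprM (- x) 2 2) sqrrN -exprM; exact.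
rewrite ger0_norm// => x2.
have [->|xN0] := eqVneq x 0; first by rewrite cos0 !expr0n/=; lra.
have {xN0}x_gt0 : 0 < x / 2 by rewrite divr_gt0// lt_neqAle eq_sym xN0.
have [c] := @MVT R sin cos 0 (x / 2) x_gt0 (fun y _ => is_derive_sin y)
  (continuous_subspaceT (@continuous_sin R)).
rewrite in_itv/= sin0 !subr0 onem_cosE => /andP[c0 cx] ->.
have := onem_cos_le c.
have c1 : c <= 1 by lra.
move: (cos c) => C hC.
have hC' : 1 - x ^+ 2 / 8 <= C by nra.
have : 0 <= 1 - x ^+ 2 / 8 by nra.
move: x0 hC'; clear; move=> x0 h1 h2.
have : (1 - x ^+ 2 / 8) ^+ 2 <= C ^+ 2 by rewrite ler_sqr ?nnegrE//; lra.
rewrite exprMn => h3.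
have h4 : 0 <= x ^+ 2 by exact: sqr_ge0.
nra.
Qed.

End trig_bounds.

Section image_measure.
Context d d' (T1 : measurableType d) (T2 : measurableType d') (R : realType).

(** The pushforward bundled as a measure, in the form expected by the uniqueness theorems for
    Lebesgue and product measures. *)
Definition image_measure (m : {measure set T1 -> \bar R}) (f : T1 -> T2)
    (mf : measurable_fun setT f) : {measure set T2 -> \bar R} :=
  measure_function_pushforward__canonical__measure_function_Measure m mf.

End image_measure.

Section scaling.
Context {R : realType}.
Local Notation mu := (@lebesgue_measure R).
Local Open Scope ereal_scope.

Let mulrk (k : R) : measurableTypeR R -> measurableTypeR R := fun x => (k * x)%R.

Let measurable_mulrk k : measurable_fun setT (mulrk k).
Proof. exact: measurable_funM. Qed.

(** By uniqueness of Lebesgue measure it is enough to look at half-open intervals: the preimage of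
    []a, b]] has length [(b - a) / k], and the scalar [k] restores it. *)
Lemma lebesgue_measure_scale (k : R) (k0 : (0 < k)%R) (A : set R) :
  measurable A ->
  mu A = mscale (NngNum (ltW k0)) (image_measure mu (measurable_mulrk k)) A.
Proof.
move=> mA; apply: lebesgue_measure_unique => //= _ [[a b]] _ <-.
have Ek : mulrk k @^-1` `]a, b] = [set` `](a / k)%R, (b / k)%R]].
  by apply/seteqP; split => x; rewrite /mulrk /= !in_itv/=;
    rewrite ltr_pdivrMr// ler_pdivlMr// (mulrC x).
rewrite /mscale /image_measure /= /pushforward Ek.
rewrite !lebesgue_measure_itv/= !lte_fin ltr_pM2r ?invr_gt0//.
case: ifPn => _; last by rewrite mule0.
rewrite -!EFinB -EFinM; congr EFin.
by rewrite -mulrBl mulrC mulfVK// gt_eqF.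
Qed.

Lemma ge0_integral_scale (k : R) (f : R -> \bar R) : (0 < k)%R ->
  measurable_fun setT f -> (forall x, 0 <= f x) ->
  \int[mu]_x f (k * x)%R = k^-1%:E * \int[mu]_x f x.
Proof.
move=> k0 mf f0.
rewrite [in RHS](eq_measure_integral
    (mscale (NngNum (ltW k0)) (image_measure mu (measurable_mulrk k)))); last first.
  by move=> A mA _; rewrite /= (lebesgue_measure_scale k0).
rewrite ge0_integral_mscale//= muleA -EFinM mulVf ?gt_eqF// mul1e.
by rewrite (ge0_integral_pushforward (measurable_mulrk k)).
Qed.

End scaling.

Section fejer_kernel.
Context {R : realType}.
Local Notation mu := (@lebesgue_measure R).
Implicit Types x y t b : R.

(** A Fejér-type kernel kept on the half-line [0 < t]. Its integral in [t] is proportional to the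
    absolute value of [y], so that piecewise linear functions become integrals of such kernels. *)
Definition cosker y t : R := if 0 < t then (1 - cos (t * y)) / t ^+ 2 else 0.

Lemma cosker_ge0 y t : 0 <= cosker y t.
Proof.
by rewrite /cosker; case: ifPn => // _; rewrite divr_ge0 ?onem_cos_ge0 ?sqr_ge0.
Qed.

Lemma measurable_cos : measurable_fun setT (@cos R).
Proof. exact: continuous_measurable_fun (@continuous_cos R). Qed.

Lemma measurable_sin : measurable_fun setT (@sin R).
Proof. exact: continuous_measurable_fun (@continuous_sin R). Qed.

Lemma measurable_cosker y : measurable_fun setT (cosker y).
Proof.
rewrite (_ : cosker y = fun t =>
    if 0 < t then (1 - cos (t * y)) * t `^ (- 2%:R) else 0); last first.
  apply/funext => t; rewrite /cosker; case: ifPn => // t0.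
  by rewrite powRN powR_mulrn// ltW.
apply: measurable_fun_ifT.
- exact: measurable_fun_ltr.
- apply: measurable_funM; last exact: measurable_powR.
  apply: measurable_funB => //; apply: (measurableT_comp measurable_cos).
  exact: measurable_funM.
- exact: measurable_cst.
Qed.

Lemma integral_cosker1_lty : (\int[mu]_t (cosker 1 t)%:E < +oo)%E.
Proof.
have [m1 m2] : measurable_fun setT (fun t : R => (oneDsqr t)^-1) /\ true.
  by split => //; apply: continuous_measurable_fun; exact: continuous_oneDsqrV.
(* [1 - cos t] is at most [t ^+ 2 / 2] and at most 2, hence [(1 - cos t) * (1 + t ^+ 2)] is at most
   [5 / 2 * t ^+ 2]. *)
apply: (@le_lt_trans _ _ (\int[mu]_(t in `[0%R, +oo[)
    ((5 / 2)%:E * ((oneDsqr t)^-1)%:E))%E).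
  rewrite [leRHS]integral_mkcond; apply: ge0_le_integral => //.
  - by move=> t _; rewrite lee_fin cosker_ge0.
  - by apply/measurable_EFinP; exact: measurable_cosker.
  - apply/(measurable_restrictT _ _).1 => //; apply: measurable_funTS.
    by apply: emeasurable_funM => //; apply/measurable_EFinP.
  - move=> t _; rewrite patchE; case: ifPn => [|].
      rewrite inE/= in_itv/= andbT => t0; rewrite -EFinM lee_fin /cosker mulr1.
      case: ifPn => [{}t0|_]; last by rewrite divr_ge0// addr_ge0// sqr_ge0.
      rewrite /oneDsqr ler_pdivrMr ?exprn_gt0// mulrAC ler_pdivlMr ?addr_gt0 ?exprn_gt0//.
      have := onem_cos_le t; have := onem_cos_le2 t; have : 0 < t ^+ 2 by rewrite exprn_gt0.
      nra.
    rewrite notin_setE/= in_itv/= andbT => /negP; rewrite -ltNge => t0.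
    have -> : cosker 1 t = 0 by rewrite /cosker ltNge (ltW t0).
    exact: lexx.
rewrite ge0_integralZl_EFin//.
- by rewrite integral0y_oneDsqr -EFinM ltry.
- by apply/measurable_EFinP; exact: measurable_funTS.
Qed.

(** On [[1, 2]], an interval contained in [[0, pi]], the cosine decreases, and the kernel is at
    least [(1 - cos 1) / 4]. *)
Lemma integral_cosker1_gt0 : (0 < \int[mu]_t (cosker 1 t)%:E)%E.
Proof.
apply: (@lt_le_trans _ _ (\int[mu]_(t in `[1%R, 2%R]) (((1 - cos 1) / 4 : R)%:E))%E).
  rewrite integral_cst//= lebesgue_measure_itv/= lte_fin ltr1n -EFinB -EFinM lte_fin.
  suff : cos 1 < 1 :> R by lra.
  by rewrite -[ltRHS](@cos0 R) ltr_cos ?in_itv/=; have := @pi_ge2 R; lra.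
rewrite [leLHS]integral_mkcond; apply: ge0_le_integral => //.
- by move=> t _; rewrite patchE; case: ifPn => // _; rewrite lee_fin divr_ge0// onem_cos_ge0.
- by apply/(measurable_restrictT _ _).1.
- by apply/measurable_EFinP; exact: measurable_cosker.
- move=> t _; rewrite patchE; case: ifPn => [|_]; last by rewrite lee_fin cosker_ge0.
  rewrite inE/= in_itv/= => /andP[t1 t2]; rewrite lee_fin /cosker.
  have t0 : 0 < t by lra.
  rewrite t0 mulr1; apply: ler_pM.
  + by rewrite onem_cos_ge0.
  + by [].
  + rewrite lerD2l lerN2; have [->//|t1'] := eqVneq t 1.
    apply/ltW; rewrite ltr_cos ?in_itv/= ?lt_neqAle 1?eq_sym ?t1' ?t1//.
      by have := @pi_ge2 R; lra.
    by have := @pi_ge2 R; lra.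
  + by rewrite lef_pV2 ?posrE ?exprn_gt0//; nra.
Qed.

(* The only property of this constant (it is pi/2) that matters is that it is positive. *)
Definition dirichlet_cst : R := fine (\int[mu]_t (cosker 1 t)%:E)%E.

Lemma dirichlet_cst_gt0 : 0 < dirichlet_cst.
Proof. by rewrite fine_gt0// integral_cosker1_gt0 integral_cosker1_lty. Qed.

(** For [y > 0] the kernel is [y ^+ 2 * cosker 1 (y * t)], and the change of variable gives back one
    factor [y]; the sign of [y] is irrelevant by evenness. *)
Lemma integral_cosker y :
  (\int[mu]_t (cosker y t)%:E = (dirichlet_cst * `|y|)%:E)%E.
Proof.
wlog y0 : y / 0 <= y => [hw|].
  have [/hw//|/ltW y0] := leP 0 y; rewrite -normrN -hw ?oppr_ge0//.
  by apply: eq_integral => t _; rewrite /cosker mulrN cosN.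
have [->|yN0] := eqVneq y 0.
  rewrite normr0 mulr0; apply: integral0_eq => t _.
  by rewrite /cosker mulr0 cos0 subrr mul0r if_same.
have {yN0}y0' : 0 < y by rewrite lt_neqAle eq_sym yN0.
transitivity (\int[mu]_t ((y ^+ 2)%:E * (EFin \o cosker 1) (y * t)%R))%E.
  apply: eq_integral => t _ /=; rewrite -EFinM /cosker pmulr_rgt0// mulr1.
  case: ifPn => [t0|_]; last by rewrite mulr0.
  congr EFin; rewrite (mulrC t) exprMn.
  by field; rewrite gt_eqF// gt_eqF.
rewrite ge0_integralZl_EFin ?sqr_ge0//; last 2 first.
- by move=> t _; rewrite lee_fin cosker_ge0.
- apply/measurable_EFinP; apply: (measurableT_comp (measurable_cosker 1)).
  exact: measurable_funM.
rewrite ge0_integral_scale//; last 2 first.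
- by apply/measurable_EFinP; exact: measurable_cosker.
- by move=> t; rewrite lee_fin cosker_ge0.
rewrite -[X in (_ * (_ * X))%E]fineK ?ge0_fin_numE ?integral_cosker1_lty//; last first.
  by apply: integral_ge0 => t _; rewrite lee_fin cosker_ge0.
rewrite -!EFinM ger0_norm//; congr EFin; rewrite -/dirichlet_cst.
by field; rewrite gt_eqF.
Qed.

End fejer_kernel.

Section tent_kernel.
Context {R : realType}.
Local Notation mu := (@lebesgue_measure R).
Implicit Types x y t b : R.

(* The trapezoid of height [b] that is flat on [[-b, b]] and vanishes outside [[-2b, 2b]]. *)
Definition tent b y : R :=
  (`|y + 2 * b| + `|y - 2 * b| - `|y + b| - `|y - b|) / 2.

(** Up to [dirichlet_cst], the function whose cosine transform is [tent b]: multiplication by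
    [cos (t * y)] turns it into a combination of [cosker] at [y + 2 * b], [y - 2 * b], [y + b] and
    [y - b], which integrates to the absolute values defining [tent]. *)
Definition tentker b t : R := cosker (2 * b) t - cosker b t.

Lemma tent_ge0 b y : 0 <= b -> 0 <= tent b y.
Proof.
move=> b0; rewrite /tent.
by have [?|?] := ger0P (y + 2 * b); have [?|?] := ger0P (y - 2 * b);
  have [?|?] := ger0P (y + b); have [?|?] := ger0P (y - b); lra.
Qed.

Lemma tent_le b y : 0 <= b -> tent b y <= b.
Proof.
move=> b0; rewrite /tent.
by have [?|?] := ger0P (y + 2 * b); have [?|?] := ger0P (y - 2 * b);
  have [?|?] := ger0P (y + b); have [?|?] := ger0P (y - b); lra.
Qed.

Lemma tent_in b y : `|y| <= b -> tent b y = b.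
Proof.
rewrite ler_norml /tent => /andP[? ?].
by have [?|?] := ger0P (y + 2 * b); have [?|?] := ger0P (y - 2 * b);
  have [?|?] := ger0P (y + b); have [?|?] := ger0P (y - b); lra.
Qed.

Lemma tent_out b y : 0 <= b -> 2 * b < `|y| -> tent b y = 0.
Proof.
move=> b0; rewrite /tent.
by have [?|?] := ger0P y => ?; have [?|?] := ger0P (y + 2 * b);
  have [?|?] := ger0P (y - 2 * b); have [?|?] := ger0P (y + b);
  have [?|?] := ger0P (y - b); lra.
Qed.

Lemma normr_tent_le b y : `|tent b y| <= 2 * `|b|.
Proof.
rewrite /tent ler_norml.
by have [?|?] := ger0P b; have [?|?] := ger0P (y + 2 * b);
  have [?|?] := ger0P (y - 2 * b); have [?|?] := ger0P (y + b);
  have [?|?] := ger0P (y - b); apply/andP; split; lra.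
Qed.

Lemma measurable_tent b : measurable_fun setT (tent b).
Proof.
rewrite /tent; apply: measurable_funM => //.
have mn z : measurable_fun setT (fun y : R => `|y + z|).
  by apply: (measurableT_comp (@normr_measurable R setT)) => //; exact: measurable_funD.
by apply: measurable_funB; [apply: measurable_funB; [exact: measurable_funD|]|].
Qed.

Lemma cos_tentkerE b y t : cos (t * y) * tentker b t =
  (cosker (y + 2 * b) t + cosker (y - 2 * b) t
   - (cosker (y + b) t + cosker (y - b) t)) / 2.
Proof.
rewrite /tentker /cosker; case: ifPn => t0; last by rewrite !(subrr,addr0,mulr0,mul0r).
have -> : t * (y + 2 * b) = t * y + t * (2 * b) by ring.
have -> : t * (y - 2 * b) = t * y - t * (2 * b) by ring.
have -> : t * (y + b) = t * y + t * b by ring.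
have -> : t * (y - b) = t * y - t * b by ring.
rewrite !cosD !sinN !cosN; field; exact: lt0r_neq0.
Qed.

Lemma integrable_cosker y : mu.-integrable setT (EFin \o cosker y).
Proof.
apply/integrableP; split; first by apply/measurable_EFinP; exact: measurable_cosker.
under eq_integral do rewrite /= ger0_norm ?cosker_ge0//.
by rewrite integral_cosker ltry.
Qed.

Lemma integrable_tentker b : mu.-integrable setT (EFin \o tentker b).
Proof.
by have := integrableB measurableT (integrable_cosker (2 * b)) (integrable_cosker b).
Qed.

Lemma measurable_tentker b : measurable_fun setT (tentker b).
Proof. by apply: measurable_funB; exact: measurable_cosker. Qed.

Lemma integral_cos_tentker b y :
  (\int[mu]_t (cos (t * y) * tentker b t)%:E = (@dirichlet_cst R * tent b y)%:E)%E.
Proof.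
have iD z z' : mu.-integrable setT (EFin \o (cosker z \+ cosker z')).
  by have := integrableD measurableT (integrable_cosker z) (integrable_cosker z').
under eq_integral do rewrite cos_tentkerE mulrC EFinM.
rewrite integralZl//; last first.
  by have := integrableB measurableT (iD (y + 2 * b) (y - 2 * b)) (iD (y + b) (y - b)).
have := integralB_EFin measurableT (iD (y + 2 * b) (y - 2 * b)) (iD (y + b) (y - b)).
rewrite /= => ->.
rewrite !integralD_EFin//; [|exact: integrable_cosker..].
by rewrite /= !integral_cosker -!EFinD -EFinM; congr EFin; rewrite /tent; ring.
Qed.

End tent_kernel.

Section tent_fubini.
Context {R : realType} d (U : measurableType d) (G : {sigma_finite_measure set U -> \bar R}).
Local Notation mu := (@lebesgue_measure R).
Variables (f g : U -> R) (b : R).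
Hypotheses (mf : measurable_fun setT f) (ig : G.-integrable setT (EFin \o g)).

Let mg : measurable_fun setT g.
Proof. by apply/measurable_EFinP; exact: measurable_int ig. Qed.

Let F (z : measurableTypeR R * U) : R := g z.2 * cos (z.1 * f z.2) * tentker b z.1.

Let mF : measurable_fun setT F.
Proof.
apply: measurable_funM; last exact: (measurableT_comp (measurable_tentker b)).
apply: measurable_funM; first exact: measurableT_comp.
apply: (measurableT_comp measurable_cos); apply: measurable_funM => //.
exact: measurableT_comp.
Qed.

Let iF : (mu \x G)%E.-integrable setT (EFin \o F).
Proof.
apply/integrable12ltyP; first exact/measurable_EFinP.
apply: (@le_lt_trans _ _ (\int[mu]_t (`|tentker b t|%:E * \int[G]_u `|(g u)%:E|))%E).
  apply: ge0_le_integral => //.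
  - by move=> t _; apply: integral_ge0.
  - apply: (@measurable_fun_fubini_tonelli_F _ _ _ _ _ G (fun z => `|(F z)%:E|%E)) => //.
    by apply: measurableT_comp => //; exact/measurable_EFinP.
  - apply: emeasurable_funM => //; apply/measurable_EFinP.
    by apply: (measurableT_comp (@normr_measurable R setT)) => //; exact: measurable_tentker.
  move=> t _.
  rewrite -ge0_integralZl_EFin//; last by apply: measurableT_comp => //; exact/measurable_EFinP.
  apply: ge0_le_integral => //.
  - apply: measurableT_comp => //; apply/measurable_EFinP.
    exact: (measurableT_comp mF (measurable_pair1 t)).
  - by apply: emeasurable_funM => //; apply: measurableT_comp => //; exact/measurable_EFinP.
  move=> u _; rewrite /= /F/= -EFinM lee_fin !normrM mulrC ler_wpM2l//.
  by rewrite ler_piMr// cos_max.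
have /integrableP[_ gfin] := ig.
have gf : (\int[G]_u `|(g u)%:E| \is a fin_num)%E by rewrite ge0_fin_numE// integral_ge0.
rewrite ge0_integralZr//; last 2 first.
- by apply/measurable_EFinP/(measurableT_comp (@normr_measurable R setT)) => //; exact: measurable_tentker.
- by rewrite integral_ge0.
apply: lte_mul_pinfty => //.
- by rewrite integral_ge0.
- rewrite ge0_fin_numE ?integral_ge0//.
  by have /integrableP[] := integrable_tentker b.
Qed.

(** The integrable weight [g] is what allows the exchange when [G] is infinite. It is applied with
    [g] of the form [1 - cos (a * f)], both to a probability and to a Lévy measure, which puts the
    two on the same footing. *)
Lemma tent_fubini :
  (\int[mu]_t \int[G]_u (g u * cos (t * f u) * tentker b t)%:E =
   (@dirichlet_cst R)%:E * \int[G]_u (g u * tent b (f u))%:E)%E.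
Proof.
have := Fubini iF; rewrite /F/= => ->.
rewrite -integralZl//; last first.
  apply: (@le_integrable _ _ _ _ _ _ _ (fun u => (2 * `|b|)%:E * (g u)%:E)%E) => //.
  - apply/measurable_EFinP/measurable_funM => //.
    exact: measurableT_comp (measurable_tent b) mf.
  - move=> u _ /=; rewrite lee_fin normrM (normrM (2 * `|b|)) mulrC ler_wpM2r//.
    by rewrite (ger0_norm (_ : 0 <= 2 * `|b|)) ?mulr_ge0// normr_tent_le.
  - exact: integrableZl.
apply: eq_integral => u _.
under eq_integral do rewrite -mulrA EFinM.
rewrite integralZl//; last first.
  apply: (le_integrable _ _ _ (integrable_tentker b)) => //.
  - apply/measurable_EFinP/measurable_funM; last exact: measurable_tentker.
    by apply: (measurableT_comp measurable_cos); exact: measurable_funM.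
  - by move=> t _ /=; rewrite lee_fin normrM ler_piMl// cos_max.
by rewrite integral_cos_tentker -!EFinM; congr EFin; ring.
Qed.

End tent_fubini.

(** * Small-time truncated moments of symmetrized increments *)

Section onem_expRN.
Context {R : realType}.
Implicit Types x s : R.

Lemma onem_expRN_le x : 1 - expR (- x) <= x.
Proof. by have := expR_ge1Dx (- x); lra. Qed.

Lemma onem_expRN_ge x : 0 <= x -> x - x ^+ 2 <= 1 - expR (- x).
Proof.
move=> x0; have h := expR_ge1Dx x; have e0 := expR_gt0 x.
rewrite expRN; have : (expR x)^-1 <= (1 + x)^-1 by rewrite lef_pV2// posrE; lra.
suff : (1 + x)^-1 <= 1 - x + x ^+ 2 by lra.
rewrite -div1r ler_pdivrMr; last by lra.
have : 0 <= x ^+ 3 by rewrite exprn_ge0.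
nra.
Qed.

Lemma cvg_onem_expRN x s : 0 <= x -> 0 < s ->
  ((1 - expR (- (s / n.+1%:R * x))) / (s / n.+1%:R)) @[n --> \oo] --> x.
Proof.
move=> x0 s0.
apply: (@squeeze_cvgr _ _ _ _ (fun n => x - s * x ^+ 2 * n.+1%:R^-1) (fun=> x)).
- apply: nearW => n; have sn : 0 < s / n.+1%:R by rewrite divr_gt0.
  rewrite ler_pdivlMr// ler_pdivrMr// [x * _]mulrC onem_expRN_le andbT.
  have := @onem_expRN_ge (s / n.+1%:R * x) (mulr_ge0 (ltW sn) x0).
  by apply: le_trans; rewrite le_eqVlt; apply/orP; left; apply/eqP; ring.
- rewrite [X in _ --> X](_ : x = x - s * x ^+ 2 * 0); last by ring.
  by apply: cvgB; [exact: cvg_cst|apply: cvgMr; exact: cvg_harmonic].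
- exact: cvg_cst.
Qed.

End onem_expRN.

Section levy_exponent.
Context {R : realType} d (U : measurableType d).
Variables (Pi : {sigma_finite_measure set U -> \bar R}) (f : U -> R).
Hypotheses (mf : measurable_fun setT f)
  (fPi : (\int[Pi]_u (Num.min 1 (f u ^+ 2))%:E < +oo)%E).
Local Notation mu := (@lebesgue_measure R).

Let M : R := fine (\int[Pi]_u (Num.min 1 (f u ^+ 2))%:E)%E.

Let min0 u : 0 <= Num.min 1 (f u ^+ 2).
Proof. by rewrite le_min ler01 sqr_ge0. Qed.

Let mmin : measurable_fun setT (fun u => Num.min 1 (f u ^+ 2)).
Proof. by apply: measurable_minr => //; exact: measurable_funX. Qed.

Let intE : (\int[Pi]_u (Num.min 1 (f u ^+ 2))%:E = M%:E)%E.
Proof. by rewrite /M fineK// ge0_fin_numE// integral_ge0// => u _; rewrite lee_fin. Qed.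

Let imin : Pi.-integrable setT (fun u => (Num.min 1 (f u ^+ 2))%:E).
Proof.
apply/integrableP; split; first exact/measurable_EFinP.
by under eq_integral do rewrite /= ger0_norm//.
Qed.

Lemma measurable_cosf t : measurable_fun setT (fun u => cos (t * f u)).
Proof. by apply: (measurableT_comp measurable_cos); exact: measurable_funM. Qed.

Lemma onem_cos_min t u :
  1 - cos (t * f u) <= (2 + t ^+ 2) * Num.min 1 (f u ^+ 2).
Proof.
have h1 := onem_cos_le (t * f u); have h2 := onem_cos_le2 (t * f u).
have t2 := sqr_ge0 t; have f2 := sqr_ge0 (f u); rewrite exprMn in h1.
by case: (leP 1 (f u ^+ 2)) => h; nra.
Qed.

Lemma integrable_onem_cos t : Pi.-integrable setT (fun u => (1 - cos (t * f u))%:E).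
Proof.
apply: (@le_integrable _ _ _ _ _ _ _ (fun u => (2 + t ^+ 2)%:E * (Num.min 1 (f u ^+ 2))%:E)%E) => //.
- by apply/measurable_EFinP/measurable_funB => //; exact: measurable_cosf.
- move=> u _; rewrite /= lee_fin ger0_norm ?onem_cos_ge0// ger0_norm ?onem_cos_min//.
  by rewrite mulr_ge0// addr_ge0// sqr_ge0.
- exact: integrableZl.
Qed.

(** For [f := tdot z] this is minus the real part of the Lévy-Khintchine exponent along the
    direction [z], in the absence of a Gaussian part. *)
Definition levy_exponent t : R := Rintegral Pi setT (fun u => 1 - cos (t * f u)).

Lemma levy_exponentE t :
  (\int[Pi]_u (1 - cos (t * f u))%:E = (levy_exponent t)%:E)%E.
Proof.
rewrite /levy_exponent /Rintegral fineK//.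
exact: integrable_fin_num (integrable_onem_cos t).
Qed.

Lemma levy_exponent_ge0 t : 0 <= levy_exponent t.
Proof. by apply: Rintegral_ge0 => u _; exact: onem_cos_ge0. Qed.

Lemma levy_exponent_le : exists2 C : R, 0 <= C &
  forall t, levy_exponent t <= (2 + t ^+ 2) * C.
Proof.
exists M => [|t]; first by rewrite -lee_fin -intE integral_ge0// => u _; rewrite lee_fin.
rewrite -lee_fin -levy_exponentE EFinM -intE -ge0_integralZl_EFin//; last 3 first.
- by move=> u _; rewrite lee_fin.
- exact/measurable_EFinP.
- by rewrite addr_ge0// sqr_ge0.
apply: ge0_le_integral => //.
- by apply/measurable_EFinP/measurable_funB => //; exact: measurable_cosf.
- by apply/measurable_EFinP/measurable_funM.
- by move=> u _; rewrite -EFinM lee_fin onem_cos_min.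
Qed.

Lemma measurable_levy_exponent : measurable_fun setT levy_exponent.
Proof.
apply: (measurableT_comp (@fine_measurable R setT measurableT)).
apply: (@measurable_fun_fubini_tonelli_F _ _ _ _ _ Pi
  (fun z : R * U => (1 - cos (z.1 * f z.2))%:E)).
- apply/measurable_EFinP/measurable_funB => //; apply: (measurableT_comp measurable_cos).
  by apply: measurable_funM => //; exact: measurableT_comp.
- by move=> z; rewrite lee_fin onem_cos_ge0.
Qed.

(** The integrand is a second difference, of step [a] in [t], of [1 - cos (t * f u)]. This is the
    cosine transform of the measure with density [1 - cos (a * f)] with respect to [Pi], which is
    finite even though [Pi] need not be. *)
Lemma levy_exponent_diff a t :
  (\int[Pi]_u ((1 - cos (a * f u)) * cos (t * f u))%:E =
   (levy_exponent (t + a) / 2 + levy_exponent (t - a) / 2 - levy_exponent t)%:E)%E.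
Proof.
have E u : (1 - cos (a * f u)) * cos (t * f u) =
    ((1 - cos ((t + a) * f u)) / 2 + (1 - cos ((t - a) * f u)) / 2) - (1 - cos (t * f u)).
  have -> : (t + a) * f u = t * f u + a * f u by ring.
  have -> : (t - a) * f u = t * f u - a * f u by ring.
  by rewrite !cosD sinN cosN; field.
under eq_integral do rewrite E.
have iZ s : Pi.-integrable setT (fun u => ((1 - cos (s * f u)) / 2)%:E).
  under eq_fun do rewrite EFinM.
  by apply: integrableZr => //; exact: integrable_onem_cos.
have iD := integrableD measurableT (iZ (t + a)) (iZ (t - a)).
have ZE s : (\int[Pi]_u ((1 - cos (s * f u)) / 2)%:E = (levy_exponent s / 2)%:E)%E.
  under eq_integral do rewrite EFinM.
  by rewrite integralZr// ?levy_exponentE//; exact: integrable_onem_cos.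
have := integralB_EFin measurableT iD (integrable_onem_cos t); rewrite /= => ->.
have := integralD_EFin measurableT (iZ (t + a)) (iZ (t - a)); rewrite /= => ->.
by rewrite !ZE levy_exponentE.
Qed.

End levy_exponent.

Section small_time_moment.
Context {R : realType} d (U : measurableType d).
Variables (Pi : {sigma_finite_measure set U -> \bar R}) (f : U -> R).
Hypotheses (mf : measurable_fun setT f)
  (fPi : (\int[Pi]_u (Num.min 1 (f u ^+ 2))%:E < +oo)%E).
Local Notation mu := (@lebesgue_measure R).
Local Notation psi := (levy_exponent Pi f).

(* [symm_transform s Q z] says that [z] has, under [Q], the law of the
   difference of two independent increments over a time span [s / 2]. *)
Definition symm_transform (s : R) d' (W : measurableType d') (Q : probability W R)
    (z : W -> R) : Prop :=
  measurable_fun setT z /\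
  forall t, (\int[Q]_w (cos (t * z w))%:E = (expR (- (s * psi t)))%:E)%E.

(** The same second difference taken on [expR (- (s * psi t))]: the cosine transform of the law of
    [z] weighted by [1 - cos (a * z)]. It involves only [s] and [psi], so it is common to all laws
    satisfying [symm_transform s]. *)
Definition ghat (s a t : R) : R :=
  expR (- (s * psi t)) - expR (- (s * psi (t + a))) / 2 - expR (- (s * psi (t - a))) / 2.

Section one_variable.
Variables (s : R) (d' : measure_display) (W : measurableType d') (Q : probability W R).
Variables (z : W -> R) (zQ : symm_transform s Q z).

Let mz : measurable_fun setT z. Proof. by case: zQ. Qed.

Lemma integrable_cosz t : Q.-integrable setT (fun w => (cos (t * z w))%:E).
Proof.
apply: measurable_bounded_integrable => //.
- by rewrite -ge0_fin_numE// fin_num_measure.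
- exact: measurable_cosf.
- by exists 1; split => // x x1 w _; rewrite /= (le_trans (cos_max _))// ltW.
Qed.

Lemma integrable_onem_cosz t : Q.-integrable setT (fun w => (1 - cos (t * z w))%:E).
Proof.
have := integrableB measurableT (finite_measure_integrable_cst Q 1 measurableT) (integrable_cosz t).
by [].
Qed.

Lemma integral_onem_cosz t :
  (\int[Q]_w (1 - cos (t * z w))%:E = (1 - expR (- (s * psi t)))%:E)%E.
Proof.
have := integralB_EFin measurableT (finite_measure_integrable_cst Q 1 measurableT) (integrable_cosz t).
rewrite /= => ->; rewrite integral_cst// mul1e (proj2 zQ).
by rewrite [X in (X - _)%E](_ : _ = 1%E) //; exact: probability_setT.
Qed.

Lemma integral_ghat a t :
  (\int[Q]_w ((1 - cos (a * z w)) * cos (t * z w))%:E = (ghat s a t)%:E)%E.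
Proof.
have E w : (1 - cos (a * z w)) * cos (t * z w) =
    (cos (t * z w) - cos ((t + a) * z w) / 2) - cos ((t - a) * z w) / 2.
  have -> : (t + a) * z w = t * z w + a * z w by ring.
  have -> : (t - a) * z w = t * z w - a * z w by ring.
  by rewrite !cosD sinN cosN; field.
under eq_integral do rewrite E.
have iZ r : Q.-integrable setT (fun w => (cos (r * z w) / 2)%:E).
  under eq_fun do rewrite EFinM.
  by apply: integrableZr => //; exact: integrable_cosz.
have iB := integrableB measurableT (integrable_cosz t) (iZ (t + a)).
have ZE r : (\int[Q]_w (cos (r * z w) / 2)%:E = (expR (- (s * psi r)) / 2)%:E)%E.
  under eq_integral do rewrite EFinM.
  by rewrite integralZr// ?(proj2 zQ)//; exact: integrable_cosz.
have := integralB_EFin measurableT iB (iZ (t - a)); rewrite /= => ->.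
have := integralB_EFin measurableT (integrable_cosz t) (iZ (t + a)); rewrite /= => ->.
by rewrite !ZE (proj2 zQ).
Qed.

(** A cosine transform is bounded by the total mass, here [1 - expR (- (s * psi a))]. The bound is
    uniform in [t] and linear in [s], which provides the domination for [ghat s a t / s] as [s]
    tends to 0. *)
Lemma normr_ghat_le a t : `|ghat s a t| <= s * psi a.
Proof.
apply: le_trans (onem_expRN_le _); rewrite -lee_fin -integral_onem_cosz.
rewrite -abse_EFin -integral_ghat; apply: le_trans (le_abse_integral _ _ _) _ => //.
  apply/measurable_EFinP/measurable_funM; last exact: measurable_cosf.
  by apply: measurable_funB => //; exact: measurable_cosf.
apply: ge0_le_integral => //.
- apply: measurableT_comp => //; apply/measurable_EFinP/measurable_funM; last exact: measurable_cosf.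
  by apply: measurable_funB => //; exact: measurable_cosf.
- by apply/measurable_EFinP/measurable_funB => //; exact: measurable_cosf.
- move=> w _; rewrite /= lee_fin normrM ger0_norm ?onem_cos_ge0//.
  by rewrite ler_piMr ?cos_max// onem_cos_ge0.
Qed.

Lemma integral_ghat_tentker a b :
  (\int[mu]_t (ghat s a t * tentker b t)%:E =
   (@dirichlet_cst R)%:E * \int[Q]_w ((1 - cos (a * z w)) * tent b (z w))%:E)%E.
Proof.
rewrite -(@tent_fubini _ _ _ Q z)//; last exact: integrable_onem_cosz.
apply: eq_integral => t _; rewrite EFinM -integral_ghat.
under [RHS]eq_integral do rewrite EFinM.
rewrite integralZr//; last first.
  apply: (le_integrable _ _ _ (integrable_onem_cosz a)) => //.
- apply/measurable_EFinP/measurable_funM; last exact: measurable_cosf.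
  by apply: measurable_funB => //; exact: measurable_cosf.
- move=> w _; rewrite /= lee_fin normrM (ger0_norm (onem_cos_ge0 _)).
  by rewrite ler_piMr ?cos_max// onem_cos_ge0.
Qed.

(** [1 - cos (a * z)] is at most [(a * z) ^+ 2 / 2], while the trapezoid is at most [b] and vanishes
    beyond [2 * b]. *)
Lemma truncated_moment_ge (a b : R) : a != 0 -> 0 < b ->
  (((2 / (a ^+ 2 * b) / dirichlet_cst)%:E * \int[mu]_t (ghat s a t * tentker b t)%:E)
  <= \int[Q]_(w in [set w | (`|z w| <= 2 * b)%R]) (z w ^+ 2)%:E)%E.
Proof.
move=> a0 b0; have a2 : 0 < a ^+ 2 by rewrite exprn_even_gt0.
have c0 := @dirichlet_cst_gt0 R.
have mA : measurable [set w | (`|z w| <= 2 * b)%R].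
  rewrite -[X in measurable X]setTI; apply: (measurable_fun_ler _ _) => //.
  by apply: (measurableT_comp (@normr_measurable R setT)).
rewrite integral_ghat_tentker muleA -EFinM mulfVK ?gt_eqF//.
rewrite [leRHS]integral_mkcond -ge0_integralZl_EFin//; last 3 first.
- by move=> w _; rewrite lee_fin mulr_ge0 ?onem_cos_ge0// tent_ge0// ltW.
- apply/measurable_EFinP/measurable_funM; last exact: (measurableT_comp (measurable_tent b)).
  by apply: measurable_funB => //; exact: measurable_cosf.
- by rewrite divr_ge0// mulr_ge0// ltW.
apply: ge0_le_integral => //.
- move=> w _; rewrite -EFinM lee_fin mulr_ge0//; first by rewrite divr_ge0// mulr_ge0// ltW.
  by rewrite mulr_ge0 ?onem_cos_ge0// tent_ge0// ltW.
- apply/measurable_EFinP/measurable_funM => //.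
  apply/measurable_funM; last exact: (measurableT_comp (measurable_tent b)).
  by apply: measurable_funB => //; exact: measurable_cosf.
- apply/(measurable_restrictT _ _).1 => //; apply/measurable_EFinP.
  by apply: measurable_funTS; exact: measurable_funX.
move=> w _; rewrite -EFinM patchE.
have h := onem_cos_le (a * z w); rewrite exprMn in h.
have h0 := onem_cos_ge0 (a * z w).
case: ifPn => [|]; rewrite ?inE ?notin_setE/=.
  move=> zb; rewrite lee_fin mulrAC ler_pdivrMr ?(mulr_gt0 a2 b0)//.
  have h1 := ler_pM h0 (tent_ge0 (z w) (ltW b0)) h (tent_le (z w) (ltW b0)).
  apply: le_trans (ler_wpM2l (ler0n _ 2) h1) _.
  by rewrite le_eqVlt; apply/orP; left; apply/eqP; field.
by move=> /negP; rewrite -ltNge => zb; rewrite tent_out ?mulr0// ltW.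
Qed.

End one_variable.

Lemma measurable_ghat s a : measurable_fun setT (ghat s a).
Proof.
have me r : measurable_fun setT (fun t : R => expR (- (s * psi (t + r)))).
  apply: (measurableT_comp (@measurable_expR R)); apply: measurable_funN.
  apply: measurable_funM => //; apply: (measurableT_comp (measurable_levy_exponent _ mf)).
  exact: measurable_funD.
apply: measurable_funB; [apply: measurable_funB|]; [|apply: measurable_funM => //..].
by have := me 0; under eq_fun do rewrite addr0.
Qed.

Lemma cvg_ghat (r a t : R) : 0 < r ->
  ghat (r / n.+1%:R) a t / (r / n.+1%:R) @[n --> \oo] -->
  psi (t + a) / 2 + psi (t - a) / 2 - psi t.
Proof.
move=> r0; pose e x n : R := (1 - expR (- (r / n.+1%:R * x))) / (r / n.+1%:R).
rewrite (_ : (fun n => _) = (fun n => e (psi (t + a)) n / 2 + e (psi (t - a)) n / 2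
    - e (psi t) n)).
  by apply: cvgB; [apply: cvgD; apply: cvgMl|];
    apply: cvg_onem_expRN => //; exact: levy_exponent_ge0.
apply/funext => n; rewrite /e /ghat; field.
by rewrite addrC natr1 !gt_eqF.
Qed.

(** Convergence of the symmetrized laws divided by their span towards the Lévy measure, tested on
    the even function [(1 - cos (a * y)) * tent b y]. On the transform side it is dominated
    convergence, with [psi a] times the absolute value of [tentker b] as dominating function. *)
Lemma cvg_integral_ghat (r a b : R) : 0 < r ->
  (forall n t, `|ghat (r / n.+1%:R) a t| <= r / n.+1%:R * psi a) ->
  (\int[mu]_t (ghat (r / n.+1%:R) a t / (r / n.+1%:R) * tentker b t)%:E)%E
    @[n --> \oo] -->
  ((@dirichlet_cst R)%:E * \int[Pi]_u ((1 - cos (a * f u)) * tent b (f u))%:E)%E.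
Proof.
move=> r0 dom; rewrite -tent_fubini//; last exact: integrable_onem_cos.
have -> : (\int[mu]_t \int[Pi]_u
      ((1 - cos (a * f u)) * cos (t * f u) * tentker b t)%:E =
    \int[mu]_t ((psi (t + a) / 2 + psi (t - a) / 2 - psi t) * tentker b t)%:E)%E.
  apply: eq_integral => t _; rewrite EFinM -levy_exponent_diff//.
  under eq_integral do rewrite EFinM.
  rewrite integralZr//.
  apply: (le_integrable _ _ _ (integrable_onem_cos mf fPi a)) => //.
  - apply/measurable_EFinP/measurable_funM; last exact: measurable_cosf.
    by apply: measurable_funB => //; exact: measurable_cosf.
  - move=> w _; rewrite /= lee_fin normrM (ger0_norm (onem_cos_ge0 _)).
    by rewrite ler_piMr ?cos_max// onem_cos_ge0.
have mpsi x : measurable_fun setT (fun t : R => psi (t + x)).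
  apply: (measurableT_comp (measurable_levy_exponent _ mf)); exact: measurable_funD.
have [//| | | | |_ _ //] := @dominated_convergence _ _ _ mu setT measurableT
  (fun n t => (ghat (r / n.+1%:R) a t / (r / n.+1%:R) * tentker b t)%:E)
  (fun t => ((psi (t + a) / 2 + psi (t - a) / 2 - psi t) * tentker b t)%:E)
  (fun t => (psi a * `|tentker b t|)%:E).
- move=> n; apply/measurable_EFinP/measurable_funM; last exact: measurable_tentker.
  by apply: measurable_funM => //; exact: measurable_ghat.
- apply/measurable_EFinP/measurable_funM; last exact: measurable_tentker.
  apply: measurable_funB; last by have := mpsi 0; under eq_fun do rewrite addr0.
  by apply: measurable_funD; apply: measurable_funM => //; exact: mpsi.
- apply: aeW => t _; apply: cvg_EFin; first exact: nearW.
  by apply: cvgMl; exact: cvg_ghat.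
- under eq_fun do rewrite EFinM.
  by apply: integrableZl => //; have := integrable_abse (integrable_tentker b).
- apply: aeW => t n _; rewrite lee_fin normrM ler_wpM2r// normrM.
  have rn : 0 < r / n.+1%:R by rewrite divr_gt0.
  have rn' : 0 < (r / n.+1%:R)^-1 by rewrite invr_gt0.
  by rewrite (gtr0_norm rn') ler_pdivrMr// [leRHS]mulrC; exact: dom.
Qed.

(** Only the region where the absolute value of [f] is at most [b] is kept. There the trapezoid
    equals [b], and [onem_cos_ge] costs the relative error [(a * b) ^+ 2 / 4]. *)
Lemma integral_onem_cos_tent_ge (a b v : R) : 0 < b -> a * b <= 2 -> 0 < a ->
  (v%:E <= \int[Pi]_(u in [set u | (`|f u| <= b)%R]) (f u ^+ 2)%:E)%E ->
  ((b * (a ^+ 2 / 2 * (1 - (a * b) ^+ 2 / 4)))%:E * v%:E <=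
   \int[Pi]_u ((1 - cos (a * f u)) * tent b (f u))%:E)%E.
Proof.
move=> b0 ab a0 hv.
set k := b * _.
have k0 : 0 <= k.
  have ab0 : 0 <= a * b by rewrite mulr_ge0// ltW.
  apply: mulr_ge0; first exact: ltW.
  apply: mulr_ge0; first by rewrite divr_ge0// sqr_ge0.
  by move: ab ab0; set y := a * b; nra.
have mA : measurable [set u | (`|f u| <= b)%R].
  rewrite -[X in measurable X]setTI; apply: (measurable_fun_ler _ _) => //.
  by apply: (measurableT_comp (@normr_measurable R setT)).
apply: (@le_trans _ _ (k%:E * \int[Pi]_(u in [set u | (`|f u| <= b)%R]) (f u ^+ 2)%:E)%E).
  by rewrite lee_wpmul2l// lee_fin.
rewrite -ge0_integralZl_EFin//; last 2 first.
- by move=> u _; rewrite lee_fin sqr_ge0.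
- by apply/measurable_EFinP/measurable_funTS; exact: measurable_funX.
rewrite [leLHS]integral_mkcond; apply: ge0_le_integral => //.
- move=> u _; rewrite patchE; case: ifPn => // _; rewrite mule_ge0// lee_fin ?sqr_ge0//.
- apply/(measurable_restrictT _ _).1 => //; apply: emeasurable_funM => //.
  by apply/measurable_EFinP; apply: measurable_funTS; exact: measurable_funX.
- apply/measurable_EFinP/measurable_funM; last exact: (measurableT_comp (measurable_tent b)).
  by apply: measurable_funB => //; exact: measurable_cosf.
- move=> u _; rewrite patchE; case: ifPn => [|_]; last first.
    rewrite (_ : point = 0%E)// lee_fin mulr_ge0 ?onem_cos_ge0//.
    by rewrite tent_ge0// ltW.
  rewrite inE/= => fb; rewrite -EFinM lee_fin tent_in// mulrC [leLHS]mulrC /k.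
  rewrite -(mulrA b) [leRHS]mulrC ler_pM2l//.
  have af : `|a * f u| <= a * b by rewrite normrM (gtr0_norm a0) ler_wpM2l// ltW.
  apply: le_trans (onem_cos_ge (le_trans af ab)).
  have : (a * f u) ^+ 2 <= (a * b) ^+ 2.
    by rewrite -[leLHS]real_normK ?num_real// ler_sqr ?nnegrE//; nra.
  have -> : (a * f u) ^+ 4 = ((a * f u) ^+ 2) ^+ 2 by rewrite -exprM.
  have -> : a ^+ 2 / 2 * (1 - (a * b) ^+ 2 / 4) * f u ^+ 2 =
    (a * f u) ^+ 2 / 2 * (1 - (a * b) ^+ 2 / 4) by rewrite exprMn; ring.
  move: (sqr_ge0 (a * f u)); set x := (a * f u) ^+ 2; set y := (a * b) ^+ 2.
  nra.
Qed.

(** The threshold [N] precedes the choice of the law: the limit concerns [ghat] alone, which depends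
    on the span and on [psi]. One [N] thus serves every increment of the given length, wherever it
    starts. *)
Lemma small_time_second_moment (r b v eta : R) : 0 < r -> 0 < b -> 0 < v ->
  0 < eta -> eta < 1 ->
  (v%:E <= \int[Pi]_(u in [set u | (`|f u| <= b)%R]) (f u ^+ 2)%:E)%E ->
  (forall n a t, `|ghat (r / n.+1%:R) a t| <= r / n.+1%:R * psi a) ->
  exists N, forall n, (N <= n)%N ->
    forall d' (W : measurableType d') (Q : probability W R) (z : W -> R),
    symm_transform (r / n.+1%:R) Q z ->
    (((1 - eta) * (r / n.+1%:R) * v)%:E <=
      \int[Q]_(w in [set w | (`|z w| <= 2 * b)%R]) (z w ^+ 2)%:E)%E.
Proof.
move=> r0 b0 v0 e0 e1 hv dom; have c0 := @dirichlet_cst_gt0 R.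
pose a := eta / b.
have a0 : 0 < a by rewrite divr_gt0.
have ab : a * b = eta by rewrite /a mulfVK// gt_eqF.
have hT := integral_onem_cos_tent_ge b0 _ a0 hv; rewrite ab in hT.
have {}hT := hT (ltW (lt_trans e1 (ltr1n _ 2))).
have hc := @cvg_integral_ghat r a b r0 (fun n => dom n a).
pose k := dirichlet_cst * (b * (a ^+ 2 / 2)) * (1 - eta) * v.
have klt : (k%:E < dirichlet_cst%:E *
    \int[Pi]_u ((1 - cos (a * f u)) * tent b (f u))%:E)%E.
  apply: (@lt_le_trans _ _ (dirichlet_cst%:E *
     ((b * (a ^+ 2 / 2 * (1 - eta ^+ 2 / 4)))%:E * v%:E))%E); last first.
    by rewrite lee_wpmul2l// lee_fin ltW.
  have a2 : 0 < a ^+ 2 / 2 by rewrite divr_gt0// exprn_gt0.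
  have K0 : 0 < dirichlet_cst * (b * (a ^+ 2 / 2)) * v by rewrite mulr_gt0// mulr_gt0// mulr_gt0.
  have h : 1 - eta < 1 - eta ^+ 2 / 4 by nra.
  have := h; rewrite -(ltr_pM2l K0) -!EFinM lte_fin; congr (_ < _) => //.
    by rewrite /k; ring.
  by ring.
have [N _ hN] := hc _ (open_ereal_gt_ereal klt).
exists N => n Nn d' W Q z zQ.
have rn : 0 < r / n.+1%:R by rewrite divr_gt0.
apply: le_trans (truncated_moment_ge zQ (lt0r_neq0 a0) b0).
have {}hN : (k%:E < \int[mu]_t (ghat (r / n.+1%:R) a t / (r / n.+1%:R) * tentker b t)%:E)%E.
  exact: hN Nn.
have E : (\int[mu]_t (ghat (r / n.+1%:R) a t * tentker b t)%:E =
   (r / n.+1%:R)%:E * \int[mu]_t (ghat (r / n.+1%:R) a t / (r / n.+1%:R) * tentker b t)%:E)%E.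
  rewrite -integralZl//; last first.
    have iP : mu.-integrable setT (fun t => (psi a)%:E * (EFin \o tentker b) t)%E.
      by apply: integrableZl => //; exact: integrable_tentker.
    apply: (le_integrable _ _ _ iP) => //.
    - apply/measurable_EFinP/measurable_funM; last exact: measurable_tentker.
      by apply: measurable_funM => //; exact: measurable_ghat.
    - move=> t _; rewrite /= lee_fin !normrM ler_wpM2r//.
      have rn' : 0 < (r / n.+1%:R)^-1 by rewrite invr_gt0.
      rewrite (gtr0_norm rn') ler_pdivrMr// (ger0_norm (levy_exponent_ge0 _ _ _)).
      by rewrite [leRHS]mulrC; exact: dom.
  apply: eq_integral => t _; rewrite -EFinM; congr EFin; field.
  by rewrite addrC natr1 !gt_eqF.
rewrite E; apply: (@le_trans _ _ ((2 / (a ^+ 2 * b) / dirichlet_cst)%:E *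
   ((r / n.+1%:R)%:E * k%:E))%E); last first.
  rewrite lee_wpmul2l ?lee_fin//; last by rewrite lee_wpmul2l ?ltW// lee_fin ltW.
  rewrite divr_ge0 ?(ltW c0)// divr_ge0// mulr_ge0 ?(ltW b0)//.
  by rewrite exprn_ge0// ltW.
rewrite -!EFinM lee_fin /k le_eqVlt; apply/orP; left; apply/eqP; field.
by rewrite addrC natr1 !gt_eqF.
Qed.

Lemma integral_onem_cos_itv (y e : R) : 0 < e -> y != 0 ->
  (\int[mu]_(t in `[0%R, e]) (1 - cos (t * y))%:E = (e - sin (e * y) / y)%:E)%E.
Proof.
move=> e0 yN0; pose F (t : R) := t - y^-1 * sin (t * y).
have dF (t : R) : is_derive t 1 F (1 - cos (t * y)).
  have h1 : is_derive t 1 (fun t : R => t * y) y.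
    by apply: is_derive_eq; rewrite scaler0 add0r scaler1 /GRing.scale/= ?mulr1.
  have h2 := @is_derive1_comp R sin (fun t => t * y) t _ _ (is_derive_sin (t * y)) h1.
  have h3 : is_derive t 1 (fun t => y^-1 * sin (t * y)) (cos (t * y)).
    have -> : cos (t * y) = y^-1 *: (cos (t * y) * y).
      by rewrite /GRing.scale/= mulrCA mulVf ?mulr1.
    exact: is_deriveZ.
  exact: is_deriveB.
rewrite (@continuous_FTC2 _ _ F)//.
- by rewrite /F mul0r sin0 mulr0 subr0 sube0 mulrC.
- apply: continuous_subspaceT => t; apply: cvgB; first exact: cvg_cst.
  apply: continuous_comp; last exact: continuous_cos.
  by apply: cvgM; [exact: cvg_id|exact: cvg_cst].
- have cF t : F x @[x --> t] --> F t.
    by apply/differentiable_continuous/derivable1_diffP; exact: ex_derive.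
  split => //; [exact: cvg_at_right_filter|exact: cvg_at_left_filter].
- by move=> t _; rewrite derive1E; exact: derive_val.
Qed.

(** The truncation inequality for characteristic functions: integrating [1 - cos (t * y)] over
    [0 <= t <= e] with [e = 1 / b] leaves at least [e / 2] when [y] is beyond [2 * b]. On the
    transform side [1 - expR (- (s * psi t)) <= s * psi t] makes the bound linear in [s], with a
    constant independent of the law. *)
Lemma symm_transform_tail (b : R) : 0 < b -> exists2 C : R, 0 <= C &
  forall (s : R) d' (W : measurableType d') (Q : probability W R) (z : W -> R),
    0 < s -> symm_transform s Q z ->
    (Q [set w | (2 * b < `|z w|)%R] <= (C * s)%:E)%E.
Proof.
move=> b0; have [M M0 psiM] := levy_exponent_le mf fPi.
pose e := b^-1; have e0 : 0 < e by rewrite invr_gt0.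
exists (2 * (2 + e ^+ 2) * M) => [|s d' W Q z s0 zQ].
  by rewrite !mulr_ge0// addr_ge0// sqr_ge0.
have mz : measurable_fun setT z by case: zQ.
have mA : measurable [set w | (2 * b < `|z w|)%R].
  rewrite -[X in measurable X]setTI; apply: (measurable_fun_ltr _ _) => //.
  by apply: (measurableT_comp (@normr_measurable R setT)).
pose D : set R := [set` `[0%R, e]].
pose F (p : measurableTypeR R * W) : \bar R :=
  ((\1_D p.1 : R) * (1 - cos (p.1 * z p.2)))%:E.
have F0 p : (0 <= F p)%E.
  by rewrite lee_fin mulr_ge0 ?onem_cos_ge0// indicE; case: (_ \in _).
have mF : measurable_fun setT F.
  apply/measurable_EFinP/measurable_funM.
    have mI : measurable_fun setT (\1_D : R -> R) by apply/measurable_indicP; exact: measurable_itv.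
    exact: (measurableT_comp mI measurable_fst).
  apply: measurable_funB => //; apply: (measurableT_comp measurable_cos).
  by apply: measurable_funM => //; exact: measurableT_comp.
have FE w : (\int[mu]_t F (t, w) = \int[mu]_(t in D) (1 - cos (t * z w))%:E)%E.
  rewrite [RHS]integral_mkcond; apply: eq_integral => t _.
  rewrite patchE /F/= indicE; case: ifPn => tD; first by rewrite mul1r.
  by rewrite mul0r.
have := @fubini_tonelli _ _ _ _ _ mu Q F mF F0.
have -> : (\int[mu]_t \int[Q]_w F (t, w) =
    \int[mu]_(t in D) (1 - expR (- (s * psi t)))%:E)%E.
  rewrite [RHS]integral_mkcond; apply: eq_integral => t _.
  rewrite patchE /F/= indicE; case: ifPn => tD /=.
    by under eq_integral do rewrite mul1r; exact: integral_onem_cosz.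
  by under eq_integral do rewrite mul0r; rewrite integral0.
move=> FT.
have up : (\int[mu]_(t in D) (1 - expR (- (s * psi t)))%:E <=
    (e * (s * ((2 + e ^+ 2) * M)))%:E)%E.
  have muD : mu D = e%:E by rewrite lebesgue_measure_itv/= lte_fin e0 sube0.
  apply: (@le_trans _ _ (\int[mu]_(t in D) (s * ((2 + e ^+ 2) * M))%:E)%E); last first.
    by rewrite integral_cst; [rewrite [leLHS](_ : _ = ((s * ((2 + e ^+ 2) * M))%:E * mu D)%E)//;
      rewrite muD -EFinM mulrC|exact: measurable_itv].
  apply: ge0_le_integral => //.
  - exact: measurable_itv.
  - move=> t _; rewrite lee_fin subr_ge0 -expR0 ler_expR oppr_le0.
    by rewrite mulr_ge0 ?levy_exponent_ge0// ltW.
  - apply/measurable_EFinP/measurable_funTS/measurable_funB => //.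
    apply: (measurableT_comp (@measurable_expR R)); apply: measurable_funN.
    by apply: measurable_funM => //; exact: measurable_levy_exponent.
  - move=> t; rewrite /D/= in_itv/= => /andP[t0 te]; rewrite lee_fin.
    apply: le_trans (onem_expRN_le _) _; rewrite ler_pM2l//.
    apply: le_trans (psiM t) _; apply: ler_wpM2r => //.
    by rewrite lerD2l ler_sqr ?nnegrE// ltW.
have low : ((e / 2)%:E * Q [set w | (2 * b < `|z w|)%R] <= \int[Q]_w \int[mu]_t F (t, w))%E.
  rewrite -(@integral_cst _ _ _ Q _ mA) integral_mkcond.
  apply: ge0_le_integral => //.
  - by move=> w _; rewrite patchE; case: ifPn => // _; rewrite lee_fin divr_ge0// ltW.
  - by apply/(measurable_restrictT _ _).1.
  - exact: measurable_fun_fubini_tonelli_G.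
  move=> w _; rewrite patchE; case: ifPn => [|_]; last exact: integral_ge0.
  rewrite inE/= => zb; have z0 : 0 < `|z w| by apply: lt_trans zb; rewrite mulr_gt0.
  rewrite FE integral_onem_cos_itv// -?normr_gt0// lee_fin.
  suff : sin (e * z w) / z w <= e / 2 by lra.
  apply: le_trans (ler_norm _) _; rewrite normrM normfV ler_pdivrMr//.
  apply: le_trans (sin_max _) _.
  rewrite mulrAC ler_pdivlMr// mul1r mulrC ler_pdivlMr//; exact: ltW.
have := le_trans low (le_trans _ up).
rewrite FT lexx => /(_ isT).
have QE : Q [set w | (2 * b < `|z w|)%R] = (fine (Q [set w | (2 * b < `|z w|)%R]))%:E.
  by rewrite fineK// fin_num_measure.
rewrite QE -EFinM !lee_fin => h.
have e2 : 0 < e / 2 by rewrite divr_gt0.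
rewrite -(ler_pM2l e2); apply: le_trans h _.
by rewrite le_eqVlt; apply/orP; left; apply/eqP; field.
Qed.

End small_time_moment.

(** * From a symmetrized increment back to the increment *)

Section product_probability.
Local Open Scope ereal_scope.
Context d1 d2 (T1 : measurableType d1) (T2 : measurableType d2) (R : realType).
Variables (P1 : probability T1 R) (P2 : probability T2 R).

Let prod := P1 \x P2.

HB.instance Definition _ := Measure.on prod.

Let prod_setT : prod setT = 1.
Proof.
rewrite -setXTT /prod product_measure1E// -[RHS]mule1.
by congr (_ * _); exact: probability_setT.
Qed.

HB.instance Definition _ := Measure_isProbability.Build _ _ _ prod prod_setT.

Definition product_prob : probability (T1 * T2)%type R := prod.

End product_probability.

Section bounded_weight.
Context {R : realType} d (T : measurableType d) (P : probability T R).
Local Open Scope ereal_scope.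

Lemma integrable_bounded (g : T -> R) (M : R) : measurable_fun setT g ->
  (forall w, (`|g w| <= M)%R) -> P.-integrable setT (EFin \o g).
Proof.
move=> mg gM; apply: measurable_bounded_integrable => //.
- by rewrite -ge0_fin_numE// fin_num_measure.
- by exists M; split => [|x Mx w _]; [rewrite num_real|exact: le_trans (gM w) (ltW Mx)].
Qed.

End bounded_weight.

Section kept_set.
Context {R : realType} d (T : measurableType d) (P : probability T R) (xi : T -> R).
Hypothesis mxi : measurable_fun setT xi.
Local Notation P2 := (product_prob P P).
Let z (w : T * T) : R := xi w.1 - xi w.2.

Let mz : measurable_fun setT z.
Proof. by apply: measurable_funB; exact: measurableT_comp. Qed.

(** If no centre were suitable, none of the values [xi w] would be; integrating over [w] by Fubini
    would then give the symmetrized tail a mass of at least [p']. *)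
Lemma symmetrization_center (e p p' : R) :
  (P2 [set w | (e < `|z w|)%R] <= p%:E)%E -> p < p' ->
  exists c, (P [set w | (e < `|xi w - c|)%R] <= p'%:E)%E.
Proof.
move=> hp pp'; apply: contrapT => hn.
have h w : (p'%:E <= P [set w' | (e < `|xi w' - xi w|)%R])%E.
  by rewrite leNgt; apply/negP => hlt; apply: hn; exists (xi w); exact: ltW.
have : (p'%:E <= P2 [set w | (e < `|z w|)%R])%E.
  have mA : measurable [set w | (e < `|z w|)%R].
    rewrite -[X in measurable X]setTI; apply: (measurable_fun_ltr _ _) => //.
    by apply: (measurableT_comp (@normr_measurable R setT)).
  rewrite (_ : P2 _ = \int[P]_w P (xsection [set w | (e < `|z w|)%R] w))%E//.
  have -> : p'%:E = (\int[P]_w p'%:E)%E.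
    by rewrite integral_cst// [X in (_ * X)%E](probability_setT P) mule1.
  have [p'0|/ltW p'0] := leP 0 p'; last first.
    by rewrite integral_cst// [X in (_ * X)%E](probability_setT P) mule1
      (le_trans _ (integral_ge0 _ _))// lee_fin.
  apply: ge0_le_integral => //; first exact: measurable_fun_xsection.
  move=> w _; apply: le_trans (h w) _; rewrite le_eqVlt; apply/orP; left; apply/eqP.
  congr (P _); apply/seteqP; split => w'; rewrite /xsection/= inE/= /z/= distrC//.
by move=> /le_trans/(_ hp); rewrite lee_fin leNgt pp'.
Qed.

(* The loss [4 b^2 p^2] comes from the pairs at distance at most [2b] that are not
   both within [4b] of [c]: both of their members are then farther than [2b] from [c]. *)
Lemma kept_set (b p vs c : R) : 0 < b -> 0 <= p -> p < 1 ->
  (P [set w | (2 * b < `|xi w - c|)%R] <= p%:E)%E ->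
  (vs%:E <= \int[P2]_(w in [set w | (`|z w| <= 2 * b)%R]) (z w ^+ 2)%:E)%E ->
  exists (K : set T) (m : R), [/\ measurable K, (P (~` K) <= p%:E)%E,
    forall w, K w -> `|xi w - m| <= 8 * b,
    (\int[P]_w ((\1_K w : R) * (xi w - m))%:E = 0)%E &
    (((vs - 4 * b ^+ 2 * p ^+ 2) / 2)%:E <= \int[P]_w ((\1_K w : R) * (xi w - m) ^+ 2)%:E)%E].
Proof.
move=> b0 p0 p1 hN hv.
have mabs (e : R) : measurable [set w | (`|xi w - c| <= e)%R].
  rewrite -[X in measurable X]setTI; apply: (measurable_fun_ler _ _) => //.
  apply: (measurableT_comp (@normr_measurable R setT)); exact: measurable_funB.
pose K := [set w | (`|xi w - c| <= 4 * b)%R].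
pose N := [set w | (2 * b < `|xi w - c|)%R].
have NE : N = ~` [set w | (`|xi w - c| <= 2 * b)%R].
  by apply/seteqP; split => w /=; rewrite /N/= ltNge => /negP.
have mK : measurable K by exact: mabs.
have mN : measurable N by rewrite NE; apply: measurableC.
have hK : (P (~` K) <= p%:E)%E.
  apply: le_trans hN; apply: le_measure; rewrite ?inE//; first exact: measurableC.
  by move=> w /negP; rewrite -ltNge; apply: le_lt_trans; rewrite ler_pM2r// ler_nat.
pose k : T -> R := \1_K.
have mk : measurable_fun setT k by exact: measurable_indic.
have k01 w : 0 <= k w <= 1 by rewrite /k indicE; case: (_ \in _); rewrite ?ler01 ?lexx.
pose kap := fine (P K).
have PK : P K = kap%:E by rewrite /kap fineK// fin_num_measure.
have kap1 : kap <= 1 by rewrite -lee_fin -PK probability_le1.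
have kap0 : 0 < kap.
  move: hK; rewrite probability_setC// PK -EFinB lee_fin => h.
  by rewrite -subr_gt0; lra.
have ik : (\int[P]_w (k w)%:E = kap%:E)%E by rewrite /k integral_indic// setIT.
have kc w : `|k w * (xi w - c)| <= 4 * b.
  rewrite /k indicE; case: (boolP (w \in K)); rewrite ?(inE,notin_setE) => hw.
    by rewrite mul1r.
  by rewrite mul0r normr0 mulr_ge0// ltW.
have mkc x : measurable_fun setT (fun w => k w * (xi w - x)).
  by apply: measurable_funM => //; exact: measurable_funB.
have ikc : P.-integrable setT (EFin \o (fun w => k w * (xi w - c))).
  exact: integrable_bounded (mkc c) kc.
pose q := fine (\int[P]_w (k w * (xi w - c))%:E)%E.
have qE : (\int[P]_w (k w * (xi w - c))%:E = q%:E)%E.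
  by rewrite /q fineK//; exact: integrable_fin_num ikc.
(* The mean of [xi] conditionally on [K]. It lies within [4 * b] of [c], which is how the radius
   [8 * b] around [m] arises. *)
pose m := c + q / kap.
have q_le : `|q| <= 4 * b * kap.
  rewrite -lee_fin -abse_EFin -qE; apply: le_trans (le_abse_integral _ _ _) _ => //.
    exact/measurable_EFinP.
  rewrite EFinM -ik -ge0_integralZl_EFin//; last 3 first.
  - by move=> w _; rewrite lee_fin; case/andP: (k01 w).
  - exact/measurable_EFinP.
  - by rewrite mulr_ge0// ltW.
  apply: ge0_le_integral => //.
  - by apply: measurableT_comp => //; exact/measurable_EFinP.
  - by apply: emeasurable_funM => //; exact/measurable_EFinP.
  move=> w _; rewrite -EFinM /= lee_fin normrM mulrC /k indicE.
  case: (boolP (w \in K)); rewrite ?(inE,notin_setE) => hw.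
    by rewrite normr1 !mulr1.
  by rewrite normr0 !mulr0.
have mc : `|m - c| <= 4 * b.
  by rewrite /m addrC addKr normrM normfV (gtr0_norm kap0) ler_pdivrMr.
have xiK w : K w -> `|xi w - m| <= 8 * b.
  move=> Kw; have -> : xi w - m = (xi w - c) - (m - c) by ring.
  apply: le_trans (ler_normB _ _) _; have := mc; move: Kw; rewrite /K/=; lra.
have i0 : (\int[P]_w (k w * (xi w - m))%:E = 0)%E.
  have E w : k w * (xi w - m) = k w * (xi w - c) - q / kap * k w by rewrite /m; ring.
  under eq_integral do rewrite E.
  have ik' : P.-integrable setT (EFin \o (fun w => q / kap * k w)).
    apply: (@integrable_bounded _ _ _ _ _ `|q / kap|); first exact: measurable_funM.
    by move=> w; rewrite normrM ler_piMr// ger0_norm; case/andP: (k01 w).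
  have := integralB_EFin measurableT ikc ik'; rewrite /= => ->; rewrite qE.
  under eq_integral do rewrite EFinM.
  rewrite integralZl//; last first.
    apply: (@integrable_bounded _ _ _ _ _ 1) => // w.
    by rewrite ger0_norm; case/andP: (k01 w).
  by rewrite ik -EFinM mulfVK ?gt_eqF// subee.
exists K, m; split => //.
pose x w := xi w - m; pose kx w := k w * x w; pose kx2 w := k w * x w ^+ 2.
have mx : measurable_fun setT x by exact: measurable_funB.
have mkx : measurable_fun setT kx by exact: measurable_funM.
have mkx2 : measurable_fun setT kx2 by apply: measurable_funM => //; exact: measurable_funX.
have kxb w : `|kx w| <= 8 * b /\ `|kx2 w| <= (8 * b) ^+ 2.
  rewrite /kx /kx2 /k indicE; case: (boolP (w \in K)); rewrite ?(inE,notin_setE) => hw.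
    by rewrite !mul1r normrX; split; rewrite ?ler_sqr ?nnegrE ?mulr_ge0 ?(ltW b0)//; exact: xiK.
  by rewrite !mul0r normr0 sqr_ge0 mulr_ge0// ltW.
have iK : P.-integrable setT (EFin \o k).
  by apply: (@integrable_bounded _ _ _ _ _ 1) => // w; rewrite ger0_norm; case/andP: (k01 w).
have iKx : P.-integrable setT (EFin \o kx) by apply: integrable_bounded mkx (fun w => (kxb w).1).
have iKx2 : P.-integrable setT (EFin \o kx2) by apply: integrable_bounded mkx2 (fun w => (kxb w).2).
pose S := fine (\int[P]_w (kx2 w)%:E)%E.
have SE : (\int[P]_w (kx2 w)%:E = S%:E)%E.
  by rewrite /S fineK//; exact: integrable_fin_num iKx2.
have kx20 w : 0 <= kx2 w by rewrite mulr_ge0 ?sqr_ge0//; case/andP: (k01 w).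
have S0 : 0 <= S by rewrite -lee_fin -SE; apply: integral_ge0 => w _; rewrite lee_fin.
rewrite -/k -/kx2 SE.
pose F (u : T * T) : R := k u.1 * k u.2 * z u ^+ 2.
have mF : measurable_fun setT F.
  apply: measurable_funM; last exact: measurable_funX.
  by apply: measurable_funM; exact: measurableT_comp.
have F0 u : 0 <= F u.
  by rewrite mulr_ge0 ?sqr_ge0// mulr_ge0.
(* The square of the difference of two independent copies is expanded; the cross term vanishes
   because [m] centres [xi] on [K]. *)
have iF : (\int[P2]_u (F u)%:E = (2 * kap * S)%:E)%E.
  rewrite [LHS](fubini_tonelli1 (EFin \o F))//; last exact/measurable_EFinP.
  transitivity (\int[P]_w ((kap * kx2 w + S * k w)%:E))%E.
    apply: eq_integral => w _; rewrite /fubini_F/=.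
    have E w' : F (w, w') = kx2 w * k w' + k w * kx2 w' - (2 * kx w) * kx w'.
      by rewrite /F /kx2 /kx /z /x/=; ring.
    under eq_integral do rewrite E.
    have i1 : P.-integrable setT (EFin \o (fun w' => kx2 w * k w')).
      by have := integrableZl measurableT (kx2 w) iK.
    have i2 : P.-integrable setT (EFin \o (fun w' => k w * kx2 w')).
      by have := integrableZl measurableT (k w) iKx2.
    have i3 : P.-integrable setT (EFin \o (fun w' => 2 * kx w * kx w')).
      by have := integrableZl measurableT (2 * kx w) iKx.
    have i12 : P.-integrable setT (EFin \o (fun w' => kx2 w * k w' + k w * kx2 w')).
      by have := integrableD measurableT i1 i2.
    have := integralB_EFin measurableT i12 i3; rewrite /= => ->.
    have := integralD_EFin measurableT i1 i2; rewrite /= => ->.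
    under eq_integral do rewrite EFinM.
    under [X in (_ + X - _)%E]eq_integral do rewrite EFinM.
    under [X in (_ - X)%E]eq_integral do rewrite EFinM.
    rewrite !integralZl// ik SE i0 mule0 sube0 -!EFinM -EFinD.
    by congr EFin; ring.
  have i1 : P.-integrable setT (EFin \o (fun w' => kap * kx2 w')).
    by have := integrableZl measurableT kap iKx2.
  have i2 : P.-integrable setT (EFin \o (fun w' => S * k w')).
    by have := integrableZl measurableT S iK.
  have := integralD_EFin measurableT i1 i2; rewrite /= => ->.
  under eq_integral do rewrite EFinM.
  under [X in (_ + X)%E]eq_integral do rewrite EFinM.
  rewrite !integralZl// ik SE -!EFinM -EFinD.
  by congr EFin; ring.
pose n : T -> R := \1_N.
have mn : measurable_fun setT n by exact: measurable_indic.
have n0 w : 0 <= n w by rewrite /n indicE; case: (_ \in _).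
pose G (u : T * T) : R := 4 * b ^+ 2 * (n u.1 * n u.2).
have mG : measurable_fun setT G.
  apply: measurable_funM => //.
  by apply: measurable_funM; exact: measurableT_comp.
have b2 : 0 <= 4 * b ^+ 2 by rewrite mulr_ge0// sqr_ge0.
have G0 u : 0 <= G u := mulr_ge0 b2 (mulr_ge0 (n0 _) (n0 _)).
have iG : (\int[P2]_u (G u)%:E <= (4 * b ^+ 2 * p ^+ 2)%:E)%E.
  rewrite /G; under eq_integral do rewrite EFinM.
  rewrite ge0_integralZl_EFin//; last 2 first.
  - by move=> u _; rewrite lee_fin mulr_ge0.
  - by apply/measurable_EFinP; apply: measurable_funM; exact: measurableT_comp.
  rewrite (EFinM (4 * b ^+ 2)) lee_wpmul2l//.
  rewrite [leLHS](fubini_tonelli1 (fun u : T * T => (n u.1 * n u.2)%:E))//; last 2 first.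
  - by apply/measurable_EFinP; apply: measurable_funM; exact: measurableT_comp.
  - by move=> u; rewrite lee_fin mulr_ge0.
  have iN : (\int[P]_w (n w)%:E <= p%:E)%E by rewrite /n integral_indic// setIT.
  apply: (@le_trans _ _ (\int[P]_w ((n w)%:E * p%:E))%E).
    apply: ge0_le_integral => //.
    - move=> w _; apply: integral_ge0 => w' _; rewrite lee_fin mulr_ge0//.
    - apply: (measurable_fun_fubini_tonelli_F (fun u : T * T => (n u.1 * n u.2)%:E)) => //.
        by apply/measurable_EFinP; apply: measurable_funM; exact: measurableT_comp.
      by move=> u; rewrite lee_fin mulr_ge0.
    - by apply: emeasurable_funM => //; exact/measurable_EFinP.
    move=> w _; rewrite /fubini_F/=; under eq_integral do rewrite EFinM.
    rewrite ge0_integralZl_EFin//; last 2 first.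
    - by move=> w' _; rewrite lee_fin.
    - exact/measurable_EFinP.
    by rewrite lee_wpmul2l// lee_fin.
  rewrite ge0_integralZr//; last 2 first.
  - exact/measurable_EFinP.
  - by move=> w _; rewrite lee_fin.
  by rewrite expr2 EFinM lee_wpmul2r// lee_fin.
have mA : measurable [set u | (`|z u| <= 2 * b)%R].
  rewrite -[X in measurable X]setTI; apply: (measurable_fun_ler _ _) => //.
  by apply: (measurableT_comp (@normr_measurable R setT)).
have hFG : (\int[P2]_(w in [set w | (`|z w| <= 2 * b)%R]) (z w ^+ 2)%:E <=
    \int[P2]_u ((F u)%:E + (G u)%:E))%E.
  rewrite [leLHS]integral_mkcond; apply: ge0_le_integral => //.
  - by move=> u _; rewrite patchE; case: ifPn => // _; rewrite lee_fin sqr_ge0.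
  - apply/(measurable_restrictT _ _).1 => //; apply/measurable_EFinP.
    by apply: measurable_funTS; exact: measurable_funX.
  - by apply: emeasurable_funD; exact/measurable_EFinP.
  move=> u _; rewrite patchE; case: ifPn => [|_]; last by rewrite -EFinD lee_fin addr_ge0.
  rewrite inE/= => zb; rewrite -EFinD lee_fin.
  have z2 : z u ^+ 2 <= 4 * b ^+ 2.
    rewrite (_ : 4 * b ^+ 2 = (2 * b) ^+ 2); last by ring.
    rewrite -[leLHS]real_normK ?num_real// ler_sqr ?nnegrE//.
    by rewrite mulr_ge0// ltW.
  have NK (w w' : T) : `|xi w - xi w'| <= 2 * b -> ~ K w -> N w /\ N w'.
    move=> h1 /negP; rewrite -ltNge => h2; split.
      by rewrite /N/=; apply: lt_trans h2; rewrite ltr_pM2r// ltr_nat.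
    rewrite /N/=; have := ler_distD (xi w') (xi w) c; lra.
  have [K1|K1] := pselect (K u.1); last first.
    have [N1 N2] := NK _ _ zb K1.
    rewrite /G /n !indicE (mem_set N1) (mem_set N2) !mulr1.
    by apply: le_trans z2 _; rewrite lerDr.
  have [K2|K2] := pselect (K u.2); last first.
    have [|N2 N1] := NK u.2 u.1 _ K2; first by rewrite distrC.
    rewrite /G /n !indicE (mem_set N1) (mem_set N2) !mulr1.
    by apply: le_trans z2 _; rewrite lerDr.
  by rewrite /F /k !indicE (mem_set K1) (mem_set K2) !mul1r lerDl.
have := le_trans hv hFG.
rewrite ge0_integralD//; last 4 first.
- by move=> u _; rewrite lee_fin.
- exact/measurable_EFinP.
- by move=> u _; rewrite lee_fin.
- exact/measurable_EFinP.
move=> /le_trans/(_ (leeD (lexx _) iG)); rewrite iF -EFinD !lee_fin.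
have : kap * S <= S by rewrite ler_piMl.
lra.
Qed.

End kept_set.

(** * Exponential moments of a kept increment *)

Section expR_bounds.
Context {R : realType}.
Implicit Types (f df : R -> R) (r u D : R).

Lemma ge0_of_derive f df r : (forall x : R, is_derive x (1 : R) f (df x)) -> f 0 = 0 ->
  (forall x, 0 <= x <= r -> 0 <= df x) -> (forall x, - r <= x <= 0 -> df x <= 0) ->
  forall u, `|u| <= r -> 0 <= f u.
Proof.
move=> dff f0 dfp dfn u; rewrite ler_norml => /andP[ru ur].
have cf : continuous f.
  by move=> x; apply/differentiable_continuous/derivable1_diffP; exact: ex_derive.
have [u0|/ltW u0] := leP 0 u.
  have [c] := MVT_segment u0 (fun x _ => dff x) (continuous_subspaceT cf).
  rewrite in_itv/= f0 !subr0 => /andP[c0 cu] ->.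
  by rewrite mulr_ge0// dfp// c0 (le_trans cu).
have [c] := MVT_segment u0 (fun x _ => dff x) (continuous_subspaceT cf).
rewrite in_itv/= f0 !sub0r => /andP[uc c0] fu.
have h : df c <= 0 by apply: dfn; rewrite c0 (le_trans ru).
by rewrite -oppr_le0 fu mulr_le0_ge0// oppr_ge0.
Qed.

Lemma expR_le_onemV u : u < 1 -> expR u <= (1 - u)^-1.
Proof.
move=> u1; rewrite -[u]opprK expRN opprK lef_pV2 ?posrE ?expR_gt0 ?subr_gt0//.
exact: expR_ge1Dx.
Qed.

Let dquad (k x : R) : is_derive x (1 : R) (fun u : R => expR u - (1 + u + k * u ^+ 2))
  (expR x - (1 + 2 * k * x)).
Proof.
apply: is_derive_eq.
by rewrite /GRing.scale/=; ring.
Qed.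

Lemma expR_quad_ge D u : 0 <= D -> D <= 1 -> `|u| <= D ->
  1 + u + (1 - D) / 2 * u ^+ 2 <= expR u.
Proof.
move=> D0 D1 uD; rewrite -subr_ge0.
apply: (ge0_of_derive (dquad ((1 - D) / 2)) _ _ _ uD).
- by rewrite expR0; ring.
- move=> x /andP[x0 xD]; have := expR_ge1Dx x; nra.
- move=> x /andP[xD x0]; have x1 : x < 1 by lra.
  rewrite subr_le0; apply: le_trans (expR_le_onemV x1) _.
  by rewrite -div1r ler_pdivrMr ?subr_gt0//; nra.
Qed.

Lemma expR_quad_le D u : 0 <= D -> D <= 1 -> `|u| <= D / 2 ->
  expR u <= 1 + u + (1 + D) / 2 * u ^+ 2.
Proof.
move=> D0 D1 uD; rewrite -subr_ge0.
have -> : 1 + u + (1 + D) / 2 * u ^+ 2 - expR u =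
  - (expR u - (1 + u + (1 + D) / 2 * u ^+ 2)) by ring.
apply: (@ge0_of_derive (fun u => - (expR u - (1 + u + (1 + D) / 2 * u ^+ 2))) _ (D / 2)
  (fun x => is_deriveN (dquad ((1 + D) / 2) x))) => //.
- by rewrite expR0; ring.
- move=> x /andP[x0 xD]; have x1 : x < 1 by lra.
  rewrite oppr_ge0 subr_le0; apply: le_trans (expR_le_onemV x1) _.
  by rewrite -div1r ler_pdivrMr ?subr_gt0//; nra.
- by move=> x /andP[xD x0]; rewrite oppr_le0; have := expR_ge1Dx x; nra.
Qed.

(** [(1 - D) * x] is at most [x / (1 + x)], and [expR u <= (1 - u)^-1]. This turns a second-order
    expansion into an exponential at a relative cost [D] in the exponent, a form in which the errors
    of many factors do not accumulate. *)
Lemma expR_le_onemD D x : 0 <= x -> x <= D -> expR ((1 - D) * x) <= 1 + x.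
Proof.
move=> x0 xD.
have h : (1 - D) * x <= x / (1 + x) by rewrite ler_pdivlMr; nra.
apply: le_trans (_ : expR (x / (1 + x)) <= _); first by rewrite ler_expR.
have x1 : x / (1 + x) < 1 by rewrite ltr_pdivrMr; lra.
apply: le_trans (expR_le_onemV x1) _.
by rewrite (_ : (1 - x / (1 + x))^-1 = 1 + x)//; field; lra.
Qed.

End expR_bounds.

Section kept_mgf.
Context {R : realType} d (T : measurableType d) (P : probability T R) (xi : T -> R).
Hypothesis mxi : measurable_fun setT xi.
Variables (K : set T) (m B kap s2 : R).
Hypotheses (mK : measurable K) (PK : P K = kap%:E) (kap0 : 0 < kap)
  (KB : forall w, K w -> `|xi w - m| <= B)
  (K1 : (\int[P]_w ((\1_K w : R) * (xi w - m))%:E = 0)%E)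
  (K2 : (\int[P]_w ((\1_K w : R) * (xi w - m) ^+ 2)%:E = s2%:E)%E).

Let k : T -> R := \1_K.
Let mk : measurable_fun setT k. Proof. exact: measurable_indic. Qed.
Let x w := xi w - m.
Let mx : measurable_fun setT x. Proof. exact: measurable_funB. Qed.

Lemma kept_mgf_aux (D a c : R) : 0 <= D -> D <= 1 -> `|a| * B <= D / 2 ->
  (\int[P]_w (k w * (1 + a * x w + c * (a * x w) ^+ 2))%:E = (kap + c * a ^+ 2 * s2)%:E)%E.
Proof.
move=> D0 D1 aB.
have E w : k w * (1 + a * x w + c * (a * x w) ^+ 2) =
  k w + a * (k w * x w) + c * a ^+ 2 * (k w * x w ^+ 2) by ring.
under eq_integral do rewrite E.
have kx w : `|k w| <= 1 /\ (`|k w * x w| <= `|B| /\ `|k w * x w ^+ 2| <= B ^+ 2).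
  rewrite /k indicE; case: (boolP (w \in K)); rewrite ?(inE,notin_setE) => hw.
    have h : `|x w| <= `|B| by rewrite (le_trans (KB hw))// ler_norm.
    rewrite !mul1r normr1; split => //; split => //.
    by rewrite normrX -(real_normK (num_real B)) ler_sqr ?nnegrE.
  by rewrite !mul0r normr0 sqr_ge0.
have i1 : P.-integrable setT (EFin \o k) by exact: integrable_bounded mk (fun w => (kx w).1).
have i2 : P.-integrable setT (EFin \o (fun w => k w * x w)).
  by apply: integrable_bounded (fun w => (kx w).2.1); exact: measurable_funM.
have i3 : P.-integrable setT (EFin \o (fun w => k w * x w ^+ 2)).
  by apply: integrable_bounded (fun w => (kx w).2.2); apply: measurable_funM => //; exact: measurable_funX.
have i2' : P.-integrable setT (EFin \o (fun w => a * (k w * x w))).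
  by have := integrableZl measurableT a i2.
have i3' : P.-integrable setT (EFin \o (fun w => c * a ^+ 2 * (k w * x w ^+ 2))).
  by have := integrableZl measurableT (c * a ^+ 2) i3.
have i12 : P.-integrable setT (EFin \o (fun w => k w + a * (k w * x w))).
  by have := integrableD measurableT i1 i2'.
have := integralD_EFin measurableT i12 i3'; rewrite /= => ->.
have := integralD_EFin measurableT i1 i2'; rewrite /= => ->.
under [X in (_ + X + _)%E]eq_integral do rewrite EFinM.
under [X in (_ + X)%E]eq_integral do rewrite EFinM.
rewrite !integralZl// K1 K2 mule0 adde0 integral_indic// setIT.
by rewrite (_ : (_ + _)%E = (kap%:E + (c * a ^+ 2)%:E * s2%:E)%E)// -PK.
Qed.

(** The linear term of the expansion integrates to 0 by centring. One half of [D] is spent on the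
    quadratic approximation of the exponential on [K], the other half, in the lower bound only, on
    converting [1 + x] into an exponential. *)
Lemma kept_mgf (D a : R) : 0 <= D -> D <= 1 -> `|a| * B <= D / 4 ->
  ((kap * expR ((1 - D) * (a ^+ 2 * (s2 / kap) / 2)))%:E <=
     \int[P]_w (k w * expR (a * x w))%:E)%E /\
  (\int[P]_w (k w * expR (a * x w))%:E <=
     (kap * expR ((1 + D) * (a ^+ 2 * (s2 / kap) / 2)))%:E)%E.
Proof.
move=> D0 D1 aB; pose D' := D / 2.
have D'0 : 0 <= D' by rewrite /D'; lra.
have D'1 : D' <= 1 by rewrite /D'; lra.
have aB' : `|a| * B <= D' / 2 by rewrite /D'; lra.
have k0 w : 0 <= k w by rewrite /k indicE; case: (_ \in _).
have mh c : measurable_fun setT (fun w => k w * (1 + a * x w + c * (a * x w) ^+ 2)).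
  apply: measurable_funM => //; apply: measurable_funD.
    by apply: measurable_funD => //; exact: measurable_funM.
  by apply: measurable_funM => //; apply: measurable_funX; exact: measurable_funM.
have me : measurable_fun setT (fun w => k w * expR (a * x w)).
  apply: measurable_funM => //; apply: (measurableT_comp (@measurable_expR R)).
  exact: measurable_funM.
have axb w : K w -> `|a * x w| <= D' / 2.
  by move=> Kw; rewrite normrM (le_trans _ aB')// ler_wpM2l// KB.
pose t := a ^+ 2 * (s2 / kap) / 2.
have s20 : 0 <= s2.
  by rewrite -lee_fin -K2; apply: integral_ge0 => w _; rewrite lee_fin mulr_ge0 ?sqr_ge0//; exact: k0.
have t0 : 0 <= t by rewrite /t divr_ge0// mulr_ge0 ?sqr_ge0// divr_ge0// ltW.
have low w : k w * (1 + a * x w + (1 - D') / 2 * (a * x w) ^+ 2) <= k w * expR (a * x w).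
  rewrite /k indicE; case: (boolP (w \in K)); rewrite ?(inE,notin_setE) => hw.
    by rewrite !mul1r; apply: expR_quad_ge => //; have := axb _ hw; lra.
  by rewrite !mul0r.
have up w : k w * expR (a * x w) <= k w * (1 + a * x w + (1 + D') / 2 * (a * x w) ^+ 2).
  rewrite /k indicE; case: (boolP (w \in K)); rewrite ?(inE,notin_setE) => hw.
    by rewrite !mul1r; apply: expR_quad_le => //; exact: axb.
  by rewrite !mul0r.
have q0 w c : 0 <= c -> 0 <= k w * (1 + a * x w + c * (a * x w) ^+ 2).
  move=> c0; rewrite /k indicE; case: (boolP (w \in K)); rewrite ?(inE,notin_setE) => hw.
    rewrite mul1r addr_ge0//; last by rewrite mulr_ge0// sqr_ge0.
    by have := axb _ hw; rewrite ler_norml => /andP[]; lra.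
  by rewrite mul0r.
split.
  apply: (@le_trans _ _ (\int[P]_w (k w * (1 + a * x w + (1 - D') / 2 * (a * x w) ^+ 2))%:E)%E).
    rewrite (kept_mgf_aux _ D'0)// lee_fin -/t.
    have -> : kap + (1 - D') / 2 * a ^+ 2 * s2 = kap * (1 + (1 - D') * t).
      by rewrite /t; field; rewrite gt_eqF.
    rewrite ler_pM2l//.
    have s2b : s2 <= B ^+ 2 * kap.
      rewrite -lee_fin -K2 EFinM -PK -[X in (_ <= _ * X)%E](_ : (\int[P]_w (k w)%:E = _)%E); last first.
        by rewrite /k integral_indic// setIT.
      rewrite -ge0_integralZl_EFin ?sqr_ge0//; last 2 first.
      - by move=> w _; rewrite lee_fin; exact: k0.
      - exact/measurable_EFinP.
      apply: ge0_le_integral => //.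
      - by move=> w _; rewrite lee_fin mulr_ge0 ?sqr_ge0//; exact: k0.
      - by apply/measurable_EFinP/measurable_funM => //; exact: measurable_funX.
      - by apply: emeasurable_funM => //; exact/measurable_EFinP.
      move=> w _; rewrite -EFinM lee_fin mulrC /k indicE.
      case: (boolP (w \in K)); rewrite ?(inE,notin_setE) => hw; last by rewrite !mulr0.
      rewrite !mulr1 -(real_normK (num_real (xi w - m))) ler_sqr ?nnegrE//; first exact: KB.
      exact: le_trans (KB hw).
    have tD : (1 - D') * t <= D'.
      have : t <= (`|a| * B) ^+ 2 / 2.
        rewrite /t ler_pM2r// exprMn real_normK ?num_real// ler_wpM2l ?sqr_ge0//.
        by rewrite ler_pdivrMr.
      have [w Kw] : exists w, K w.
        apply: contrapT => /forallNP h; have K0 : K = set0 by apply/seteqP; split.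
        by move: kap0; rewrite -lte_fin -PK K0 measure0 ltxx.
      have : 0 <= `|a| * B by rewrite mulr_ge0// (le_trans _ (KB Kw)).
      nra.
    apply: le_trans (expR_le_onemD _ tD); last by rewrite mulr_ge0//; lra.
    by rewrite ler_expR mulrA; apply: ler_wpM2r => //; rewrite /D'; nra.
  apply: ge0_le_integral => //.
  - by move=> w _; rewrite lee_fin q0//; lra.
  - exact/measurable_EFinP.
  - exact/measurable_EFinP.
  - by move=> w _; rewrite lee_fin low.
apply: (@le_trans _ _ (\int[P]_w (k w * (1 + a * x w + (1 + D') / 2 * (a * x w) ^+ 2))%:E)%E).
  apply: ge0_le_integral => //.
  - by move=> w _; rewrite lee_fin mulr_ge0// ?expR_ge0//; exact: k0.
  - exact/measurable_EFinP.
  - exact/measurable_EFinP.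
  - by move=> w _; rewrite lee_fin up.
rewrite (kept_mgf_aux _ D'0)// lee_fin -/t.
have -> : kap + (1 + D') / 2 * a ^+ 2 * s2 = kap * (1 + (1 + D') * t).
  by rewrite /t; field; rewrite gt_eqF.
rewrite ler_pM2l//; apply: le_trans (expR_ge1Dx _) _.
by rewrite ler_expR; apply: ler_wpM2r => //; rewrite /D'; lra.
Qed.

End kept_mgf.

(** * Near-Gaussian laws and their tails *)

Section near_gaussian.
Context {R : realType}.

(* The weighted law of [Y] has mass [M] and, after centering, its moment generating
   function on [[-A, A]] is up to [D] that of a Gaussian of variance [S]. *)
Definition near_gaussian (A D S M : R) d (W : measurableType d)
    (L : probability W R) (g Y : W -> R) : Prop :=
  [/\ measurable_fun setT g, measurable_fun setT Y, (forall w, 0 <= g w),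
      (\int[L]_w (g w)%:E = M%:E)%E &
      exists m : R, forall a, `|a| <= A ->
        ((M * expR ((1 - D) * (a ^+ 2 * S / 2)))%:E <=
           \int[L]_w (g w * expR (a * (Y w - m)))%:E)%E /\
        (\int[L]_w (g w * expR (a * (Y w - m)))%:E <=
           (M * expR ((1 + D) * (a ^+ 2 * S / 2)))%:E)%E].

Lemma near_gaussian0 (A D : R) d (W : measurableType d) (L : probability W R) :
  near_gaussian A D 0 1 L (cst 1) (cst 0).
Proof.
have L1 (c : R) : (\int[L]_w c%:E = c%:E)%E.
  by rewrite integral_cst// [X in (_ * X)%E](probability_setT L) mule1.
split => //; first exact: L1.
exists 0 => a _; rewrite /cst.
under eq_integral do rewrite subrr mulr0 expR0 mulr1.
by rewrite L1 mulr0 mul0r !mulr0 expR0 mulr1.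
Qed.

Section step.
Variables (A D S M : R) (d : measure_display) (W : measurableType d).
Variables (L : probability W R) (g Y : W -> R).
Hypothesis LgY : near_gaussian A D S M L g Y.
Variables (d' : measure_display) (T : measurableType d') (P : probability T R) (xi : T -> R).
Hypothesis mxi : measurable_fun setT xi.
Variables (K : set T) (m B kap s2 : R).
Hypotheses (mK : measurable K) (PK : P K = kap%:E) (kap0 : 0 < kap)
  (KB : forall w, K w -> `|xi w - m| <= B)
  (K1 : (\int[P]_w ((\1_K w : R) * (xi w - m))%:E = 0)%E)
  (K2 : (\int[P]_w ((\1_K w : R) * (xi w - m) ^+ 2)%:E = s2%:E)%E)
  (D0 : 0 <= D) (D1 : D <= 1) (B0 : 0 <= B) (AB : A * B <= D / 4).

Let k : T -> R := \1_K.
Let mk : measurable_fun setT k. Proof. exact: measurable_indic. Qed.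
Let k0 w : 0 <= k w. Proof. by rewrite /k indicE; case: (_ \in _). Qed.

Lemma ge0_fubini_mul d1 d2 (W1 : measurableType d1) (W2 : measurableType d2)
    (m1 : {sigma_finite_measure set W1 -> \bar R})
    (m2 : {sigma_finite_measure set W2 -> \bar R}) (f1 : W1 -> R) (f2 : W2 -> R) :
  measurable_fun setT f1 -> measurable_fun setT f2 ->
  (forall w, 0 <= f1 w) -> (forall w, 0 <= f2 w) ->
  (\int[(m1 \x m2)%E]_u (f1 u.1 * f2 u.2)%:E =
   (\int[m1]_w (f1 w)%:E) * \int[m2]_w (f2 w)%:E)%E.
Proof.
move=> mf1 mf2 f10 f20.
rewrite (fubini_tonelli1 (fun u : W1 * W2 => (f1 u.1 * f2 u.2)%:E)); last 2 first.
- by apply/measurable_EFinP; apply: measurable_funM; exact: measurableT_comp.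
- by move=> u; rewrite lee_fin mulr_ge0.
rewrite -ge0_integralZr//; last 3 first.
- exact/measurable_EFinP.
- by move=> w _; rewrite lee_fin.
- by apply: integral_ge0 => w _; rewrite lee_fin.
apply: eq_integral => w _; rewrite /fubini_F/=.
under eq_integral do rewrite EFinM.
rewrite ge0_integralZl_EFin//; last exact/measurable_EFinP.
by move=> w' _; rewrite lee_fin.
Qed.

(** On the product space the exponential moments multiply. [s2 / kap] is the variance of [xi] under
    [P] conditioned on [K], and the mass [kap] of the condition is kept as a separate factor; the
    relative error [D] stays the same. *)
Lemma near_gaussian_step :
  near_gaussian A D (S + s2 / kap) (M * kap) (product_prob L P)
    (fun u : W * T => g u.1 * k u.2) (fun u => Y u.1 + xi u.2).
Proof.
have [mg mY g0 gM [c hc]] := LgY.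
split.
- by apply: measurable_funM; exact: measurableT_comp.
- by apply: measurable_funD; exact: measurableT_comp.
- by move=> u; rewrite mulr_ge0//; exact: k0.
- rewrite [LHS](@ge0_fubini_mul _ _ _ _ L P g k)// gM EFinM; congr (_ * _)%E.
  by rewrite /k integral_indic// setIT.
exists (c + m) => a aA.
have aB : `|a| * B <= D / 4 by rewrite (le_trans _ AB)// ler_wpM2r.
have [l1 u1] := hc a aA.
have [l2 u2] := kept_mgf mxi mK PK kap0 KB K1 K2 D0 D1 aB.
have -> : (\int[product_prob L P]_u (g u.1 * k u.2 * expR (a * (Y u.1 + xi u.2 - (c + m))))%:E =
   (\int[L]_w (g w * expR (a * (Y w - c)))%:E) *
   \int[P]_w (k w * expR (a * (xi w - m)))%:E)%E.
  rewrite -ge0_fubini_mul//.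
  - apply: eq_integral => u _; congr EFin.
    rewrite (_ : a * (_ - _) = a * (Y u.1 - c) + a * (xi u.2 - m)); last by ring.
    by rewrite expRD; ring.
  - apply: measurable_funM => //; apply: (measurableT_comp (@measurable_expR R)).
    by apply: measurable_funM => //; exact: measurable_funB.
  - apply: measurable_funM => //; apply: (measurableT_comp (@measurable_expR R)).
    by apply: measurable_funM => //; exact: measurable_funB.
  - by move=> w; rewrite mulr_ge0 ?expR_ge0.
  - by move=> w; rewrite mulr_ge0 ?expR_ge0//; exact: k0.
have M0 : 0 <= M by rewrite -lee_fin -gM; apply: integral_ge0 => w _; rewrite lee_fin.
have E e : M * kap * expR (e * (a ^+ 2 * (S + s2 / kap) / 2)) =
    M * expR (e * (a ^+ 2 * S / 2)) * (kap * expR (e * (a ^+ 2 * (s2 / kap) / 2))).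
  rewrite (_ : e * (a ^+ 2 * (S + s2 / kap) / 2) =
    e * (a ^+ 2 * S / 2) + e * (a ^+ 2 * (s2 / kap) / 2)); last by ring.
  by rewrite expRD; ring.
rewrite !E !(EFinM (M * _)); split.
- apply: lee_pmul => //; first by rewrite lee_fin mulr_ge0 ?expR_ge0.
  by rewrite lee_fin mulr_ge0 ?expR_ge0// ltW.
- apply: lee_pmul => //; by apply: integral_ge0 => w _; rewrite lee_fin mulr_ge0 ?expR_ge0.
Qed.

End step.

Section tail.
Variables (A D S M : R) (d : measure_display) (W : measurableType d).
Variables (L : probability W R) (g Y : W -> R).
Hypothesis LgY : near_gaussian A D S M L g Y.

(* On [Z < x1] the exponential of rate [a] is dominated by that of the smaller rate [a1],
   on [Z > x2] by that of the larger rate [a2]; what is left is the mass of [x1 <= Z <= x2].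
   This replaces a change of measure in the lower bound of Cramer's theorem. *)
Lemma mgf_tail_split (Z : W -> R) (a a1 a2 x1 x2 m1 m1' m2' : R) :
  measurable_fun setT Z -> 0 <= a -> a1 <= a -> a <= a2 ->
  (m1%:E <= \int[L]_w (g w * expR (a * Z w))%:E)%E ->
  (\int[L]_w (g w * expR (a1 * Z w))%:E <= m1'%:E)%E ->
  (\int[L]_w (g w * expR (a2 * Z w))%:E <= m2'%:E)%E ->
  ((m1 - expR ((a - a1) * x1) * m1' - expR (- ((a2 - a) * x2)) * m2')%:E <=
   (expR (a * x2))%:E * \int[L]_w (g w * \1_[set w | (x1 <= Z w)%R] w)%:E)%E.
Proof.
have [mg _ g0 _ _] := LgY.
move=> mZ a0 a1a aa2 h1 h2 h3.
have mA : measurable [set w | (x1 <= Z w)%R].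
  rewrite -[X in measurable X]setTI; exact: measurable_fun_ler.
have mI : measurable_fun setT (fun w => g w * \1_[set w | (x1 <= Z w)%R] w).
  by apply: measurable_funM => //; exact: measurable_indic.
have me e : measurable_fun setT (fun w => g w * expR (e * Z w)).
  apply: measurable_funM => //; apply: (measurableT_comp (@measurable_expR R)).
  exact: measurable_funM.
have e0 e w : (0 <= (g w * expR (e * Z w))%:E)%E by rewrite lee_fin mulr_ge0 ?expR_ge0.
have i0 w : (0 <= (g w * \1_[set w | (x1 <= Z w)%R] w)%:E)%E.
  by rewrite lee_fin mulr_ge0// indicE; case: (_ \in _).
have key w : g w * expR (a * Z w) <= expR (a * x2) * (g w * \1_[set w | (x1 <= Z w)%R] w) +
    (expR ((a - a1) * x1) * (g w * expR (a1 * Z w)) +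
     expR (- ((a2 - a) * x2)) * (g w * expR (a2 * Z w))).
  rewrite indicE.
  rewrite [X in _ <= X](_ : _ = g w * (expR (a * x2) * (w \in [set w | (x1 <= Z w)%R])%:R +
    (expR ((a - a1) * x1) * expR (a1 * Z w) + expR (- ((a2 - a) * x2)) * expR (a2 * Z w))));
    last by ring.
  apply: ler_wpM2l => //; rewrite -!expRD.
  have p1 := expR_gt0 ((a - a1) * x1 + a1 * Z w).
  have p2 := expR_gt0 (- ((a2 - a) * x2) + a2 * Z w).
  have p3 := expR_gt0 (a * x2).
  case: (boolP (w \in _)); rewrite ?(inE,notin_setE)/= => hw.
    rewrite mulr1; have [hx|/ltW hx] := leP (Z w) x2.
      have : expR (a * Z w) <= expR (a * x2) by rewrite ler_expR ler_wpM2l.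
      lra.
    have : expR (a * Z w) <= expR (- ((a2 - a) * x2) + a2 * Z w) by rewrite ler_expR; nra.
    lra.
  move/negP : hw; rewrite -ltNge => hw.
  have : expR (a * Z w) <= expR ((a - a1) * x1 + a1 * Z w) by rewrite ler_expR; nra.
  lra.
have J e : (\int[L]_w (g w * expR (e * Z w))%:E <= m1'%:E)%E -> 0 <= m1'.
  by move=> h; rewrite -lee_fin; apply: le_trans h; apply: integral_ge0.
have m1'0 := J _ h2.
have m2'0 : 0 <= m2'.
  by rewrite -lee_fin; apply: le_trans h3; apply: integral_ge0.
have : (m1%:E <= (expR (a * x2))%:E * \int[L]_w (g w * \1_[set w | (x1 <= Z w)%R] w)%:E +
    ((expR ((a - a1) * x1) * m1')%:E + (expR (- ((a2 - a) * x2)) * m2')%:E))%E.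
  apply: le_trans h1 _.
  apply: (@le_trans _ _ (\int[L]_w ((expR (a * x2))%:E *
      (g w * \1_[set w | (x1 <= Z w)%R] w)%:E +
      ((expR ((a - a1) * x1))%:E * (g w * expR (a1 * Z w))%:E +
       (expR (- ((a2 - a) * x2)))%:E * (g w * expR (a2 * Z w))%:E)))%E).
    apply: ge0_le_integral => //.
    - exact/measurable_EFinP.
    - apply: emeasurable_funD; [|apply: emeasurable_funD];
        by apply: emeasurable_funM => //; exact/measurable_EFinP.
    - by move=> w _; rewrite -!EFinM -!EFinD lee_fin key.
  have e00 (c : R) : (0 <= (expR c)%:E)%E by rewrite lee_fin expR_ge0.
  rewrite ge0_integralD//; last 4 first.
  - by move=> w _; rewrite mule_ge0.
  - by apply: emeasurable_funM => //; exact/measurable_EFinP.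
  - by move=> w _; rewrite adde_ge0// mule_ge0.
  - by apply: emeasurable_funD; apply: emeasurable_funM => //; exact/measurable_EFinP.
  rewrite ge0_integralD//; last 4 first.
  - by move=> w _; rewrite mule_ge0.
  - by apply: emeasurable_funM => //; exact/measurable_EFinP.
  - by move=> w _; rewrite mule_ge0.
  - by apply: emeasurable_funM => //; exact/measurable_EFinP.
  rewrite !ge0_integralZl_EFin ?expR_ge0//; [|exact/measurable_EFinP..].
  rewrite !EFinM; apply: leeD => //; apply: leeD; rewrite lee_wpmul2l//.
rewrite -EFinD -leeBlDr// -EFinB.
by rewrite opprD addrA.
Qed.

(** The optimal Gaussian rate for the level [xS := Num.sqrt (ell * S)] is [q := Num.sqrt (ell / S)].
    [mgf_tail_split] is used at rate [(1 + e) * q], whose tilted law concentrates near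
    [(1 + e) * xS], between the cut-offs [xS] and [(1 + 2 * e) * xS], with [q] and [(1 + 2 * e) * q]
    as comparison rates. In the exactly Gaussian case each discarded part is smaller by a factor
    [expR (- (e ^+ 2 * ell / 2))]; the error [D] consumes at most half of this exponent, and what
    remains is at least 2, so each discarded part is at most a quarter of the whole. *)
Lemma near_gaussian_tail (e ell x : R) :
  0 < e -> e <= 1 / 2 -> 0 <= D -> D <= e ^+ 2 / 20 -> 8 / e ^+ 2 <= ell -> 0 < S ->
  2 * Num.sqrt (ell / S) <= A -> x <= Num.sqrt (ell * S) ->
  forall y,
  ((M * expR (- ((1 + 8 * e) * ell / 2)) / 2)%:E <=
   \int[L]_w (g w * \1_[set w | (x <= `|y + Y w|)%R] w)%:E)%E.
Proof.
move=> e0 e2 D0 De he S0 hA hx y.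
have [mg mY g0 gM [m hm]] := LgY.
have M0 : 0 <= M by rewrite -lee_fin -gM; apply: integral_ge0 => w _; rewrite lee_fin.
have ell0 : 0 < ell by apply: lt_le_trans he; rewrite divr_gt0// exprn_gt0.
have e2ell : 8 <= e ^+ 2 * ell by rewrite mulrC -ler_pdivrMr ?exprn_gt0.
pose q := Num.sqrt (ell / S); pose xS := Num.sqrt (ell * S).
have q0 : 0 <= q by exact: sqrtr_ge0.
have qS : q ^+ 2 * S = ell.
  by rewrite sqr_sqrtr ?mulfVK ?gt_eqF// divr_ge0// ltW.
have qx : q * xS = ell.
  rewrite /q /xS -sqrtrM; last by rewrite divr_ge0// ltW.
  have -> : ell / S * (ell * S) = ell ^+ 2 by field; rewrite gt_eqF.
  by rewrite sqrtr_sqr ger0_norm// ltW.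
(* The offset [y] is arbitrary, so the side of the deviation is chosen according to the sign of
   [y + m]: on that side the offset can only increase the absolute value. *)
have [s [s1 hs]] : exists s : R, (s = 1 \/ s = -1) /\ 0 <= s * (y + m).
  have [ym|/ltW ym] := leP 0 (y + m); first by exists 1; split; [left|rewrite mul1r].
  by exists (-1); split; [right|rewrite mulN1r oppr_ge0].
have ss : s ^+ 2 = 1 by case: s1 => ->; rewrite ?sqrrN expr1n.
have sn : `|s| = 1 by case: s1 => ->; rewrite ?normrN normr1.
pose Z w := s * (Y w - m).
have mZ : measurable_fun setT Z by apply: measurable_funM => //; exact: measurable_funB.
have mgf (t : R) : 0 <= t -> t <= 2 ->
    ((M * expR ((1 - D) * (t ^+ 2 * ell / 2)))%:E <=
       \int[L]_w (g w * expR (t * q * Z w))%:E)%E /\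
    (\int[L]_w (g w * expR (t * q * Z w))%:E <=
       (M * expR ((1 + D) * (t ^+ 2 * ell / 2)))%:E)%E.
  move=> t0 t2; have := hm (t * q * s).
  rewrite !normrM sn mulr1 (ger0_norm t0) (ger0_norm q0).
  have -> : (t * q * s) ^+ 2 * S = t ^+ 2 * ell by rewrite -qS !exprMn ss; ring.
  have -> : (\int[L]_w (g w * expR (t * q * s * (Y w - m)))%:E =
      \int[L]_w (g w * expR (t * q * Z w))%:E)%E.
    by apply: eq_integral => w _; rewrite /Z mulrA.
  by apply; apply: le_trans hA; rewrite ler_wpM2r.
have [l1 _] := mgf (1 + e) (ltac:(lra)) (ltac:(lra)).
have [_ u1] := mgf 1 (ltac:(lra)) (ltac:(lra)).
have [_ u2] := mgf (1 + 2 * e) (ltac:(lra)) (ltac:(lra)).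
have := @mgf_tail_split Z ((1 + e) * q) (1 * q) ((1 + 2 * e) * q) xS
  ((1 + 2 * e) * xS) _ _ _ mZ _ _ _ l1 u1 u2.
have -> : ((1 + e) * q - 1 * q) * xS = e * ell by rewrite -qx; ring.
have -> : ((1 + 2 * e) * q - (1 + e) * q) * ((1 + 2 * e) * xS) = e * (1 + 2 * e) * ell.
  by rewrite -qx; ring.
have -> : (1 + e) * q * ((1 + 2 * e) * xS) = (1 + e) * (1 + 2 * e) * ell by rewrite -qx; ring.
have E4 (u : R) : u <= - 2 -> expR u <= 1 / 4.
  move=> u2'; apply: (@le_trans _ _ (expR (- 2))); first by rewrite ler_expR.
  have -> : - 2 = - 1 - 1 :> R by ring.
  rewrite expRD expRN; have := expR_ge1Dx (1 : R).
  have e1 := expR_gt0 (1 : R) => h.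
  rewrite -invfM -div1r ler_pdivrMr ?mulr_gt0//; nra.
have E4' (u v w : R) : u + v <= w - 2 -> expR u * (M * expR v) <= M * expR w / 4.
  move=> uvw; have -> : expR u * (M * expR v) = M * (expR (u + v - w) * expR w).
    by rewrite -expRD subrK expRD; ring.
  rewrite -mulrA ler_wpM2l// mulrC ler_wpM2l ?expR_ge0// -div1r E4//; lra.
have D1 : D * (1 + e) ^+ 2 <= e ^+ 2 / 20 * (9 / 4).
  by apply: ler_pM => //; [exact: sqr_ge0|nra].
have D2 : D * (1 + 2 * e) ^+ 2 <= e ^+ 2 / 20 * 4.
  by apply: ler_pM => //; [exact: sqr_ge0|nra].
have e20 : 0 <= e ^+ 2 by exact: sqr_ge0.
have ee : e ^+ 2 <= e / 2 by nra.
have T1 : expR (e * ell) * (M * expR ((1 + D) * (1 ^+ 2 * ell / 2))) <=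
    M * expR ((1 - D) * ((1 + e) ^+ 2 * ell / 2)) / 4.
  apply: E4'.
  suff : (e + (1 + D) / 2 - (1 - D) * (1 + e) ^+ 2 / 2 + e ^+ 2 / 4) * ell <= 0 by nra.
  by rewrite mulr_le0_ge0 ?(ltW ell0)//; lra.
have T2 : expR (- (e * (1 + 2 * e) * ell)) *
      (M * expR ((1 + D) * ((1 + 2 * e) ^+ 2 * ell / 2))) <=
    M * expR ((1 - D) * ((1 + e) ^+ 2 * ell / 2)) / 4.
  apply: E4'.
  suff : (- (e * (1 + 2 * e)) + (1 + D) * (1 + 2 * e) ^+ 2 / 2
    - (1 - D) * (1 + e) ^+ 2 / 2 + e ^+ 2 / 4) * ell <= 0 by nra.
  by rewrite mulr_le0_ge0 ?(ltW ell0)//; lra.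
move=> hh.
have p1 : 0 <= (1 + e) * q by rewrite mulr_ge0//; lra.
have p2 : 1 * q <= (1 + e) * q by rewrite ler_wpM2r//; lra.
have p3 : (1 + e) * q <= (1 + 2 * e) * q by rewrite ler_wpM2r//; lra.
have {p1 p2 p3}hh := hh p1 p2 p3.
have mA (x' : R) (V : W -> R) : measurable_fun setT V -> measurable [set w | (x' <= V w)%R].
  by move=> mV; rewrite -[X in measurable X]setTI; exact: measurable_fun_ler.
have mI (A' : set W) : measurable A' -> measurable_fun setT (fun w => (g w * \1_A' w)%:E).
  by move=> mA'; apply/measurable_EFinP/measurable_funM => //; exact: measurable_indic.
have mabs : measurable_fun setT (fun w => `|y + Y w|).
  by apply: (measurableT_comp (@normr_measurable R setT)); exact: measurable_funD.
apply: (@le_trans _ _ (\int[L]_w (g w * \1_[set w | (xS <= Z w)%R] w)%:E)%E); last first.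
  apply: ge0_le_integral => //.
  - by move=> w _; rewrite lee_fin mulr_ge0.
  - by apply: mI; exact: mA.
  - by apply: mI; exact: mA.
  move=> w _; rewrite lee_fin ler_wpM2l// !indicE ler_nat.
  case: (boolP (w \in [set w | (xS <= Z w)%R])) => //; rewrite inE/= => hw.
  rewrite mem_set//=; apply: le_trans hx _; apply: le_trans hw _.
  apply: le_trans (_ : s * (y + Y w) <= _); first by move: hs; rewrite /Z; lra.
  by apply: le_trans (ler_norm _) _; rewrite normrM sn mul1r.
have ip : (0%E <= \int[L]_w (g w * \1_[set w | (xS <= Z w)%R] w)%:E)%E.
  by apply: integral_ge0 => w _; rewrite lee_fin mulr_ge0.
set I := (\int[L]_w _)%E in hh ip *.
set c := (1 + e) * (1 + 2 * e) * ell in hh.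
suff h2 : ((expR c)%:E * (M * expR (- ((1 + 8 * e) * ell / 2)) / 2)%:E <= (expR c)%:E * I)%E.
  by rewrite lee_pmul2l// ?lte_fin ?expR_gt0// in h2.
apply: le_trans hh; rewrite -EFinM lee_fin.
apply: (@le_trans _ _ (M * expR ((1 - D) * ((1 + e) ^+ 2 * ell / 2)) / 2)); last by lra.
rewrite mulrA ler_pM2r// mulrCA ler_wpM2l// -expRD ler_expR /c.
suff : ((1 + e) * (1 + 2 * e) - (1 + 8 * e) / 2 - (1 - D) * (1 + e) ^+ 2 / 2) * ell <= 0 by nra.
by rewrite mulr_le0_ge0 ?(ltW ell0)//; lra.
Qed.

End tail.

End near_gaussian.

(** * Tails of sums of many small independent increments *)

Section chain.
Context {R : realType} d0 (T : measurableType d0) (P : probability T R).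
Variables (n : nat) (E xi : nat -> T -> R) (x : R).
Hypotheses (mE : forall j, measurable_fun setT (E j))
  (mxi : forall j, measurable_fun setT (xi j)) (En : forall w, E n w = 0).

Let Q j (u : R) : \bar R := P [set t | (x <= `|u + E j t|)%R].

Hypothesis EQ : forall j, (j < n)%N -> forall v, Q j v = (\int[P]_t Q j.+1 (v + xi j t)%R)%E.

Variables (e ell A D B sig p : R) (K : nat -> set T) (m kap s2 : nat -> R).
Hypotheses (e0 : 0 < e) (e2 : e <= 1 / 2) (D0 : 0 <= D) (De : D <= e ^+ 2 / 20)
  (hell : 8 / e ^+ 2 <= ell) (sig0 : 0 < sig) (n0 : (0 < n)%N)
  (B0 : 0 <= B) (AB : A * B <= D / 4) (x0 : 0 <= x)
  (ellE : ell = x ^+ 2 / ((1 - e) * n%:R * sig))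
  (hA : 2 * x / ((1 - e) * n%:R * sig) <= A)
  (mK : forall j, measurable (K j)) (PK : forall j, P (K j) = (kap j)%:E)
  (kap0 : forall j, 0 < kap j) (kapp : forall j, 1 - kap j <= p)
  (KB : forall j w, K j w -> `|xi j w - m j| <= B)
  (K1 : forall j, (\int[P]_w ((\1_(K j) w : R) * (xi j w - m j))%:E = 0)%E)
  (K2 : forall j, (\int[P]_w ((\1_(K j) w : R) * (xi j w - m j) ^+ 2)%:E = (s2 j)%:E)%E)
  (s2sig : forall j, sig <= s2 j / kap j).

Let c0 := expR (- ((1 + 8 * e) * ell / 2)) / 2.

Let mQset j : measurable [set u : R * T | (x <= `|u.1 + E j u.2|)%R].
Proof.
rewrite -[X in measurable X]setTI; apply: (measurable_fun_ler _ _) => //.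
apply: (measurableT_comp (@normr_measurable R setT)).
by apply: measurable_funD => //; exact: measurableT_comp.
Qed.

Let mQ j : measurable_fun setT (Q j).
Proof.
have := @measurable_fun_xsection _ _ R T R P _ (mQset j).
rewrite (_ : _ \o _ = Q j)//.
apply/funext => u /=; congr (P _); apply/seteqP; split => t; rewrite /xsection/= inE//.
Qed.

Let Q0 j u : (0 <= Q j u)%E. Proof. exact: measure_ge0. Qed.

(* Downward induction on the number of steps left. [l] counts the steps already lost, i.e.
   those whose increment fell outside [K]: they are frozen in [y] and only cost [sig] of
   variance each, and by Markov's inequality fewer than [e n] of the [n] steps are lost. *)
Lemma chain_lower_bound j : (j <= n)%N ->
  forall (l : nat) d (W : measurableType d) (L : probability W R) (g Y : W -> R) (S M : R),
  near_gaussian A D S M L g Y -> (j%:R - l%:R) * sig <= S ->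
  forall y, ((c0 * M * (1 - (l%:R + (n - j)%:R * p) / (e * n%:R)))%:E <=
    \int[L]_w ((g w)%:E * Q j (y + Y w)))%E.
Proof.
have nR : 0 < n%:R :> R by rewrite ltr0n.
have p0 : 0 <= p.
  apply: le_trans (kapp 0); rewrite subr_ge0 -lee_fin -PK; exact: probability_le1.
have c0gt : 0 < c0 by rewrite /c0 divr_gt0// expR_gt0.
move=> jn; have [k jnk] : exists k, (n - j = k)%N by exists (n - j)%N.
elim: k j jnk jn => [|k IH] j jnk jn l d W L g Y S M LgY hS y.
  have jE : j = n by apply/eqP; rewrite eqn_leq jn -subn_eq0 jnk.
  rewrite {}jE in hS *; have [mg mY g0 gM _] := LgY.
  have M0 : 0 <= M by rewrite -lee_fin -gM; apply: integral_ge0 => w _; rewrite lee_fin.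
  rewrite subnn mul0r addr0.
  (* If at least [e * n] steps are lost, the claimed bound is not positive. Otherwise the kept steps
     carry a variance of at least [(1 - e) * n * sig], for which [ell], [x] and [A] are
     calibrated. *)
  have [le|le] := leP (e * n%:R) l%:R.
    apply: le_trans (_ : 0%E <= _)%E; last first.
      by apply: integral_ge0 => w _; rewrite mule_ge0// lee_fin.
    rewrite lee_fin mulr_ge0_le0 ?mulr_ge0 ?(ltW c0gt)// subr_le0.
    by rewrite ler_pdivlMr ?mul1r// mulr_gt0.
  have S0S : (1 - e) * n%:R * sig <= S by apply: le_trans hS; rewrite ler_pM2r//; nra.
  have e1 : 0 < 1 - e by have := e2; lra.
  have S0 : 0 < (1 - e) * n%:R * sig by rewrite mulr_gt0// mulr_gt0.
  have SS := lt_le_trans S0 S0S.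
  have xE : x ^+ 2 = ell * ((1 - e) * n%:R * sig) by rewrite ellE mulfVK ?gt_eqF.
  have ell0 : 0 <= ell by rewrite ellE divr_ge0 ?sqr_ge0// ltW.
  have h1 : x <= Num.sqrt (ell * S).
    rewrite -(ger0_norm x0) -sqrtr_sqr ler_sqrt ?mulr_ge0 ?(ltW SS)//.
    by rewrite xE ler_wpM2l.
  have h2 : 2 * Num.sqrt (ell / S) <= A.
    apply: le_trans hA; rewrite -mulrA ler_wpM2l//.
    rewrite -(ger0_norm (divr_ge0 x0 (ltW S0))) -sqrtr_sqr ler_sqrt ?sqr_ge0//.
    rewrite exprMn xE exprVn ler_pdivrMr//.
    rewrite (_ : _ * S = ell * (S / ((1 - e) * n%:R * sig))); last first.
      by field; rewrite !gt_eqF//=; lra.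
    by rewrite ler_peMr// ler_pdivlMr ?mul1r.
  have := near_gaussian_tail LgY e0 e2 D0 De hell SS h2 h1 y.
  move=> h; apply: le_trans (le_trans _ h) _.
    rewrite lee_fin -[leRHS]mulrA [in leRHS]mulrC -/c0.
    by rewrite ler_piMr ?mulr_ge0 ?(ltW c0gt)// gerBl divr_ge0// mulr_ge0// ltW.
  rewrite le_eqVlt; apply/orP; left; apply/eqP; apply: eq_integral => w _.
  rewrite EFinM; congr (_ * _)%E; rewrite /Q indicE.
  case: (boolP (w \in _)); rewrite ?(inE, notin_setE)/= => hw.
    rewrite [X in P X](_ : _ = setT) ?probability_setT//.
    by apply/seteqP; split => // t _ /=; rewrite En addr0.
  rewrite [X in P X](_ : _ = set0) ?measure0//.
  by apply/seteqP; split => // t /=; rewrite En addr0.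
have jn' : (j < n)%N by rewrite -subn_gt0 jnk.
have jnk' : (n - j.+1 = k)%N by rewrite subnS jnk.
have [mg mY g0 gM _] := LgY.
have M0 : 0 <= M by rewrite -lee_fin -gM; apply: integral_ge0 => w _; rewrite lee_fin.
have D1 : D <= 1 by have := e0; have := e2; have := De; nra.
have LP := near_gaussian_step LgY (mxi j) (mK j) (PK j) (kap0 j) (@KB j) (K1 j) (K2 j) D0 D1 B0 AB.
have hS1 : (j.+1%:R - l%:R) * sig <= S + s2 j / kap j.
  by rewrite -natr1; have := s2sig j; nra.
have IH1 := IH j.+1 jnk' jn' l _ _ _ _ _ _ _ LP hS1 y.
have hS2 : (j.+1%:R - l.+1%:R) * sig <= S by rewrite -!natr1 opprD addrACA subrr addr0.
have IH2 := fun y' => IH j.+1 jnk' jn' l.+1 _ _ _ _ _ _ _ LgY hS2 y'.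
have mg' : measurable_fun setT (EFin \o g) by exact/measurable_EFinP.
pose kk : T -> R := \1_(K j); pose kc : T -> R := \1_(~` K j).
have mkk : measurable_fun setT kk by exact: measurable_indic.
have mkc : measurable_fun setT kc by apply: measurable_indic; exact: measurableC.
have kk0 t : 0 <= kk t by rewrite /kk indicE.
have kc0 t : 0 <= kc t by rewrite /kc indicE.
have mQY : measurable_fun setT (fun u : W * T => Q j.+1 (y + Y u.1 + xi j u.2)).
  apply: (measurableT_comp (mQ j.+1)); apply: measurable_funD; last exact: measurableT_comp.
  by apply: measurable_funD => //; exact: measurableT_comp.
have mF h : measurable_fun setT (h : T -> R) ->
    measurable_fun setT (fun u : W * T => ((g u.1)%:E * ((h u.2)%:E * Q j.+1 (y + Y u.1 + xi j u.2)))%E).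
  move=> mh; apply: emeasurable_funM; first by apply/measurable_EFinP; exact: measurableT_comp.
  by apply: emeasurable_funM => //; apply/measurable_EFinP; exact: measurableT_comp.
have F0 h (u : W * T) : (forall t, 0 <= (h : T -> R) t) ->
    (0 <= (g u.1)%:E * ((h u.2)%:E * Q j.+1 (y + Y u.1 + xi j u.2)))%E.
  by move=> h0; rewrite !mule_ge0// lee_fin.
have mI h : measurable_fun setT (h : T -> R) -> (forall t, 0 <= h t) -> measurable_fun setT
    (fun w => \int[P]_t ((g w)%:E * ((h t)%:E * Q j.+1 (y + Y w + xi j t))))%E.
  move=> mh h0; apply: (@measurable_fun_fubini_tonelli_F _ _ _ _ _ P (fun u : W * T =>
      ((g u.1)%:E * ((h u.2)%:E * Q j.+1 (y + Y u.1 + xi j u.2)))%E)).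
  - exact: mF.
  - by move=> u; exact: F0.
(* The next increment is split according to [K j]. On [K j] it joins the near-Gaussian sum; off
   [K j] it is added to the offset and [l] increases by one. *)
have -> : (\int[L]_w ((g w)%:E * Q j (y + Y w)) =
    \int[L]_w (\int[P]_t ((g w)%:E * ((kk t)%:E * Q j.+1 (y + Y w + xi j t)))) +
    \int[L]_w (\int[P]_t ((g w)%:E * ((kc t)%:E * Q j.+1 (y + Y w + xi j t)))))%E.
  rewrite -ge0_integralD//; last 4 first.
  - by move=> w _; apply: integral_ge0 => t _; exact: (F0 kk (w, t)).
  - exact: mI.
  - by move=> w _; apply: integral_ge0 => t _; exact: (F0 kc (w, t)).
  - exact: mI.
  apply: eq_integral => w _; rewrite EQ//.
  have mQw : measurable_fun setT (fun t => Q j.+1 (y + Y w + xi j t)).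
    by apply: (measurableT_comp (mQ j.+1)); exact: measurable_funD.
  have mh h : measurable_fun setT (h : T -> R) ->
      measurable_fun setT (fun t => ((h t)%:E * Q j.+1 (y + Y w + xi j t))%E).
    by move=> mh; apply: emeasurable_funM => //; exact/measurable_EFinP.
  rewrite !ge0_integralZl_EFin//; last 4 first.
  - by move=> t _; rewrite mule_ge0// lee_fin.
  - exact: mh.
  - by move=> t _; rewrite mule_ge0// lee_fin.
  - exact: mh.
  rewrite -ge0_muleDr ?integral_ge0//; last 2 first.
  - by move=> t _; rewrite mule_ge0// lee_fin.
  - by move=> t _; rewrite mule_ge0// lee_fin.
  congr (_ * _)%E; rewrite -ge0_integralD//; last 4 first.
  - by move=> t _; rewrite mule_ge0// lee_fin.
  - exact: mh.
  - by move=> t _; rewrite mule_ge0// lee_fin.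
  - exact: mh.
  apply: eq_integral => t _; rewrite -ge0_muleDl ?lee_fin//.
  rewrite -EFinD (_ : kk t + kc t = 1) ?mul1e//.
  rewrite /kk /kc !indicE in_setC; case: (_ \in _); rewrite /= ?addr0 ?add0r//.
have -> : (\int[L]_w (\int[P]_t ((g w)%:E * ((kk t)%:E * Q j.+1 (y + Y w + xi j t)))) =
    \int[product_prob L P]_u ((g u.1 * kk u.2)%:E * Q j.+1 (y + (Y u.1 + xi j u.2))))%E.
  rewrite -(fubini_tonelli1 (fun u : W * T =>
      ((g u.1)%:E * ((kk u.2)%:E * Q j.+1 (y + Y u.1 + xi j u.2)))%E))//.
  - by apply: eq_integral => u _; rewrite addrA EFinM muleA.
  - exact: mF.
  - by move=> u; exact: F0.
have PKc : P (~` K j) = (1 - kap j)%:E.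
  by rewrite probability_setC// PK.
have kapp1 : kap j <= 1 by rewrite -lee_fin -PK; exact: probability_le1.
set c1 := (c0 * (M * kap j) * _) in IH1.
pose c2 := c0 * M * (1 - (l.+1%:R + (n - j.+1)%:R * p) / (e * n%:R)).
have I2 : ((c2 * (1 - kap j))%:E <=
    \int[L]_w (\int[P]_t ((g w)%:E * ((kc t)%:E * Q j.+1 (y + Y w + xi j t)))))%E.
  have [c20|/ltW c20] := leP c2 0.
    apply: le_trans (_ : 0%E <= _)%E.
      by rewrite lee_fin mulr_le0_ge0// subr_ge0.
    by apply: integral_ge0 => w _; apply: integral_ge0 => t _; exact: (F0 kc (w, t)).
  rewrite (fubini_tonelli (fun u : W * T =>
      ((g u.1)%:E * ((kc u.2)%:E * Q j.+1 (y + Y u.1 + xi j u.2)))%E))//; last 2 first.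
  - exact: mF.
  - by move=> u; exact: F0.
  rewrite EFinM -PKc -[X in (_ * P X)%E]setIT -integral_indic//; last exact: measurableC.
  rewrite -ge0_integralZl_EFin//; last exact/measurable_EFinP.
  apply: ge0_le_integral => //.
  - by move=> t _; rewrite mule_ge0// lee_fin.
  - by apply: emeasurable_funM => //; exact/measurable_EFinP.
  - apply: (@measurable_fun_fubini_tonelli_G _ _ _ _ _ L (fun u : W * T =>
      ((g u.1)%:E * ((kc u.2)%:E * Q j.+1 (y + Y u.1 + xi j u.2)))%E)).
      exact: mF.
    by move=> u; exact: F0.
  move=> t _ /=.
  have -> : (\int[L]_w ((g w)%:E * ((kc t)%:E * Q j.+1 (y + Y w + xi j t))) =
     (kc t)%:E * \int[L]_w ((g w)%:E * Q j.+1 (y + xi j t + Y w)))%E.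
    rewrite -ge0_integralZl_EFin//.
    - by apply: eq_integral => w _; rewrite muleCA addrAC.
    - by move=> w _; rewrite mule_ge0// lee_fin.
    - apply: emeasurable_funM => //; apply: (measurableT_comp (mQ j.+1)).
      exact: measurable_funD.
  by rewrite muleC lee_wpmul2l ?lee_fin//; exact: IH2.
apply: le_trans (leeD IH1 I2); rewrite -EFinD lee_fin /c1 /c2.
rewrite jnk jnk' -!natr1.
set N := e * n%:R; have N0 : 0 < N by rewrite mulr_gt0.
(* Averaging over the two cases adds the probability [1 - kap j] of a loss to the expected count of
   lost steps; as this is at most [p], the induction closes. *)
have -> : c0 * (M * kap j) * (1 - (l%:R + k%:R * p) / N) +
    c0 * M * (1 - (l%:R + 1 + k%:R * p) / N) * (1 - kap j) =
  c0 * M * (1 - (l%:R + k%:R * p + (1 - kap j)) / N) by field; rewrite gt_eqF.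
rewrite ler_wpM2l ?mulr_ge0 ?(ltW c0gt)// lerD2l lerN2 ler_pM2r ?invr_gt0//.
by have := kapp j; lra.
Qed.

(** When [p <= e / 2] the expected number of lost steps is at most half of the tolerated [e * n], so
    the Markov factor is at least [1 / 2]. *)
Lemma chain_lower_bound0 : p <= e / 2 ->
  ((c0 / 2)%:E <= P [set t | (x <= `|E 0 t|)%R])%E.
Proof.
move=> pe; have nR : 0 < n%:R :> R by rewrite ltr0n.
have h0 : (0%:R - 0%:R) * sig <= 0 :> R by rewrite subrr mul0r.
have := @chain_lower_bound 0 (leq0n _) 0 _ _ _ _ _ _ _ (near_gaussian0 A D P) h0 0.
have -> : (\int[P]_w ((cst 1 w)%:E * Q 0 (0 + cst 0 w)%R) = P [set t | (x <= `|E 0 t|)%R])%E.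
  rewrite /cst; under eq_integral do rewrite mul1e addr0.
  rewrite integral_cst// [X in (_ * X)%E](probability_setT P) mule1 /Q.
  by congr (P _); apply/seteqP; split => t /=; rewrite add0r.
apply: le_trans; rewrite lee_fin mulr1 subn0 add0r.
rewrite ler_wpM2l ?divr_ge0 ?expR_ge0//.
suff : n%:R * p / (e * n%:R) <= 1 / 2 by lra.
by rewrite ler_pdivrMr ?mulr_gt0//; nra.
Qed.

End chain.

Section independent_sum.
Context {R : realType} d (T : measurableType d) (P : probability T R) (X Y : T -> R).
Hypotheses (mX : measurable_fun setT X) (mY : measurable_fun setT Y).
Hypothesis XY : forall A B : set R, measurable A -> measurable B ->
  P (X @^-1` A `&` Y @^-1` B) = (P (X @^-1` A) * P (Y @^-1` B))%E.

(** The joint law agrees with the product of the marginals on rectangles, hence everywhere by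
    uniqueness of the product measure; the right-hand side is its integral over sections. *)
Lemma independent_joint (A : set (R * R)) : measurable A ->
  P [set t | A (X t, Y t)] = (\int[P]_t P [set t' | A (X t, Y t')])%E.
Proof.
move=> mA.
pose Xm : {mfun T >-> R} := HB.pack X (isMeasurableFun.Build _ _ _ _ X mX).
pose Ym : {mfun T >-> R} := HB.pack Y (isMeasurableFun.Build _ _ _ _ Y mY).
have mXY : measurable_fun setT (fun t => (X t, Y t)) by exact: measurable_fun_pair.
have h := @product_measure_unique _ _ _ _ _ (distribution P Xm) (distribution P Ym)
  (image_measure P mXY).
have {}h := h _ A mA.
transitivity (image_measure P mXY A); first by [].
rewrite -h; last first.
  by move=> B C mB mC; rewrite /image_measure/= /pushforward/= XY.
rewrite /product_measure1 /distribution ge0_integral_pushforward//; last first.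
  exact: (@measurable_fun_xsection _ _ _ _ _ (distribution P Ym) A mA).
rewrite preimage_setT.
apply: eq_integral => t _ /=; rewrite /pushforward; congr (P _).
by apply/seteqP; split => t' /=; rewrite /xsection/= inE.
Qed.

End independent_sum.

(** * Lower tail bound for a real-valued increment *)

Section chain_constants.
Context {R : realType}.
Variables (e b v u x : R) (n : nat).
Hypotheses (e0 : 0 < e) (e1 : e <= 1) (b0 : 0 < b) (v0 : 0 < v) (u0 : 0 < u)
  (n0 : (0 < n)%N) (hd : b * x / (u * v) <= (e / 40) ^+ 2 / 2560).

Let a := e / 40.
Let sig := (1 - 2 * (a / 2)) * (u / n%:R) * v.
Let ell := x ^+ 2 / ((1 - a) * n%:R * sig).
Let D := a ^+ 2 / 20.
Let A := D / (4 * (8 * b)).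

Lemma chain_scale_bounds : [/\ 0 < a, 0 < a / 2, a / 2 < 1 & a <= 1 / 2].
Proof. by have := e0; have := e1; rewrite /a; split; lra. Qed.

(** [a := e / 40] makes [(1 + 8 * a) / (1 - a) ^+ 2] at most [1 + e]. [D] is the largest error
    allowed by [near_gaussian_tail], and [A] the largest rate for increments bounded by [8 * b], so
    that [A = a ^+ 2 / (640 * b)]. The rate needed is [2 * x / ((1 - a) ^+ 2 * (u * v))], and
    [(1 - a) ^+ 2 >= 1 / 2] accounts for the 2560. *)
Lemma chain_constants : [/\ 0 < sig, x ^+ 2 / (u * v) <= ell,
  (1 + 8 * a) * ell / 2 <= (1 + e) * x ^+ 2 / (2 * (u * v)),
  A * (8 * b) <= D / 4 & 2 * x / ((1 - a) * n%:R * sig) <= A].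
Proof.
have a0 : 0 < a by rewrite divr_gt0.
have a1 : a <= 1 / 40 by have := e1; rewrite /a; lra.
have nR : 0 < n%:R :> R by rewrite ltr0n.
have uv0 : 0 < u * v by rewrite mulr_gt0.
have b1 : 0 < 1 - a by lra.
have sigE : (1 - a) * n%:R * sig = (1 - a) ^+ 2 * (u * v).
  by rewrite /sig; field; rewrite gt_eqF.
split.
- by rewrite /sig mulr_gt0// mulr_gt0 ?divr_gt0//; lra.
- rewrite /ell sigE ler_wpM2l ?sqr_ge0// lef_pV2 ?posrE ?mulr_gt0//.
  by rewrite ler_piMl ?(ltW uv0)//; nra.
- rewrite /ell sigE.
  have -> : (1 + 8 * a) * (x ^+ 2 / ((1 - a) ^+ 2 * (u * v))) / 2 =
    (1 + 8 * a) / (1 - a) ^+ 2 * (x ^+ 2 / (2 * (u * v))) by field; rewrite !gt_eqF.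
  rewrite -[leRHS]mulrA ler_wpM2r//; first by rewrite divr_ge0 ?sqr_ge0// mulr_ge0// ltW.
  rewrite ler_pdivrMr ?exprn_gt0// (_ : e = 40 * a); last by rewrite /a; field.
  have : 0 <= a ^+ 2 by exact: sqr_ge0.
  have : 0 <= a ^+ 3 by rewrite exprn_ge0// ltW.
  nra.
- by rewrite /A le_eqVlt; apply/orP; left; apply/eqP; field; rewrite gt_eqF.
rewrite sigE /A ler_pdivlMr ?mulr_gt0// mulrAC ler_pdivrMr ?mulr_gt0 ?exprn_gt0//.
have := hd; rewrite -/a ler_pdivrMr// => hd'.
have : 1 / 2 * (u * v) <= (1 - a) ^+ 2 * (u * v) by rewrite ler_pM2r//; nra.
rewrite /D; have : 0 <= a ^+ 2 by exact: sqr_ge0.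
nra.
Qed.

End chain_constants.

Section increments.
Context {R : realType} d (U : measurableType d).
Variables (Pi : {sigma_finite_measure set U -> \bar R}) (f : U -> R).
Hypotheses (mf : measurable_fun setT f)
  (fPi : (\int[Pi]_u (Num.min 1 (f u ^+ 2))%:E < +oo)%E).
Context d0 (T : measurableType d0) (P : probability T R).
Variable X : R -> R -> T -> R.
Hypotheses (mX : forall s t : R, 0 <= s -> s <= t -> measurable_fun setT (X s t))
  (XD : forall (s t v : R) w, 0 <= s -> s <= t -> t <= v -> X s v w = X s t w + X t v w)
  (Xindep : forall s t v : R, 0 <= s -> s < t -> t < v -> forall A B : set R,
     measurable A -> measurable B ->
     P (X s t @^-1` A `&` X t v @^-1` B) = (P (X s t @^-1` A) * P (X t v @^-1` B))%E)
  (Xsymm : forall s t : R, 0 <= s -> s <= t ->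
     symm_transform Pi f (2 * (t - s)) (product_prob P P) (fun w => X s t w.1 - X s t w.2)).

(** With [r] the length of a piece, the truncated second moment of the symmetrized piece is about
    [2 * r * v], whereas the loss in [kept_set] is of order [r ^+ 2]: a fine mesh makes it
    negligible. The mesh does not depend on the starting point [s]. *)
Lemma increment_kept_data (b v u eta : R) : 0 < b -> 0 < v -> 0 < u -> 0 < eta -> eta < 1 ->
  (v%:E <= \int[Pi]_(u in [set u | (`|f u| <= b)%R]) (f u ^+ 2)%:E)%E ->
  exists2 n : nat, (0 < n)%N & forall s : R, 0 <= s ->
    exists (K : set T) (m kap s2 : R),
    [/\ measurable K, P K = kap%:E, 0 < kap, 1 - kap <= eta &
    [/\ forall w, K w -> `|X s (s + u / n%:R) w - m| <= 8 * b,
      (\int[P]_w ((\1_K w : R) * (X s (s + u / n%:R) w - m))%:E = 0)%E,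
      (\int[P]_w ((\1_K w : R) * (X s (s + u / n%:R) w - m) ^+ 2)%:E = s2%:E)%E &
      (1 - 2 * eta) * (u / n%:R) * v <= s2 / kap]].
Proof.
move=> b0 v0 u0 e0 e1 hv.
have [C C0 hC] := symm_transform_tail mf fPi b0.
have u20 : 0 < 2 * u by rewrite mulr_gt0.
have sE n : 2 * u / n.+1%:R = 2 * (u / n.+1%:R - 0) by rewrite subr0 mulrA.
have un0 n : 0 < u / n.+1%:R by rewrite divr_gt0.
(* [ghat] depends on the span only, so the increment starting at 0 supplies the domination for all
   starting points. *)
have dom n a t : `|ghat Pi f (2 * u / n.+1%:R) a t| <= 2 * u / n.+1%:R * levy_exponent Pi f a.
  by rewrite sE; exact: (normr_ghat_le (Xsymm (lexx 0) (ltW (un0 n)))).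
have [N hN] := small_time_second_moment mf fPi u20 b0 v0 e0 e1 hv dom.
(* A symmetrized piece of length [r] has span parameter [2 * r], hence the 2; the added 1 gives the
   strict inequality asked by [symmetrization_center]. *)
pose C1 := 2 * (C + 1); have C10 : 0 < C1 by rewrite /C1; lra.
(* A length at which [4 * b ^+ 2 * (C1 * r) ^+ 2], the loss in [kept_set], is at most
   [2 * eta * r * v]; the 1 in the denominator only keeps it positive. *)
pose bd := eta * v / (8 * b ^+ 2 * C1 ^+ 2 + 1).
have bd0 : 0 < bd.
  rewrite /bd divr_gt0 ?mulr_gt0// ltr_wpDl//.
  by rewrite mulr_ge0 ?sqr_ge0// mulr_ge0// sqr_ge0.
have [n Nn [h1 h2]] : exists2 n, (N <= n)%N & C1 * (u / n.+1%:R) <= eta /\ u / n.+1%:R <= bd.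
  pose q := Num.max (C1 * u / eta) (u / bd).
  have [n hn] : exists n, q <= n.+1%:R /\ (N <= n)%N.
    exists (maxn N (Num.bound q)); split; last exact: leq_maxl.
    have [q0|/ltW q0] := leP 0 q; last exact: le_trans q0 _.
    apply/ltW/(lt_le_trans (archi_boundP q0)).
    by rewrite ler_nat; apply: leq_trans (leq_maxr N _) _.
  exists n; first by case: hn.
  case: hn; rewrite /q ge_max => /andP[q1 q2] _; split.
    by rewrite mulrA ler_pdivrMr// [leRHS]mulrC -ler_pdivrMr.
  by rewrite ler_pdivrMr// [leRHS]mulrC -ler_pdivrMr.
exists n.+1 => // s s0; set r := u / n.+1%:R in h1 h2 *.
have r0 : 0 < r by exact: un0.
have sr : s <= s + r by rewrite lerDl ltW.
have hs := Xsymm s0 sr; rewrite addrAC subrr add0r in hs.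
have r2 : 2 * u / n.+1%:R = 2 * r by rewrite sE subr0.
have rr : 0 < 2 * r by rewrite mulr_gt0.
have t1 := hC _ _ _ _ _ rr hs.
have t1' : C * (2 * r) < C1 * r by rewrite /C1; lra.
have [c hc] := symmetrization_center (mX s0 sr) t1 t1'.
have hm := hN n Nn _ _ (product_prob P P) (fun w => X s (s + r) w.1 - X s (s + r) w.2).
rewrite r2 in hm; have {}hm := hm hs.
have p0 : 0 <= C1 * r by rewrite mulr_ge0// ltW.
have p1 : C1 * r < 1 by exact: le_lt_trans h1 e1.
have [K [m [mK PK KB K1 K2]]] := kept_set (mX s0 sr) b0 p0 p1 hc hm.
pose kap := fine (P K).
have kapE : P K = kap%:E by rewrite /kap fineK// fin_num_measure.
have kap1 : kap <= 1 by rewrite -lee_fin -kapE; exact: probability_le1.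
have kapp : 1 - kap <= C1 * r.
  by move: PK; rewrite probability_setC// kapE -EFinB lee_fin.
have kap0 : 0 < kap by lra.
have mk : measurable_fun setT (\1_K : T -> R) by exact: measurable_indic.
have ms : measurable_fun setT (fun w => X s (s + r) w - m).
  by apply: measurable_funB => //; exact: mX.
pose s2 := fine (\int[P]_w ((\1_K w : R) * (X s (s + r) w - m) ^+ 2)%:E)%E.
have s2E : (\int[P]_w ((\1_K w : R) * (X s (s + r) w - m) ^+ 2)%:E = s2%:E)%E.
  rewrite /s2 fineK//; apply: integrable_fin_num => //.
  apply: (@integrable_bounded _ _ _ P (fun w => (\1_K w : R) * (X s (s + r) w - m) ^+ 2) ((8 * b) ^+ 2)).
    by apply: measurable_funM => //; exact: measurable_funX.
  move=> w; rewrite indicE; case: (boolP (w \in K)); rewrite ?(inE,notin_setE) => hw.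
    rewrite mul1r normrX ler_sqr ?nnegrE//; first exact: KB.
    by rewrite mulr_ge0// ltW.
  by rewrite mul0r normr0 sqr_ge0.
exists K, m, kap, s2; split => //; first by lra.
split => //.
have s2ge : (1 - 2 * eta) * r * v <= s2.
  rewrite s2E lee_fin in K2; apply: le_trans K2.
  have : 4 * b ^+ 2 * (C1 * r) ^+ 2 <= 2 * (eta * r * v).
    have -> : 4 * b ^+ 2 * (C1 * r) ^+ 2 = r * (4 * b ^+ 2 * C1 ^+ 2 * r) by ring.
    have -> : 2 * (eta * r * v) = r * (2 * (eta * v)) by ring.
    rewrite ler_pM2l//.
    have bb : 0 <= b ^+ 2 * C1 ^+ 2 by rewrite mulr_ge0 ?sqr_ge0.
    move: h2; rewrite /bd ler_pdivlMr; last by nra.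
    have : 0 <= r by exact: ltW.
    nra.
  nra.
apply: le_trans s2ge _; rewrite ler_pdivlMr//.
rewrite s2E lee_fin in K2.
have s20 : 0 <= s2.
  by rewrite -lee_fin -s2E; apply: integral_ge0 => w _; rewrite lee_fin mulr_ge0 ?sqr_ge0.
by rewrite ler_piMr.
Qed.

(** The number of pieces, furnished by [increment_kept_data], is absent from the conclusion: the
    variances of the pieces add up to about [u * v], and only the two ratios in the hypotheses
    matter. *)
Lemma increment_lower_bound (e b v s u x : R) : 0 < e -> e <= 1 ->
  0 < b -> 0 < v -> 0 <= s -> 0 < u -> 0 <= x ->
  (v%:E <= \int[Pi]_(u in [set u | (`|f u| <= b)%R]) (f u ^+ 2)%:E)%E ->
  8 / (e / 40) ^+ 2 <= x ^+ 2 / (u * v) -> b * x / (u * v) <= (e / 40) ^+ 2 / 2560 ->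
  ((expR (- ((1 + e) * x ^+ 2 / (2 * (u * v)))) / 4)%:E <=
   P [set t | (x <= `|X s (s + u)%R t|)%R])%E.
Proof.
move=> e0 e1 b0 v0 s0 u0 x0 hv hK hd.
have uv0 : 0 < u * v by rewrite mulr_gt0.
have [] := chain_scale_bounds e0 e1.
set a := e / 40 in hK * => a0 a20 a21 a12.
have [n n0 hn] := increment_kept_data b0 v0 u0 a20 a21 hv.
have nR : 0 < n%:R :> R by rewrite ltr0n.
pose r := u / n%:R; have r0 : 0 < r by rewrite divr_gt0.
have := @chain_constants _ e b v u x n e0 e1 b0 v0 u0 n0 hd.
rewrite -/a -/r; set sig := _ * r * v; set ell := x ^+ 2 / (_ * sig); set D := a ^+ 2 / 20.
set A := D / _; move=> [sig0 q1 q2 AB hA].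
have D0 : 0 <= D by rewrite /D divr_ge0// sqr_ge0.
have b8 : 0 <= 8 * b by rewrite mulr_ge0// ltW.
pose sj (j : nat) := s + j%:R * r.
have sj0 j : 0 <= sj j by rewrite addr_ge0// mulr_ge0// ltW.
have sjS j : sj j.+1 = sj j + r by rewrite /sj -natr1; ring.
have sjn : sj n = s + u by rewrite /sj /r mulrC mulfVK// gt_eqF.
have sjlt j : (j < n)%N -> sj j < s + u.
  by move=> jn; rewrite -sjn ltrD2l ltr_pM2r// ltr_nat.
pose xi j := X (sj j) (sj j + r).
(* The increment still to come after [j] pieces. It is 0 from [n] on, so that independence is
   invoked for nondegenerate intervals only. *)
pose E j : T -> R := if (j < n)%N then X (sj j) (s + u) else cst 0.
have mxi j : measurable_fun setT (xi j) by apply: mX => //; rewrite lerDl ltW.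
have mE j : measurable_fun setT (E j).
  by rewrite /E; case: ifPn => // jn; apply: mX => //; rewrite ltW// sjlt.
have En w : E n w = 0 by rewrite /E ltnn.
have EQ j : (j < n)%N -> forall y, P [set t | (x <= `|y + E j t|)%R] =
    (\int[P]_t P [set t' | (x <= `|y + xi j t + E j.+1 t'|)%R])%E.
  move=> jn y; have [jn'|jn'] := ltnP j.+1 n.
    have ED t : E j t = xi j t + E j.+1 t.
      rewrite /E jn jn' /xi sjS; apply: XD => //; first by rewrite lerDl ltW.
      by rewrite -sjS ltW// sjlt.
    have -> : [set t | x <= `|y + E j t|] =
        [set t | [set q : R * R | x <= `|y + q.1 + q.2|] (xi j t, E j.+1 t)].
      by apply/seteqP; split => t /=; rewrite ED addrA.
    rewrite independent_joint//.
    - move=> A1 A2 mA1 mA2; rewrite /E jn' /xi sjS; apply: Xindep => //.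
      + by rewrite ltrDl.
      + by rewrite -sjS sjlt.
    - rewrite -[X in measurable X]setTI; apply: (measurable_fun_ler _ _) => //.
      apply: (measurableT_comp (@normr_measurable R setT)).
      by apply: measurable_funD => //; apply: measurable_funD.
  (* Last piece: nothing comes after it, and the inner probability is the indicator of the event
     itself. *)
  have jE : j.+1 = n by apply/eqP; rewrite eqn_leq jn jn'.
  have EE t : E j t = xi j t by rewrite /E jn /xi -sjS jE sjn.
  have mA : measurable [set t | x <= `|y + E j t|].
    rewrite -[X in measurable X]setTI; apply: (measurable_fun_ler _ _) => //.
    by apply: (measurableT_comp (@normr_measurable R setT)); exact: measurable_funD.
  rewrite -[LHS](_ : (\int[P]_t (\1_[set t | x <= `|y + E j t|] t)%:E = _)%E); last first.
    by rewrite integral_indic// setIT.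
  apply: eq_integral => t _; rewrite indicE.
  case: (boolP (t \in _)); rewrite ?(inE, notin_setE)/= => ht.
    rewrite [X in P X](_ : _ = setT) ?probability_setT//.
    by apply/seteqP; split => // t' _ /=; rewrite jE En addr0 -EE.
  rewrite [X in P X](_ : _ = set0) ?measure0//.
  by apply/seteqP; split => // t' /=; rewrite jE En addr0 -EE.
pose Pr j (F : set T * R * R * R) :=
    [/\ measurable F.1.1.1, P F.1.1.1 = F.1.2%:E, 0 < F.1.2, 1 - F.1.2 <= a / 2 &
    [/\ forall w, F.1.1.1 w -> `|xi j w - F.1.1.2| <= 8 * b,
      (\int[P]_w ((\1_(F.1.1.1) w : R) * (xi j w - F.1.1.2))%:E = 0)%E,
      (\int[P]_w ((\1_(F.1.1.1) w : R) * (xi j w - F.1.1.2) ^+ 2)%:E = F.2%:E)%E &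
      (1 - 2 * (a / 2)) * r * v <= F.2 / F.1.2]].
have hP j : exists F, Pr j F.
  have [K [m [kap [s2 h]]]] := hn (sj j) (sj0 j).
  by exists (K, m, kap, s2).
have [F hF] := choice hP.
have ellge := le_trans hK q1.
have pa : a / 2 <= a / 2 by [].
have D1 : D <= a ^+ 2 / 20 by [].
have h := @chain_lower_bound0 _ _ _ P n E xi x mE mxi En EQ a ell A D (8 * b) sig (a / 2)
  (fun j => (F j).1.1.1) (fun j => (F j).1.1.2) (fun j => (F j).1.2) (fun j => (F j).2)
  a0 a12 D0 D1 ellge sig0 n0 b8 AB x0 erefl hA.
have {}h := h (fun j => let: And5 H _ _ _ _ := hF j in H)
  (fun j => let: And5 _ H _ _ _ := hF j in H)
  (fun j => let: And5 _ _ H _ _ := hF j in H)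
  (fun j => let: And5 _ _ _ H _ := hF j in H)
  (fun j => let: And5 _ _ _ _ (And4 H _ _ _) := hF j in H)
  (fun j => let: And5 _ _ _ _ (And4 _ H _ _) := hF j in H)
  (fun j => let: And5 _ _ _ _ (And4 _ _ H _) := hF j in H)
  (fun j => let: And5 _ _ _ _ (And4 _ _ _ H) := hF j in H) pa.
have E0 : E 0%N = X s (s + u) by rewrite /E n0 /sj mul0r addr0.
rewrite -E0; apply: le_trans h; rewrite lee_fin.
rewrite -[leRHS]mulrA (_ : 2^-1 * 2^-1 = 4^-1 :> R); last by field.
by rewrite ler_wpM2r ?invr_ge0// ler_expR lerN2.
Qed.

End increments.

(** * One-dimensional projections of Levy processes *)

Section tuple_dot.
Context {R : realType} {d : nat}.
Implicit Types x y z : d.-tuple R.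

Lemma tdotC x y : tdot x y = tdot y x.
Proof. by apply: eq_bigr => i _; rewrite mulrC. Qed.

Lemma tdot_ge0 x : 0 <= tdot x x.
Proof. by apply: sumr_ge0 => i _; rewrite -expr2 sqr_ge0. Qed.

Lemma sqr_tnorm x : tnorm x ^+ 2 = tdot x x.
Proof. by rewrite sqr_sqrtr// tdot_ge0. Qed.

Lemma tdot_sub x y z : tdot z (tsub x y) = tdot z x - tdot z y.
Proof. by rewrite -sumrB; apply: eq_bigr => i _; rewrite tnth_mktuple mulrBr. Qed.

Lemma tdot0r z : tdot z (tzero R d) = 0.
Proof. by apply: big1 => i _; rewrite tnth_mktuple mulr0. Qed.

Lemma tdot_scale (a : R) z y : tdot [tuple a * tnth z i | i < d] y = a * tdot z y.
Proof. by rewrite mulr_sumr; apply: eq_bigr => i _; rewrite tnth_mktuple mulrA. Qed.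

Lemma tnorm_eq0 x : tnorm x = 0 -> x = tzero R d.
Proof.
move=> x0; have : tdot x x = 0 by rewrite -sqr_tnorm x0 expr0n.
move/eqP; rewrite psumr_eq0; last by move=> i _; rewrite -expr2 sqr_ge0.
move=> /allP h; apply: eq_from_tnth => i; rewrite tnth_mktuple.
have := h i; rewrite mem_index_enum => /(_ isT)/implyP/(_ isT).
by rewrite mulf_eq0 orbb => /eqP.
Qed.

Lemma sqr_tdot_le z y : tdot z y ^+ 2 <= tdot z z * tdot y y.
Proof.
set a := tdot z z; set b := tdot z y; set c := tdot y y.
have sq (s t : R) : 0 <= s ^+ 2 * a - 2 * (s * t) * b + t ^+ 2 * c.
  rewrite (_ : _ + _ = \sum_(i < d) (s * tnth z i - t * tnth y i) ^+ 2).
    by apply: sumr_ge0 => i _; rewrite sqr_ge0.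
  rewrite /a /b /c /tdot !mulr_sumr -sumrB -big_split/=.
  by apply: eq_bigr => i _; ring.
have c0 : 0 <= c by exact: tdot_ge0.
move: c0; rewrite le_eqVlt => /predU1P[c0|c0]; last by have := sq c b; nra.
have y0 : y = tzero R d.
  by apply: tnorm_eq0; rewrite /tnorm -/c -c0 sqrtr0.
by rewrite /b y0 tdot0r expr0n -c0 mulr0.
Qed.

Lemma normr_tdot_le z y : tnorm z <= 1 -> `|tdot z y| <= tnorm y.
Proof.
move=> z1; have z0 : 0 <= tnorm z by exact: sqrtr_ge0.
rewrite -ler_sqr ?nnegrE ?sqrtr_ge0// real_normK ?num_real//.
apply: le_trans (sqr_tdot_le z y) _; rewrite sqr_tnorm ler_piMl ?tdot_ge0//.
by rewrite -sqr_tnorm expr_le1.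
Qed.

Lemma measurable_tdot z : measurable_fun setT (tdot z).
Proof.
apply: measurable_sum => i; apply: measurable_funM => //.
exact: measurable_tnth.
Qed.

Lemma measurable_tnorm : measurable_fun setT (@tnorm R d).
Proof.
apply: measurableT_comp; first by apply: continuous_measurable_fun; exact: sqrt_continuous.
by apply: measurable_sum => i; apply: measurable_funM; exact: measurable_tnth.
Qed.

End tuple_dot.

Section levy_measure_theory.
Context {R : realType} {d : nat} (Pi : {measure set (d.-tuple R) -> \bar R}).
Hypothesis PiL : levy_measure Pi.

Let mmin : measurable_fun setT (fun y : d.-tuple R => Num.min 1 (tnorm y ^+ 2)).
Proof.
apply: measurable_minr => //; apply: measurable_funX; exact: measurable_tnorm.
Qed.

(** Away from the origin the sets where [Num.min 1 (tnorm y ^+ 2)] is at least [n.+1%:R^-1] have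
    finite mass by Markov's inequality; the origin, which none of them contains, has mass 0.
    Sigma-finiteness is what the Fubini arguments on [Pi] require. *)
Lemma levy_measure_sigma_finite : sigma_finite setT Pi.
Proof.
have [P0 P1] := PiL.
pose F n := [set y : d.-tuple R | tnorm y = 0 \/ n.+1%:R^-1 <= Num.min 1 (tnorm y ^+ 2)].
exists F.
  apply/seteqP; split => // y _; have [y0|y0] := eqVneq (tnorm y) 0; first by exists 0%N => //; left.
  have y1 : 0 < Num.min 1 (tnorm y ^+ 2) by rewrite lt_min ltr01 exprn_even_gt0.
  have [n _ hn] := near_infty_natSinv_lt (PosNum y1).
  by exists n => //; right; apply/ltW/hn => /=.
move=> n.
have mA : measurable [set y : d.-tuple R | n.+1%:R^-1 <= Num.min 1 (tnorm y ^+ 2)].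
  by rewrite -[X in measurable X]setTI; exact: measurable_fun_ler.
have mB : measurable [set tzero R d].
  rewrite (_ : [set _] = @tnorm R d @^-1` [set 0]).
    by rewrite -[X in measurable X]setTI; exact: measurable_tnorm.
  apply/seteqP; split => y /=; last exact: tnorm_eq0.
  by move=> ->; rewrite /tnorm tdot0r sqrtr0.
have FE : F n = [set tzero R d] `|` [set y | n.+1%:R^-1 <= Num.min 1 (tnorm y ^+ 2)].
  apply/seteqP; split => y [h|h]; [left|by right|left|by right].
    exact: tnorm_eq0.
  by rewrite h /tnorm tdot0r sqrtr0.
split; first by rewrite FE; exact: measurableU.
rewrite FE (le_lt_trans (measureU2 _ _ _))//= P0 add0e.
have n0 : 0 < n.+1%:R^-1 :> R by rewrite invr_gt0.
have mE : measurable_fun setT (fun y : d.-tuple R => (Num.min 1 (tnorm y ^+ 2))%:E).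
  exact/measurable_EFinP.
have h := le_integral_abse Pi measurableT mE n0; rewrite setTI in h.
rewrite ltey; apply/eqP => AE; move: h.
rewrite (_ : [set _ | _] = [set y | n.+1%:R^-1 <= Num.min 1 (tnorm y ^+ 2)]); last first.
  apply/seteqP; split => y /=; rewrite lee_fin ger0_norm// le_min ler01 sqr_ge0//.
rewrite AE gt0_muley ?lte_fin// leye_eq => /eqP E.
move: P1; suff -> : (\int[Pi]_y (Num.min 1 (tnorm y ^+ 2))%:E = +oo)%E by rewrite ltxx.
rewrite -E; apply: eq_integral => y _ /=.
by rewrite ger0_norm// le_min ler01 sqr_ge0.
Qed.

Lemma levy_measure_tdot (z : d.-tuple R) : tnorm z <= 1 ->
  (\int[Pi]_y (Num.min 1 (tdot z y ^+ 2))%:E < +oo)%E.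
Proof.
move=> z1; apply: le_lt_trans (proj2 PiL); apply: ge0_le_integral => //.
- by move=> y _; rewrite lee_fin le_min ler01 sqr_ge0.
- apply/measurable_EFinP; apply: measurable_minr => //; apply: measurable_funX.
  exact: measurable_tdot.
- exact/measurable_EFinP.
move=> y _; rewrite lee_fin le_min ge_min lexx/= ge_min; apply/orP; right.
by rewrite -[leLHS]real_normK ?num_real// ler_sqr ?nnegrE ?sqrtr_ge0// normr_tdot_le.
Qed.

End levy_measure_theory.

Section levy_process_projection.
Context {R : realType} (dT : measure_display) (T : measurableType dT) (P : probability T R).
Variables (d : nat) (X : R -> T -> d.-tuple R) (g : d.-tuple R).
Variable Pi : {measure set (d.-tuple R) -> \bar R}.
Hypotheses (PiL : levy_measure Pi) (XL : is_levy_process P X g 0 Pi).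
Variable z : d.-tuple R.
Hypothesis z1 : tnorm z <= 1.

(** The measure [Pi] itself, equipped with its sigma-finite structure. *)
Let Pis : {sigma_finite_measure set (d.-tuple R) -> \bar R} :=
  let sig := levy_measure_sigma_finite PiL in
  HB.pack_for {sigma_finite_measure set (d.-tuple R) -> \bar R} (Measure.sort Pi)
    (isSFinite.Build _ _ _ (Measure.sort Pi) (sfinite_measure_sigma_finite sig))
    (isSigmaFinite.Build _ _ _ (Measure.sort Pi) sig).

Definition projected_increment (s t : R) (w : T) : R := tdot z (tsub (X t w) (X s w)).

Lemma measurable_projected_increment (s t : R) : 0 <= s -> s <= t ->
  measurable_fun setT (projected_increment s t).
Proof.
move=> s0 st; have [mX _ _ _ _] := XL.
rewrite /projected_increment; under eq_fun do rewrite tdot_sub.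
apply: measurable_funB; apply: (measurableT_comp (measurable_tdot z)); apply: mX => //.
exact: le_trans st.
Qed.

Lemma projected_incrementD (s t v : R) w :
  projected_increment s v w = projected_increment s t w + projected_increment t v w.
Proof. by rewrite /projected_increment !tdot_sub; ring. Qed.

Lemma LK_re_levy_exponent (a : R) :
  LK_re 0 Pi [tuple a * tnth z i | i < d] = - levy_exponent Pis (tdot z) a.
Proof.
rewrite /LK_re /qform big1 ?oppr0 ?mul0r ?add0r; last first.
  by move=> i _; rewrite big1// => j _; rewrite mxE mulr0 mul0r.
rewrite /levy_exponent /Rintegral -fineN; congr fine.
rewrite -integral_ge0N; last by move=> y _; rewrite lee_fin subr_ge0 cos_le1.
by apply: eq_integral => y _; rewrite tdot_scale -EFinN opprB.
Qed.

(** The expectation of [cos (a * (Y - Y'))] for independent copies is the sum of the squares of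
    those of [cos (a * Y)] and [sin (a * Y)], that is, the squared modulus of the characteristic
    function. The phase, which carries the drift and the compensator, disappears. *)
Lemma projected_increment_symm (s t : R) : 0 <= s -> s <= t ->
  symm_transform Pis (tdot z) (2 * (t - s)) (product_prob P P)
    (fun w => projected_increment s t w.1 - projected_increment s t w.2).
Proof.
move=> s0 st; set Y := projected_increment s t.
have mY : measurable_fun setT Y by exact: measurable_projected_increment.
split; first by apply: measurable_funB; exact: measurableT_comp.
move=> a; have [_ _ _ /(_ s t [tuple a * tnth z i | i < d] s0 st) [hc hs] _] := XL.
pose C w := cos (a * Y w); pose S w := sin (a * Y w).
have maY : measurable_fun setT (fun w => a * Y w) by exact: measurable_funM.
have mC : measurable_fun setT C by exact: (measurableT_comp (@measurable_cos R)).
have mS : measurable_fun setT S by exact: (measurableT_comp (@measurable_sin R)).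
have C1 w : `|C w| <= 1 by rewrite ler_norml cos_geN1 cos_le1.
have S1 w : `|S w| <= 1 by rewrite ler_norml sin_geN1 sin_le1.
have {hc} hC : (\int[P]_w (C w)%:E = (expR ((t - s) * LK_re 0 Pi [tuple a * tnth z i | i < d]) *
    cos ((t - s) * LK_im g Pi [tuple a * tnth z i | i < d]))%:E)%E.
  by rewrite -hc; apply: eq_integral => w _; rewrite tdot_scale.
have {hs} hS : (\int[P]_w (S w)%:E = (expR ((t - s) * LK_re 0 Pi [tuple a * tnth z i | i < d]) *
    sin ((t - s) * LK_im g Pi [tuple a * tnth z i | i < d]))%:E)%E.
  by rewrite -hs; apply: eq_integral => w _; rewrite tdot_scale.
set ec := expR _ * _ in hC; set es := expR _ * _ in hS.
pose F (u : T * T) := C u.1 * C u.2 + S u.1 * S u.2.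
have FE u : cos (a * (Y u.1 - Y u.2)) = F u by rewrite mulrBr cosB.
under eq_integral do rewrite FE.
have iF : (product_prob P P).-integrable setT (EFin \o F).
  apply: (@integrable_bounded _ _ _ _ _ (1 + 1)).
    by apply: measurable_funD; apply: measurable_funM; exact: measurableT_comp.
  by move=> u; apply: le_trans (ler_normD _ _) _; rewrite lerD// normrM mulr_ile1.
have iC : P.-integrable setT (EFin \o C) by exact: integrable_bounded mC C1.
have iS : P.-integrable setT (EFin \o S) by exact: integrable_bounded mS S1.
rewrite -(@integral12_prod_meas1 _ _ _ _ _ P P (EFin \o F))//.
have E1 w : fubini_F P (EFin \o F) w = (C w * ec + S w * es)%:E.
  rewrite /fubini_F/= /F.
  have iZ (c : R) (h : T -> R) : P.-integrable setT (EFin \o h) ->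
      P.-integrable setT (EFin \o (fun w => c * h w)).
    by move=> ih; have := integrableZl measurableT c ih.
  have := integralD_EFin measurableT (iZ (C w) _ iC) (iZ (S w) _ iS); rewrite /= => ->.
  have := integralZl measurableT iC (C w); rewrite /= => ->.
  have := integralZl measurableT iS (S w); rewrite /= => ->.
  by rewrite hC hS.
under eq_integral do rewrite E1.
have iZ (c : R) (h : T -> R) : P.-integrable setT (EFin \o h) ->
    P.-integrable setT (EFin \o (fun w => h w * c)).
  by move=> ih; have := integrableZr measurableT c ih.
have := integralD_EFin measurableT (iZ ec _ iC) (iZ es _ iS); rewrite /= => ->.
have := integralZr measurableT iC ec; rewrite /= => ->.
have := integralZr measurableT iS es; rewrite /= => ->.
rewrite hC hS -!EFinM -EFinD; congr EFin; rewrite /ec /es LK_re_levy_exponent.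
set c := cos _; set v := sin _; set l := levy_exponent _ _ _.
have cv : c ^+ 2 + v ^+ 2 = 1 by exact: cos2Dsin2.
rewrite [LHS](_ : _ = expR ((t - s) * - l) ^+ 2 * (c ^+ 2 + v ^+ 2)); last by ring.
by rewrite cv mulr1 -expRM_natl; congr expR; ring.
Qed.

Lemma projected_increment_indep (n : nat) (r : nat -> R) (A : nat -> set R) :
  0 <= r 0%N -> (forall k, (k < n)%N -> r k < r k.+1) -> (forall k, measurable (A k)) ->
  P (\bigcap_(k in [set k | (k < n)%N]) projected_increment (r k) (r k.+1) @^-1` A k) =
  (\prod_(k < n) P (projected_increment (r k) (r k.+1) @^-1` A k))%E.
Proof.
move=> r0 rS mA; have [_ _ ind _ _] := XL.
have := ind n r r0 rS (fun k => tdot z @^-1` A k) _.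
move=> <-; last first.
  by move=> k; rewrite -[X in measurable X]setTI; exact: measurable_tdot.
congr (P _); apply/seteqP; split => w h; first by move=> k _; exact: (h k (ltn_ord k)).
by move=> k kn; exact: (h (Ordinal kn)).
Qed.

(** Since [tnorm z <= 1], the ball of radius [b] lies in the strip where the absolute value of
    [tdot z y] is at most [b]. The integral over the ball, as in the definition of [Vfun], thus
    bounds from below the truncated variance of the projection. *)
Lemma projected_increment_lower_bound (e b v s t x : R) : 0 < e -> e <= 1 ->
  0 < b -> 0 < v -> 0 <= s -> s < t -> 0 <= x ->
  (v%:E <= \int[Pi]_(y in [set y | (tnorm y <= b)%R]) (tdot y z ^+ 2)%:E)%E ->
  8 / (e / 40) ^+ 2 <= x ^+ 2 / ((t - s) * v) ->
  b * x / ((t - s) * v) <= (e / 40) ^+ 2 / 2560 ->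
  ((expR (- ((1 + e) * x ^+ 2 / (2 * ((t - s) * v)))) / 4)%:E <=
   P [set w | (x <= `|projected_increment s t w|)%R])%E.
Proof.
move=> e0 e1 b0 v0 s0 st x0 hv h1 h2.
have tE : s + (t - s) = t by rewrite addrC subrK.
rewrite -[X in projected_increment s X]tE.
apply: (@increment_lower_bound _ _ _ Pis _ (measurable_tdot z) (levy_measure_tdot PiL z1)
  _ _ P projected_increment measurable_projected_increment _ _ projected_increment_symm
  e b v s (t - s) x) => //.
- by move=> *; exact: projected_incrementD.
- move=> s' t' v' s0' st' tv' A B mA mB.
  pose r k : R := if k is k'.+1 then (if k' is _.+1 then v' else t') else s'.
  pose AB k := if k is 0%N then A else B.
  have := @projected_increment_indep 2 r AB s0'; rewrite /r/=.
  rewrite big_ord_recl big_ord1/= => <-; last 2 first.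
  + by case=> [|[|]].
  + by case.
  congr (P _); apply/seteqP; split => w.
    by move=> [hA hB] [|[|]].
  by move=> h; split; [exact: (h 0%N)|exact: (h 1%N)].
- by rewrite subr_gt0.
apply: le_trans hv _.
have mI (D : set (d.-tuple R)) : measurable_fun D (fun y => (tdot z y ^+ 2)%:E).
  apply/measurable_EFinP/measurable_funX; apply: measurable_funTS; exact: measurable_tdot.
rewrite [leLHS](_ : _ = \int[Pi]_(y in [set y | (tnorm y <= b)%R]) (tdot z y ^+ 2)%:E)%E; last first.
  by apply: eq_integral => y _; rewrite tdotC.
apply: ge0_subset_integral => //.
- rewrite -[X in measurable X]setTI; apply: measurable_fun_ler => //; exact: measurable_tnorm.
- rewrite -[X in measurable X]setTI; apply: measurable_fun_ler => //.
  by apply: (measurableT_comp (@normr_measurable R setT)); exact: measurable_tdot.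
- by move=> y _; rewrite lee_fin sqr_ge0.
by move=> y; apply: le_trans; exact: normr_tdot_le.
Qed.

Lemma no_large_increment (N : nat) (r x : nat -> R) (p : R) :
  0 <= r 0%N -> (forall k, (k < N)%N -> r k < r k.+1) ->
  (forall k, (k < N)%N ->
    (p%:E <= P [set w | (x k <= `|projected_increment (r k) (r k.+1) w|)%R])%E) ->
  (P (\bigcap_(k in [set k | (k < N)%N])
      [set w | (`|projected_increment (r k) (r k.+1) w| < x k)%R]) <=
    (expR (- (N%:R * p)))%:E)%E.
Proof.
move=> r0 rS hp; pose A k := [set y : R | (`|y| < x k)%R].
have mA k : measurable (A k).
  by rewrite -[X in measurable X]setTI; apply: measurable_fun_ltr.
have -> := @projected_increment_indep N r A r0 rS mA.
have hk k : (k < N)%N -> (P (projected_increment (r k) (r k.+1) @^-1` A k) <= (1 - p)%:E)%E.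
  move=> kN; have r0k : 0 <= r k.
    by elim: k kN => // k IH kN; apply: (le_trans (IH (ltnW kN))); exact/ltW/rS/ltnW.
  have mY := measurable_projected_increment r0k (ltW (rS _ kN)).
  have mB : measurable [set w | (x k <= `|projected_increment (r k) (r k.+1) w|)%R].
    rewrite -[X in measurable X]setTI; apply: measurable_fun_ler => //.
    exact: (measurableT_comp (@normr_measurable R setT)).
  rewrite (_ : _ @^-1` _ = ~` [set w | (x k <= `|projected_increment (r k) (r k.+1) w|)%R]).
    by rewrite probability_setC// EFinB leeB// hp.
  by apply/seteqP; split => w /=; rewrite /A/= ltNge => /negP.
apply: (@le_trans _ _ (\prod_(k < N) (expR (- p))%:E)%E).
  suff : (0 <= \prod_(k < N) P (projected_increment (r k) (r k.+1) @^-1` A k) /\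
     \prod_(k < N) P (projected_increment (r k) (r k.+1) @^-1` A k) <=
     \prod_(k < N) (expR (- p))%:E)%E by case.
  apply: (big_ind2 (fun a b : \bar R => 0 <= a /\ a <= b)%E) => //.
  - by move=> a b a' b' [a0 ab] [a0' ab']; rewrite mule_ge0// lee_pmul.
  - move=> k _; split; first exact: measure_ge0.
    by apply: le_trans (hk k (ltn_ord k)) _; rewrite lee_fin expR_ge1Dx.
by rewrite -(big_morph EFin EFinM erefl) prodr_const card_ord -expRM_natl mulrN.
Qed.

End levy_process_projection.

(** * Geometric scales *)

Section regular_variation_window.
Context {R : realType}.

(** Monotonicity reduces the whole window to its right end [y * ftau tau y], where the defining
    limit of the class applies. *)
Lemma Hq_window (q : R) (h : R -> R) (tau eta : R) :
  Hq q h -> 0 <= tau -> tau < 1 - q -> 0 < eta ->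
  exists y0 : R, forall y y' : R, y0 <= y -> y <= y' -> y' <= y * ftau tau y ->
    0 < h y /\ h y' <= (1 + eta) * h y.
Proof.
move=> [[_ _ hmono [[A hA] _]] /(_ tau) hq] tau0 tauq eta0.
have /cvgrPdist_le/(_ _ eta0)[M [_ hM]] := hq tau0 tauq.
exists (Num.max (Num.max A 0) (M + 1)) => y y'.
rewrite !ge_max => /andP[/andP[Ay y0] My] yy' y'y.
have hy : 0 < h y by exact: hA.
split=> //; apply: (le_trans (hmono _ _ (le_trans y0 yy') y'y)).
have My' : M < y by lra.
have := hM y My'; rewrite distrC => /ler_normlW.
by rewrite lerBlDl ler_pdivrMr// addrC.
Qed.

(** Write [Lam] for [ln (1 / t)]. The class compares values of [h] from the left end [1 / s] of the
    window, while the scales are laid out from [t]. For [s] in the range, [ln (1 / s) >= Lam / 2],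
    so its power [tau] is at least half of that of [Lam] because [tau <= 1]; this explains the
    division by 2 in the range of [s]. *)
Lemma window_bounds (q : R) (h : R -> R) (tau eta delta : R) :
  Hq q h -> 0 <= tau -> tau < 1 - q -> 0 <= q -> 0 < eta -> 0 < delta ->
  exists2 L0 : R, 0 < L0 & forall t : R, 0 < t -> L0 <= ln (ln (1 / t)) ->
    forall s : R, t <= s -> s <= t * expR (expR (tau * ln (ln (1 / t))) / 2) ->
    [/\ 0 < h (1 / s), h (1 / t) <= (1 + eta) * h (1 / s),
        0 < ln (ln (1 / s)) /\ ln (ln (1 / s)) <= ln (ln (1 / t)) & s < delta].
Proof.
move=> hq tau0 tauq q0 eta0 delta0.
have [y0 hy0] := Hq_window hq tau0 tauq eta0.
exists (Num.max 2 (Num.max (2 * y0) (2 / delta))); first by rewrite lt_max ltr0n.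
move=> t t0; set Lam := ln (1 / t); set L := ln Lam.
rewrite !ge_max => /and3P[L2 Ly Ld] s ts sE.
have L0 : 0 < L by apply: lt_le_trans L2.
have Lam0 : 0 < Lam by rewrite ltNge; apply/negP => l; move: L0; rewrite /L ln0// ltxx.
have LE : expR L = Lam by rewrite lnK.
have LamL : 1 + L <= Lam by rewrite -LE expR_ge1Dx.
have tE : 1 / t = expR Lam by rewrite lnK// posrE divr_gt0.
have tauL : expR (tau * L) <= Lam by rewrite -LE ler_expR ler_piMl ?(ltW L0)//; lra.
have s0 : 0 < s by exact: lt_le_trans ts.
have sy : 0 < 1 / s by rewrite divr_gt0.
have lns : ln (1 / s) = - ln s by rewrite div1r lnV.
have lnt : Lam = - ln t by rewrite /Lam div1r lnV.
have slo : Lam - expR (tau * L) / 2 <= ln (1 / s).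
  move: sE; rewrite -ler_ln ?posrE ?mulr_gt0 ?expR_gt0// lnM ?posrE ?expR_gt0// expRK.
  by rewrite lns lnt -/L; lra.
have shi : ln (1 / s) <= Lam by rewrite lns lnt lerN2 ler_ln.
have shalf : Lam / 2 <= ln (1 / s) by lra.
have s1 : 1 < ln (1 / s) by lra.
have y0s : y0 <= 1 / s.
  rewrite -[leRHS]lnK//; apply: le_trans (expR_ge1Dx _); lra.
have yy : 1 / s <= 1 / t by rewrite !div1r lef_pV2.
have yft : 1 / t <= 1 / s * ftau tau (1 / s).
  rewrite tE -{1}[1 / s]lnK// -expRD ler_expR.
  suff : expR (tau * L) / 2 <= ln (1 / s) `^ tau by lra.
  apply: (@le_trans _ _ ((Lam / 2) `^ tau)); last first.
    by apply: ge0_ler_powR => //; rewrite nnegrE; lra.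
  have L20 : 0 < Lam / 2 by lra.
  rewrite /powR gt_eqF// lnM ?posrE// lnV ?posrE// mulrDr expRD -/L.
  rewrite ler_wpM2l ?expR_ge0// mulrN expRN lef_pV2 ?posrE ?expR_gt0//.
  have ln20 : 0 <= ln (2 : R) by rewrite ln_ge0// ler1n.
  have ln2E : expR (ln (2 : R)) = 2 by rewrite lnK// posrE.
  rewrite -[leRHS]ln2E ler_expR ler_piMl//; lra.
have [h1 h2] := hy0 _ _ y0s yy yft.
split => //; first by split; [exact: ln_gt0|rewrite ler_ln ?posrE//; lra].
have sE' : s = expR (- ln (1 / s)) by rewrite lns opprK lnK.
rewrite sE' expRN -[ltRHS]invrK ltf_pV2 ?posrE ?invr_gt0 ?expR_gt0//.
apply: lt_le_trans (expR_ge1Dx _).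
by move: Ld; rewrite ler_pdivrMr// -div1r ltr_pdivrMr//; nra.
Qed.

End regular_variation_window.

Section number_of_scales.
Context {R : realType}.

(** A count of order [expR (tau * L)] dominates both a linear function of [L] and
    [expR (theta * L)]. The first fact will make the jump bound negligible against the levels, the
    second makes the number of scales times the success probability as large as desired. *)
Lemma truncn_expR_ge (tau theta kappa B : R) : 0 < kappa -> 0 <= theta -> theta < tau ->
  exists L0 : R, forall L : R, L0 <= L ->
    B * L <= (Num.truncn (expR (tau * L) / kappa))%:R /\
    B <= (Num.truncn (expR (tau * L) / kappa))%:R * expR (- (theta * L)).
Proof.
move=> k0 th0 tht.
(* The added 1 pays for the integer truncation. *)
pose B1 := Num.max B 0 + 1.
have B11 : 1 <= B1 by rewrite /B1 lerDr le_max lexx orbT.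
have BB : B <= B1 - 1 by rewrite /B1 addrK le_max lexx.
have tau0 : 0 < tau by lra.
exists (Num.max 1 (Num.max (4 * kappa * B1 / tau ^+ 2) (kappa * B1 / (tau - theta)))) => L.
rewrite !ge_max => /and3P[L1].
rewrite ler_pdivrMr ?exprn_gt0// => h1; rewrite ler_pdivrMr ?subr_gt0// => h2.
set y := expR (tau * L) / kappa.
have y0 : 0 <= y by rewrite divr_ge0 ?expR_ge0// ltW.
have /andP[_] := truncn_itv y0; rewrite -natr1; set N := _%:R => hN.
have yE : expR (tau * L) = y * kappa by rewrite /y mulfVK// gt_eqF.
split.
  have : (1 + tau * L / 2) ^+ 2 <= expR (tau * L).
    rewrite (_ : expR (tau * L) = expR (tau * L / 2) ^+ 2).
      rewrite ler_sqr ?nnegrE ?expR_ge0 ?expR_ge1Dx// addr_ge0// divr_ge0// mulr_ge0//; lra.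
    by rewrite -expRM_natl; congr expR; field.
  rewrite yE => h3.
  have h4 : B1 * L <= y.
    rewrite -(ler_pM2r k0); apply: le_trans h3.
    have : 4 * kappa * B1 * L <= L * tau ^+ 2 * L by rewrite ler_wpM2r//; lra.
    have : 0 <= tau * L by rewrite mulr_ge0//; lra.
    rewrite (_ : (1 + tau * L / 2) ^+ 2 = 1 + tau * L + L * tau ^+ 2 * L / 4); last by field.
    by lra.
  have : B * L <= (B1 - 1) * L by rewrite ler_wpM2r//; lra.
  by nra.
have h3 : expR ((tau - theta) * L) = y * kappa * expR (- (theta * L)).
  by rewrite -yE -expRD; congr expR; ring.
have h4 := expR_ge1Dx ((tau - theta) * L).
have E0 : 0 < expR (- (theta * L)) by exact: expR_gt0.
have E1 : expR (- (theta * L)) <= 1 by rewrite -expR0 ler_expR oppr_le0 mulr_ge0//; lra.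
have h5 : B1 <= y * expR (- (theta * L)).
  by rewrite -(ler_pM2r k0); nra.
by nra.
Qed.

End number_of_scales.

Section geometric_scales.
Context {R : realType} (dT : measure_display) (T : measurableType dT) (P : probability T R).
Variables (d : nat) (X : R -> T -> d.-tuple R) (g : d.-tuple R).
Variable Pi : {measure set (d.-tuple R) -> \bar R}.
Hypotheses (PiL : levy_measure Pi) (XL : is_levy_process P X g 0 Pi).
Variables (eta tau a lv : R).
Hypotheses (eta0 : 0 < eta) (eta2 : eta <= 1 / 2) (a0 : 0 < a) (lv0 : 0 < lv).

(** [L] stands for [ln (ln (1 / t))], so that [expR (tau * L)] is the power [tau] of [ln (1 / t)].
    With [N] scales, the times reach [t] multiplied by the power [4 * N] of [eta^-1]; the divisor
    [8 * ln eta^-1] keeps this below [t * expR (expR (tau * L) / 2)], the end of the window in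
    [window_bounds]. *)
Definition scale_count (L : R) : nat := Num.truncn (expR (tau * L) / (8 * ln eta^-1)).

(* The shift of the exponent by [scale_count L] makes the jump bound [b(t)] negligible with
   respect to the levels, as required by [projected_increment_lower_bound]. *)
Definition scale_time (t L : R) (k : nat) : R := t * (eta^-1 ^+ (scale_count L + k)) ^+ 2.

(** [H] stands for [h (1 / t)]. One factor [1 + eta] absorbs the variation of [h] over the window,
    the other the position at the previous scale, whose own bound is [eta] times that of the current
    one. *)
Definition scale_level (t L H : R) (k : nat) : R :=
  a * (1 + eta) ^+ 2 * Num.sqrt (scale_time t L k.+1 * L) / H.

Definition no_success (z : d.-tuple R) (t L H : R) : set T :=
  \bigcap_(k in [set k | (k < scale_count L)%N])
    [set w | `|projected_increment X z (scale_time t L k) (scale_time t L k.+1) w|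
             < scale_level t L H k].

(* Each scale succeeds with probability at least [(ln (1 / t)) `^ (- scale_theta) / 4]. *)
Definition scale_theta : R := (1 + eta) * ((a * (1 + eta) ^+ 2) ^+ 2 / ((1 - eta ^+ 2) * lv)).

Let ei0 : 0 < eta^-1. Proof. by rewrite invr_gt0. Qed.

Let ei2 : 2 <= eta^-1.
Proof. by rewrite -(ler_pM2r eta0) mulVf ?gt_eqF//; have := eta2; lra. Qed.

Let lne : 0 < ln eta^-1.
Proof. by apply: ln_gt0; have := ei2; lra. Qed.

Lemma scale_time_gt0 (t L : R) k : 0 < t -> 0 < scale_time t L k.
Proof. by move=> t0; rewrite mulr_gt0// !exprn_gt0. Qed.

Lemma scale_timeS (t L : R) k : scale_time t L k = scale_time t L k.+1 * eta ^+ 2.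
Proof.
rewrite /scale_time addnS [X in _ = t * X ^+ 2 * _]exprS.
move: (eta^-1 ^+ _) => w.
by field; rewrite gt_eqF.
Qed.

Lemma scale_time_lt (t L : R) k : 0 < t -> scale_time t L k < scale_time t L k.+1.
Proof.
move=> t0; rewrite [ltLHS]scale_timeS gtr_pMr ?scale_time_gt0//.
by have := eta0; have := eta2; nra.
Qed.

Lemma scale_time_ge (t L : R) k : 0 < t -> t <= scale_time t L k.
Proof.
move=> t0; by rewrite (ler_peMr (ltW t0))//; do 2!apply: exprn_ege1; have := ei2; lra.
Qed.

Lemma scale_time_le (t L : R) k : 0 < t -> (k <= scale_count L)%N ->
  scale_time t L k <= t * expR (expR (tau * L) / 2).
Proof.
move=> t0 kN; rewrite ler_pM2l// -[eta^-1]lnK//.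
rewrite -!expRM_natl ler_expR.
have y0 : 0 <= expR (tau * L) / (8 * ln eta^-1).
  by rewrite divr_ge0 ?expR_ge0// mulr_ge0// ltW.
have /andP[+ _] := truncn_itv y0; rewrite -/(scale_count L) ler_pdivlMr ?mulr_gt0// => h.
have : (scale_count L + k)%:R <= 2 * (scale_count L)%:R :> R.
  by rewrite -natrM ler_nat mul2n -addnn leq_add2l.
by have := lne; nra.
Qed.

Lemma measurable_no_success (z : d.-tuple R) (t L H : R) : 0 < t ->
  measurable (no_success z t L H).
Proof.
move=> t0; apply: bigcap_measurableType => k _.
rewrite -[X in measurable X]setTI; apply: measurable_fun_ltr => //.
apply: (measurableT_comp (@normr_measurable R setT)).
apply: (measurable_projected_increment XL); first exact/ltW/scale_time_gt0.
exact/ltW/scale_time_lt.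
Qed.

(** In the ratio of squared level to variance both the scale and [H] cancel, leaving [L] times a
    constant; hence one threshold [L0] for all [t], [H] and [z]. In the other ratio the scale
    survives as a divisor of at least [2 ^+ scale_count L], which exceeds any multiple of [L]. *)
Lemma no_success_small (eps : R) : 0 < eps -> scale_theta < tau ->
  exists L0 : R, forall t L H : R, L0 <= L -> 0 < t -> 0 < H ->
    forall z : d.-tuple R, tnorm z <= 1 ->
    ((lv / (2 * H ^+ 2))%:E <=
      \int[Pi]_(y in [set y | (tnorm y <= Num.sqrt (t * L) / H)%R]) (tdot y z ^+ 2)%:E)%E ->
    (P (no_success z t L H) <= eps%:E)%E.
Proof.
move=> eps0 thtau.
have e1 : eta <= 1 by have := eta2; lra.
have e21 : 0 < 1 - eta ^+ 2 by have := eta0; have := eta2; nra.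
pose A := a * (1 + eta) ^+ 2; have A0 : 0 < A.
  by rewrite mulr_gt0// exprn_gt0//; have := eta0; lra.
pose G := A ^+ 2 / ((1 - eta ^+ 2) * lv).
have G0 : 0 < G by rewrite divr_gt0 ?exprn_gt0// mulr_gt0.
have thE : scale_theta = (1 + eta) * G by [].
have th0 : 0 <= scale_theta by rewrite thE mulr_ge0 ?ltW//; have := eta0; lra.
pose c := (eta / 40) ^+ 2 / 2560.
have c0 : 0 < c.
  apply: divr_gt0; last by rewrite ltr0n.
  by apply: exprn_gt0; apply: divr_gt0; rewrite ?ltr0n.
(* Chosen so that [B1 * L <= scale_count L] yields the condition on the jump bound. *)
pose B1 := 2 * A / ((1 - eta ^+ 2) * lv * c).
(* The second entry makes the count times the success probability at least [- ln eps]; the 4 is the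
   denominator in that probability. *)
pose B := Num.max B1 (- (4 * ln eps)).
have k0 : 0 < 8 * ln eta^-1 by rewrite mulr_gt0.
have [L0 hL0] := truncn_expR_ge B k0 th0 thtau.
exists (Num.max 1 (Num.max L0 (4 / (eta / 40) ^+ 2 / G))) => t L H.
rewrite !ge_max => /and3P[L1 LL0]; rewrite ler_pdivrMr// => LG t0 H0 z z1 hv.
have Lgt : 0 < L by lra.
have [] := hL0 L LL0; rewrite -/(scale_count L) => N1 N2.
have p_le k : (k < scale_count L)%N -> ((expR (- (scale_theta * L)) / 4)%:E <=
    P [set w | (scale_level t L H k <=
      `|projected_increment X z (scale_time t L k) (scale_time t L k.+1) w|)%R])%E.
  move=> kN; have rt := @scale_time_gt0 t L k.+1 t0.
  set r := scale_time t L k.+1 in rt *.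
  set v := lv / (2 * H ^+ 2) in hv.
  have v0 : 0 < v by rewrite divr_gt0// mulr_gt0// exprn_gt0.
  have rE : r - scale_time t L k = r * (1 - eta ^+ 2).
    by rewrite scale_timeS -/r; ring.
  have x2 : scale_level t L H k ^+ 2 = A ^+ 2 * (r * L) / H ^+ 2.
    rewrite /scale_level -/A -/r expr_div_n exprMn sqr_sqrtr//.
    by rewrite mulr_ge0// ltW.
  have xuv : scale_level t L H k ^+ 2 / ((r - scale_time t L k) * v) = 2 * G * L.
    by rewrite x2 rE /v /G; field; rewrite !gt_eqF.
  have st := @scale_time_lt t L k t0.
  have s0 := ltW (@scale_time_gt0 t L k t0).
  have x0 : 0 <= scale_level t L H k.
    by rewrite /scale_level -/A divr_ge0 ?(ltW H0)// mulr_ge0 ?(ltW A0)// sqrtr_ge0.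
  have b0 : 0 < Num.sqrt (t * L) / H by rewrite divr_gt0// sqrtr_gt0 mulr_gt0.
  have := projected_increment_lower_bound PiL XL z1 eta0 e1 b0 v0 s0 st x0 hv.
  rewrite -/r xuv => h.
  apply: le_trans (h _ _).
  - rewrite lee_fin ler_pM2r ?invr_gt0// ler_expR lerN2.
    rewrite (_ : _ / _ = (1 + eta) / 2 * (scale_level t L H k ^+ 2 / ((r - scale_time t L k) * v))).
      by rewrite xuv thE le_eqVlt; apply/orP; left; apply/eqP; field.
    by rewrite invfM; field; rewrite !gt_eqF// subr_gt0.
  - by move: LG; set i := _^-1; lra.
  pose W : R := eta^-1 ^+ (scale_count L + k.+1).
  have W0 : 0 < W by rewrite exprn_gt0.
  have WN : (scale_count L)%:R <= W.
    apply: (@le_trans _ _ (2 ^+ (scale_count L + k.+1))).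
      by rewrite -natrX ler_nat (leq_trans (leq_addr _ _) (ltnW (ltn_expl _ _))).
    by apply: lerXn2r; rewrite ?nnegrE ?(ltW ei0) ?ei2 ?ler0n.
  have sq : Num.sqrt (t * L) / H * scale_level t L H k = A * (t * W * L) / H ^+ 2.
    rewrite /scale_level -/A -/r /r /scale_time -/W.
    rewrite (_ : t * W ^+ 2 * L = W ^+ 2 * (t * L)); last by ring.
    rewrite [Num.sqrt (W ^+ 2 * _)]sqrtrM ?sqr_ge0// sqrtr_sqr gtr0_norm//.
    have sE : Num.sqrt (t * L) ^+ 2 = t * L by rewrite sqr_sqrtr// mulr_ge0// ltW.
    rewrite [RHS](_ : _ = A * W * (t * L) / H ^+ 2); last by ring.
    move: (Num.sqrt (t * L)) sE => y <-.
    by field; rewrite gt_eqF.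
  rewrite -/c sq rE /v /r /scale_time -/W.
  rewrite (_ : _ / _ = 2 * A * L / ((1 - eta ^+ 2) * lv) / W); last first.
    by field; rewrite !gt_eqF.
  rewrite ler_pdivrMr//.
  have BL : B1 * L <= W.
    by apply: le_trans WN; apply: le_trans N1; rewrite ler_pM2r// le_max lexx.
  apply: (@le_trans _ _ (c * (B1 * L))); last by rewrite ler_pM2l.
  rewrite le_eqVlt; apply/orP; left; apply/eqP; rewrite /B1; field.
  by rewrite !gt_eqF.
have rt0 : 0 <= scale_time t L 0 by exact/ltW/scale_time_gt0.
have rS k : (k < scale_count L)%N -> scale_time t L k < scale_time t L k.+1.
  by move=> _; exact: scale_time_lt.
apply: le_trans (no_large_increment (x := scale_level t L H) XL rt0 rS p_le) _.
rewrite lee_fin -[leRHS]lnK// ler_expR.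
have : - (4 * ln eps) <= B by rewrite le_max lexx orbT.
lra.
Qed.

End geometric_scales.

(** * From one small time to the almost sure upper limit *)

Section limsup_lower_bound.
Context {R : realType} (dT : measure_display) (T : measurableType dT) (P : probability T R).
Variables (d : nat) (X : R -> T -> d.-tuple R) (g : d.-tuple R).
Variable Pi : {measure set (d.-tuple R) -> \bar R}.
Variables (lam q : R) (h : R -> R).
Hypotheses (PiL : levy_measure Pi) (XL : is_levy_process P X g 0 Pi).
Hypotheses (lam0 : 0 < lam) (q0 : 0 <= q) (q1 : q < 1) (hq : Hq q h).

Let b (t : R) : R := Num.sqrt (t * ln (ln (1 / t))) / h (1 / t).

Hypothesis hV :
  ((lam ^+ 2 / 2)%:E <= limsup0 (fun t => (Vfun Pi (b t) * ((h (1 / t)) ^+ 2)%:E)%E))%E.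

Let f (w : T) (t : R) : \bar R :=
  (h (1 / t) * tnorm (X t w) / Num.sqrt (t * ln (ln (1 / t))))%:E.

(** The strict inequality [c < lam ^+ 2 / 2] is used twice: to find arbitrarily small [t] at which
    the product exceeds [c], and then a direction [z] nearly attaining the supremum in [Vfun]. A
    product exceeding [c > 0] also forces [h (1 / t)] to be positive. *)
Lemma large_variance_scale (L0 c : R) : 0 < c -> c < lam ^+ 2 / 2 ->
  exists t : R, [/\ 0 < t, L0 <= ln (ln (1 / t)), 0 < h (1 / t) &
    exists2 z : d.-tuple R, tnorm z <= 1 &
      ((c / h (1 / t) ^+ 2)%:E <=
        \int[Pi]_(y in [set y | (tnorm y <= b t)%R]) (tdot y z ^+ 2)%:E)%E].
Proof.
(* [t < expR (- expR L0)] is the same as [ln (ln (1 / t)) > L0]. *)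
move=> c0 hc; pose t0 := expR (- expR L0).
pose D := [set t : R | 0 < t /\ t < t0].
have D0 : (0 : R)^'+ D.
  have := @nbhs_right_lt R 0 t0 (expR_gt0 _).
  have := nbhs_right_gt (0 : R).
  by apply: filterS2 => t; split.
pose G (t : R) : \bar R := (Vfun Pi (b t) * (h (1 / t) ^+ 2)%:E)%E.
have : (c%:E < ereal_sup [set G t | t in D])%E.
  apply: (@lt_le_trans _ _ (limsup0 G)).
    by apply: lt_le_trans (hV : (_ <= limsup0 G)%E); rewrite lte_fin.
  by apply: ereal_inf_lbound; exists D.
move=> /ereal_sup_gt[_ [t [tp tt] <-]] hG; exists t.
have lnt : expR L0 <= ln (1 / t).
  by rewrite div1r lnV ?posrE// lerNr -(expRK (- expR L0)) ler_ln ?posrE ?expR_gt0// ltW.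
have e0 := expR_gt0 L0.
have L1 : L0 <= ln (ln (1 / t)).
  by rewrite -[leLHS]expRK ler_ln ?posrE// (lt_le_trans e0).
have ht0 : 0 <= h (1 / t).
  by have [[_ hpos _ _] _] := hq; apply: hpos; rewrite divr_ge0// ltW.
have ht : 0 < h (1 / t).
  rewrite lt_neqAle ht0 andbT; apply/eqP => E; move: hG.
  by rewrite /G -E expr0n mule0 lte_fin ltNge (ltW c0).
split => //.
have : ((c / h (1 / t) ^+ 2)%:E < Vfun Pi (b t))%E.
  move: hG; rewrite /G; case: (Vfun Pi (b t)) => [r| |] //=.
    by rewrite -EFinM !lte_fin ltr_pdivrMr// exprn_gt0.
    by rewrite ltry.
  by rewrite gt0_mulNye ?lte_fin ?exprn_gt0.
move=> /ereal_sup_gt[_ [z z1 <-]] hz; exists z => //; exact: ltW.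
Qed.

(** An increment is at most the sum of the norms at its two ends, and both ends obey the bound
    assumed on [f w], with [h (1 / s)] replaced by [h (1 / t)] at the cost of a factor [1 + eta].
    The threshold is uniform in the path and in the direction. *)
Lemma no_success_sub (eta tau a delta : R) :
  0 < eta -> eta <= 1 / 2 -> 0 < a -> 0 <= tau -> tau < 1 - q -> 0 < delta ->
  exists2 L0 : R, 0 < L0 & forall t : R, 0 < t -> L0 <= ln (ln (1 / t)) -> 0 < h (1 / t) ->
    forall z : d.-tuple R, tnorm z <= 1 -> forall w : T,
    (forall s : R, 0 < s -> s < delta -> (f w s < a%:E)%E) ->
    no_success X eta tau a z t (ln (ln (1 / t))) (h (1 / t)) w.
Proof.
move=> eta0 eta2 a0 tau0 tauq delta0.
have [L0 L0p hL0] := window_bounds hq tau0 tauq q0 eta0 delta0.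
exists L0 => // t t0 LL ht z z1 w hw k kN.
set L := ln (ln (1 / t)) in LL *; set H := h (1 / t) in ht *.
have Lp : 0 < L by exact: lt_le_trans LL.
have bound j : (j <= scale_count eta tau L)%N ->
    tnorm (X (scale_time eta tau t L j) w) <
    a * (1 + eta) * Num.sqrt (scale_time eta tau t L j * L) / H.
  move=> jN; set s := scale_time _ _ _ _ _.
  have s0 : 0 < s by exact: scale_time_gt0.
  have [hs1 hs2 [l1 l2] sd] := hL0 t t0 LL s (scale_time_ge tau eta0 eta2 L j t0)
    (scale_time_le eta0 eta2 t0 jN).
  have := hw s s0 sd; rewrite /f lte_fin.
  set y := Num.sqrt (s * ln (ln (1 / s))).
  have y0 : 0 < y by rewrite sqrtr_gt0 mulr_gt0.
  have yY : y <= Num.sqrt (s * L) by rewrite ler_wsqrtr// ler_pM2l.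
  rewrite ltr_pdivrMr// => hX.
  have X0 : 0 <= tnorm (X s w) by exact: sqrtr_ge0.
  rewrite ltr_pdivlMr// mulrC.
  apply: (@le_lt_trans _ _ ((1 + eta) * h (1 / s) * tnorm (X s w))).
    by rewrite ler_wpM2r.
  have e1 : 0 < 1 + eta by rewrite addr_gt0.
  rewrite -mulrA (mulrC a) -mulrA ltr_pM2l//; apply: lt_le_trans hX _.
  by rewrite ler_pM2l.
rewrite /= /projected_increment tdot_sub.
have kN' : (k.+1 <= scale_count eta tau L)%N by [].
apply: le_lt_trans (ler_normB _ _) _.
apply: (@le_lt_trans _ _ (tnorm (X (scale_time eta tau t L k.+1) w) +
    tnorm (X (scale_time eta tau t L k) w))).
  by apply: lerD; exact: normr_tdot_le.
apply: (lt_le_trans (ltrD (bound _ kN') (bound _ (ltnW kN')))).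
rewrite /scale_level [scale_time eta tau t L k](scale_timeS tau eta0 t L k).
set s := scale_time _ _ _ _ k.+1; have s0 : 0 < s by exact: scale_time_gt0.
have -> : Num.sqrt (s * eta ^+ 2 * L) = eta * Num.sqrt (s * L).
  rewrite (_ : s * eta ^+ 2 * L = eta ^+ 2 * (s * L)); last by ring.
  by rewrite sqrtrM ?sqr_ge0// sqrtr_sqr gtr0_norm.
by rewrite le_eqVlt; apply/orP; left; apply/eqP; ring.
Qed.

(** A path with upper limit below [a] stays below [a] on some interval [(0, delta)], hence belongs
    to all but finitely many of the events [G k], where [G k] has probability at most [k.+1%:R^-1].
    The set of such paths is then negligible as a subset of the lower limit of the [G k]; its own
    measurability is never at issue, nor is any independence between different [G k]. *)
Lemma limsup_ge_ae (a : R) : 0 < a -> a ^+ 2 < (1 - q) * lam ^+ 2 ->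
  {ae P, forall w, (a%:E <= limsup0 (f w))%E}.
Proof.
move=> a0 ha; have q10 : 0 < 1 - q by rewrite subr_gt0.
have lam20 : 0 < lam ^+ 2 by rewrite exprn_gt0.
pose rho := a ^+ 2 / ((1 - q) * lam ^+ 2).
have rho0 : 0 < rho by rewrite divr_gt0 ?exprn_gt0// mulr_gt0.
have rho1 : rho < 1 by rewrite ltr_pdivrMr ?mul1r// mulr_gt0.
(* small enough for [(1 + eta) ^+ 5 * rho < (1 - eta ^+ 2) * (1 - eta)] *)
pose eta := (1 - rho) / 40.
have eta0 : 0 < eta by rewrite /eta; lra.
have eta40 : 40 * eta = 1 - rho by rewrite /eta; field.
have eta2 : eta <= 1 / 2 by lra.
have e21 : 0 < 1 - eta ^+ 2 by nra.
(* Slightly less than [lam ^+ 2], which gives the strict inequality required by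
   [large_variance_scale]. *)
pose lv := (1 - eta) * lam ^+ 2.
have lv0 : 0 < lv by rewrite mulr_gt0//; lra.
have th_lt : scale_theta eta a lv < 1 - q.
  rewrite (_ : scale_theta eta a lv =
      (1 + eta) ^+ 5 * rho / ((1 - eta ^+ 2) * (1 - eta)) * (1 - q)); last first.
    rewrite /scale_theta /lv /rho; field; rewrite !gt_eqF//; lra.
  rewrite gtr_pMl// ltr_pdivrMr ?mul1r; last by rewrite mulr_gt0//; lra.
  have h2 : (1 + eta) ^+ 2 <= 1 + 3 * eta by nra.
  have h4 : (1 + eta) ^+ 4 <= 1 + 7 * eta.
    rewrite (_ : (1 + eta) ^+ 4 = (1 + eta) ^+ 2 * (1 + eta) ^+ 2); last by ring.
    have : 0 <= (1 + eta) ^+ 2 by exact: sqr_ge0.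
    by nra.
  have h5 : (1 + eta) ^+ 5 <= 1 + 9 * eta by rewrite exprS; nra.
  have : (1 + eta) ^+ 5 * rho <= (1 + 9 * eta) * rho by rewrite ler_pM2r.
  by nra.
have th0 : 0 <= scale_theta eta a lv.
  apply: mulr_ge0; first by lra.
  by rewrite divr_ge0 ?sqr_ge0// mulr_ge0// ltW.
pose tau := (scale_theta eta a lv + (1 - q)) / 2.
have [thtau tau0 tauq] : [/\ scale_theta eta a lv < tau, 0 <= tau & tau < 1 - q].
  by rewrite /tau; split; lra.
have key n : exists G : set T, [/\ measurable G, (P G <= (n.+1%:R^-1)%:E)%E &
    forall w, (forall s : R, 0 < s -> s < n.+1%:R^-1 -> (f w s < a%:E)%E) -> G w].
  have n0 : 0 < n.+1%:R^-1 :> R by rewrite invr_gt0.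
  have [L1 hL1] := no_success_small PiL XL eta0 eta2 a0 lv0 n0 thtau.
  have [L2 _ hL2] := no_success_sub eta0 eta2 a0 tau0 tauq n0.
  have c0 : 0 < lv / 2 by rewrite divr_gt0.
  have clam : lv / 2 < lam ^+ 2 / 2 by rewrite /lv; nra.
  have [t [t0 LL ht [z z1 hz]]] := large_variance_scale (Num.max L1 L2) c0 clam.
  move: LL; rewrite ge_max => /andP[LL1 LL2].
  exists (no_success X eta tau a z t (ln (ln (1 / t))) (h (1 / t))); split.
  - exact: (measurable_no_success XL).
  - apply: hL1 => //; apply: le_trans hz; rewrite lee_fin le_eqVlt; apply/orP; left.
    by apply/eqP; field; rewrite gt_eqF.
  - by move=> w; exact: hL2.
have [G hG] := choice key.
apply: (@negligibleS _ _ _ P (\bigcup_n \bigcap_(k in [set k | (n <= k)%N]) G k)); last first.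
  apply: negligible_bigcup => n.
  have mI : measurable (\bigcap_(k in [set k | (n <= k)%N]) G k).
    by apply: bigcap_measurableType => k _; have [] := hG k.
  exists (\bigcap_(k in [set k | (n <= k)%N]) G k); split => //.
  apply/eqP; rewrite eq_le measure_ge0 andbT.
  apply/lee_addgt0Pr => e e0; rewrite add0e.
  have [N _ hN] := near_infty_natSinv_lt (PosNum e0).
  have [mG PG _] := hG (maxn n N).
  apply: le_trans (_ : P (G (maxn n N)) <= _)%E.
    apply: le_measure; rewrite ?inE// => w; apply; exact: leq_maxl.
  by apply: (le_trans PG); rewrite lee_fin ltW// hN//= leq_maxr.
move=> w /= /negP; rewrite -ltNge => /ereal_inf_lt[_ [V V0 <-]] hVa.
have [r /= r0 hr] := V0.
have [N _ hN] := near_infty_natSinv_lt (PosNum r0).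
exists N => // k Nk; have [_ _] := hG k; apply => s s0 sk.
apply: le_lt_trans hVa; apply: ereal_sup_ubound; exists s => //.
apply: hr => //=; rewrite sub0r normrN gtr0_norm//.
exact: lt_trans sk (hN _ Nk).
Qed.

End limsup_lower_bound.

Lemma limsup0_ge0 (R : realType) (f : R -> \bar R) :
  (forall t, 0 < t -> (0 <= f t)%E) -> (0 <= limsup0 f)%E.
Proof.
move=> f0; apply: le_ereal_inf_tmp => _ [V [r /= r0 hr] <-].
have r2 : 0 < r / 2 by rewrite divr_gt0.
apply: le_trans (f0 _ r2) _; apply: ereal_sup_ubound; exists (r / 2) => //.
by apply: hr => //=; rewrite sub0r normrN gtr0_norm//; lra.
Qed.

Lemma ae_ge_of_lt d (T : measurableType d) (R : realType) (P : {measure set T -> \bar R})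
    (F : T -> \bar R) (c : R) : 0 < c ->
  (forall a : R, 0 < a -> a < c -> {ae P, forall w, (a%:E <= F w)%E}) ->
  {ae P, forall w, (c%:E <= F w)%E}.
Proof.
(* A sequence increasing to [c], reducing the claim to countably many levels; the index [n.+2] keeps
   its first term positive. *)
move=> c0 hF; pose a n := c * (1 - n.+2%:R^-1).
have inv0 n : 0 < n.+2%:R^-1 :> R by rewrite invr_gt0.
have inv1 n : n.+2%:R^-1 < 1 :> R by rewrite invf_lt1 ?ltr1n.
have /ae_foralln : forall n, {ae P, forall w, ((a n)%:E <= F w)%E}.
  move=> n; apply: hF; first by rewrite mulr_gt0// subr_gt0.
  by rewrite gtr_pMr// gtrBl.
apply: filterS => w hw; apply/lee_subgt0Pr => e e0.
have [n _ hn] := near_infty_natSinv_lt (PosNum (divr_gt0 e0 c0)).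
apply: le_trans (hw n); rewrite -EFinB lee_fin /a mulrBr mulr1 lerD2l lerN2.
rewrite mulrC -ler_pdivlMr//; apply: le_trans (ltW (hn n (leqnn n))).
by rewrite lef_pV2 ?posrE// ler_nat.
Qed.

Theorem theorem2p2 (R : realType) (dT : measure_display) (T : measurableType dT)
  (P : probability T R) (d : nat) (X : R -> T -> d.-tuple R)
  (g : d.-tuple R) (S : 'M[R]_d) (Pi : {measure set (d.-tuple R) -> \bar R})
  (lam q : R) (h : R -> R) :
  levy_measure Pi ->
  is_levy_process P X g S Pi ->
  S = 0 ->
  0 <= lam ->
  0 <= q <= 1 ->
  Hq q h ->
  let b := fun t : R => Num.sqrt (t * ln (ln (1 / t))) / h (1 / t) in
  ((lam ^+ 2 / 2)%:E <= limsup0 (fun t => (Vfun Pi (b t) * ((h (1 / t)) ^+ 2)%:E)%E))%E ->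
  {ae P, forall w, ((Num.sqrt (1 - q) * lam)%:E <=
     limsup0 (fun t => (h (1 / t) * tnorm (X t w) / Num.sqrt (t * ln (ln (1 / t))))%:E))%E}.
Proof.
move=> PiL XL S0 lam0 /andP[q0 q1] hq b hV; rewrite {}S0 in XL.
(* For [q = 1] or [lam = 0] the claimed bound is 0 and the quantity is nonnegative. In the remaining
   case a positive [tau < 1 - q] and a positive variance are available. *)
have [qe|qe] := eqVneq q 1.
  apply: aeW => w; rewrite qe subrr sqrtr0 mul0r; apply: limsup0_ge0 => t t0.
  rewrite lee_fin divr_ge0 ?sqrtr_ge0// mulr_ge0 ?sqrtr_ge0//.
  by have [[_ hpos _ _] _] := hq; apply: hpos; rewrite divr_ge0// ltW.
have [le|le] := eqVneq lam 0.
  apply: aeW => w; rewrite le mulr0; apply: limsup0_ge0 => t t0.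
  rewrite lee_fin divr_ge0 ?sqrtr_ge0// mulr_ge0 ?sqrtr_ge0//.
  by have [[_ hpos _ _] _] := hq; apply: hpos; rewrite divr_ge0// ltW.
have q11 : 0 < 1 - q by rewrite subr_gt0 lt_neqAle qe.
have lamp : 0 < lam by rewrite lt_neqAle eq_sym le.
have c0 : 0 < Num.sqrt (1 - q) * lam by rewrite mulr_gt0// sqrtr_gt0.
apply: ae_ge_of_lt => // a a0 ac.
have q1' : q < 1 by rewrite -subr_gt0.
apply: (limsup_ge_ae PiL XL lamp q0 q1' hq hV a0).
rewrite -[X in X * _](sqr_sqrtr (ltW q11)) -exprMn.
by rewrite ltr_sqr ?nnegrE ?ltW.
Qed.
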